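(* The trajectories of the sensors (agents) with dynamics $\dot p_i=u_i$ governed by the control law $$u_i=-k_{prop}\,\bigl(p_i-\tilde C_{(V_i\cap\bar B(p_i,R_i))}\bigr),\qquad i=1,\dots,N,$$ with positive gain $k_{prop}$, starting from any initial condition $\mathcal{P}(0)$, will asymptotically converge to the critical points of $\tilde{\mathcal{H}}$.
   Context: $Q\subset\mathbb{R}^d$ is a convex polytope (the search space), and $\phi_n:Q\to[0,1]$ is the continuous uncertainty density at the $n$-th search step, with $n$ fixed. $\mathcal{P}=\{p_1,\dots,p_N\}$, with $p_i\in Q$ and $p_i\neq p_j$ for $i\neq j$, is the configuration of $N$ agents, where $p_i=p_i(t)$ is the position of agent $i$ at time $t$. For each $i$, the sensor detection function $\beta_i$, with values in $[0,1]$, is a monotonically increasing analytic function of the Euclidean distance from agent $i$. The node function of agent $i$ is $f_i=1-\beta_i$, which is analytic and strictly decreasing. The generalized Voronoi cells are $$V_i=\{q\in Q: f_i(\|p_i-q\|)\ge f_j(\|p_j-q\|)\ \ \forall j\neq i\},$$ and they are recomputed from the current positions as the agents move. Sensor $i$ has limited range $R_i$, and $\bar B(p_i,R_i)$ is the closed ball of radius $R_i$ centered at $p_i$. Sensor $i$ has access to information only from points of $V_i\cap\bar B(p_i,R_i)$. It is assumed that $f_i(R_i)=f_j(R_j)$ for all $i,j\in\{1,\dots,N\}$. Let $\tilde f_i(r)=f_i(r)$ if $r\le R_i$ and $\tilde f_i(r)=f_i(R_i)$ otherwise. The objective function to be maximized is $$\tilde{\mathcal{H}}(\mathcal{P})=\sum_{i}\int_{V_i\cap\bar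 B(p_i,R_i)}\phi_n(q)\,\tilde f_i(\|p_i-q\|)\,dQ .$$ With $r_i=\|q-p_i\|$, let $\tilde\phi_n(q)=-\phi_n(q)\frac{\partial f_i(r_i)}{\partial (r_i^2)}\ge 0$ for $q\in V_i\cap\bar B(p_i,R_i)$. Then $\tilde M_{(V_i\cap\bar B(p_i,R_i))}$ and $\tilde C_{(V_i\cap\bar B(p_i,R_i))}$ denote the mass and the centroid of $V_i\cap\bar B(p_i,R_i)$ with $\tilde\phi_n$ as density. The source states the gradient of the objective function as $$\frac{\partial\tilde{\mathcal{H}}}{\partial p_i}(\mathcal{P})=2\tilde M_{(V_i\cap\bar B(p_i,R_i))}\bigl(\tilde C_{(V_i\cap\bar B(p_i,R_i))}-p_i\bigr).$$
   Formalization: Critical points are zeros of the stated gradient 2M(C−p) (the true gradient has an extra boundary term, so the literal claim fails); limits may have coinciding agents; zero mass means C=p; for d=1, masses are assumed finite and cells of agents at distinct positions to overlap negligibly. *)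

(* Defs.v *)
From HB Require Import structures.
From mathcomp Require Import all_boot all_order all_algebra.
From mathcomp Require Import all_classical all_reals all_analysis.

Set Implicit Arguments.
Unset Strict Implicit.
Unset Printing Implicit Defensive.

Import Order.TTheory GRing.Theory Num.Theory.
Import numFieldNormedType.Exports.

Local Open Scope classical_set_scope.
Local Open Scope ring_scope.

(** * Lebesgue measure on [R^d]

    The library has Lebesgue measure on the line and binary products.  The
    d-dimensional measure is the iterated product, transported to d-tuples
    along [(x, q) |-> x :: q]. *)

Section tuple_cons_measure.
Context {R : realType} (n : nat).
Local Notation realT := (measurableTypeR R).

Definition tuple_cons (u : (realT * n.-tuple realT)%type) : n.+1.-tuple realT :=
  [the n.+1.-tuple realT of u.1 :: u.2].

Lemma measurable_tuple_cons : measurable_fun [set: _] tuple_cons.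
Proof. by apply: measurable_cons; [exact: measurable_fst|exact: measurable_snd]. Qed.

Variable m : {sigma_finite_measure set (n.-tuple realT) -> \bar R}.

Let leb1 : {sigma_finite_measure set realT -> \bar R} := lebesgue_measure.

Let leb1m : {measure set (realT * n.-tuple realT)%type -> \bar R} :=
  product_measure1 leb1 m.

Definition cons_measure (A : set (n.+1.-tuple realT)) : \bar R :=
  pushforward leb1m tuple_cons A.

Let cons_measure0 : cons_measure set0 = 0%E.
Proof. by rewrite /cons_measure /pushforward preimage_set0 measure0. Qed.

Let cons_measure_ge0 A : (0 <= cons_measure A)%E.
Proof. by rewrite /cons_measure /pushforward measure_ge0. Qed.

Let cons_measure_sigma_additive : semi_sigma_additive cons_measure.
Proof.
move=> F mF tF mUF; rewrite /cons_measure /pushforward preimage_bigcup.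
apply: measure_semi_sigma_additive.
- by move=> k; rewrite -[X in measurable X]setTI; exact: measurable_tuple_cons.
- apply/trivIsetP => /= i j _ _ ij; rewrite -preimage_setI.
  by move/trivIsetP : tF => /(_ _ _ _ _ ij) ->//; rewrite preimage_set0.
- rewrite -preimage_bigcup -[X in measurable X]setTI.
  exact: measurable_tuple_cons.
Qed.

HB.instance Definition _ := isMeasure.Build _ _ _ cons_measure
  cons_measure0 cons_measure_ge0 cons_measure_sigma_additive.

Let cons_measure_sigma_finite : sigma_finite setT cons_measure.
Proof.
have /sigma_finiteP[F [FT ndF Foo]] := sigma_finiteT leb1.
have /sigma_finiteP[G [GT ndG Goo]] := sigma_finiteT m.
pose tl (x : n.+1.-tuple realT) : (realT * n.-tuple realT)%type :=
  (tnth x ord0, [tuple of behead x]).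
have tlK : cancel tuple_cons tl.
  by move=> [x y]; rewrite /tl /tuple_cons; congr pair; exact: val_inj.
have mtl : measurable_fun setT tl.
  apply/measurable_fun_pairP; split.
    exact: (measurable_tnth ord0).
  exact: measurable_behead.
exists (fun k => tl @^-1` (F k `*` G k)).
  apply/seteqP; split=> // u _.
  have [k _ Fk] : (\bigcup_k F k) (tl u).1 by rewrite -FT.
  have [l _ Gl] : (\bigcup_k G k) (tl u).2 by rewrite -GT.
  exists (maxn k l) => //; split.
    by move: Fk; exact/subsetPset/ndF/leq_maxl.
  by move: Gl; exact/subsetPset/ndG/leq_maxr.
move=> k; have [mF Fk] := Foo k; have [mG Gk] := Goo k; split.
  by rewrite -[X in measurable X]setTI; apply: mtl => //; exact: measurableX.
rewrite /cons_measure /pushforward -comp_preimage.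
rewrite (_ : tl \o tuple_cons = id); last exact/funext/tlK.
rewrite preimage_id /= product_measure1E//.
by rewrite lte_mul_pinfty// ge0_fin_numE.
Qed.

HB.instance Definition _ := Measure_isSigmaFinite.Build _ _ _ cons_measure
  cons_measure_sigma_finite.

End tuple_cons_measure.

Fixpoint lebesgue_tuple (R : realType) (d : nat) :
    {sigma_finite_measure set (d.-tuple (measurableTypeR R)) -> \bar R} :=
  if d is n.+1 then cons_measure (lebesgue_tuple R n) else \d_[tuple].

(** * Euclidean space, polytopes, analytic functions

    Points of [R^d] are row vectors; the norm the library puts on them is the
    sup norm (which only matters through the topology), hence [enorm]. *)

Section euclidean.
Context {R : realType} {d : nat}.

Definition dotp (x y : 'rV[R]_d) : R := \sum_(k < d) x 0 k * y 0 k.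

Definition enorm (x : 'rV[R]_d) : R := Num.sqrt (dotp x x).

Definition closed_eball (c : 'rV[R]_d) (r : R) : set 'rV[R]_d :=
  [set q | enorm (q - c) <= r].

Definition convex_polytope (Q : set 'rV[R]_d) : Prop :=
  exists (n : nat) (v : 'I_n.+1 -> 'rV[R]_d),
    Q = [set q | exists w : 'I_n.+1 -> R,
           [/\ forall j, 0 <= w j,
               \sum_j w j = 1 &
               q = \sum_j w j *: v j]].

Definition tuple_vec (q : d.-tuple (measurableTypeR R)) : 'rV[R]_d :=
  \row_k tnth q k.

Definition vol_int (S : set 'rV[R]_d) (h : 'rV[R]_d -> R) : R :=
  \int[lebesgue_tuple R d]_(q in tuple_vec @^-1` S) h (tuple_vec q).

Definition vol_integrable (S : set 'rV[R]_d) (h : 'rV[R]_d -> R) : Prop :=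
  (lebesgue_tuple R d).-integrable (tuple_vec @^-1` S)
    (fun q => (h (tuple_vec q))%:E).

End euclidean.

(** Real analyticity on [0, +oo), the domain of a function of a distance; at
    the endpoint 0 the expansion is only required on the right. *)
Definition analytic_nonneg {R : realType} (f : R -> R) : Prop :=
  forall x, 0 <= x -> exists (a : nat -> R) (r : R),
    0 < r /\
    forall y, 0 <= y -> `|y - x| < r -> pseries a (y - x) @ \oo --> f y.

(** * Coverage by sensors of limited range

    [Q] is the search space, [phi] the uncertainty density, [beta i] the
    detection function of agent [i] and [rng i] its range.  A configuration is
    represented by the family [P] of the agents' positions. *)

Section coverage.
Context {R : realType} {d N : nat}.
Variables (Q : set 'rV[R]_d) (phi : 'rV[R]_d -> R).
Variables (beta : 'I_N -> R -> R) (rng : 'I_N -> R).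
Implicit Types (P X Y : 'I_N -> 'rV[R]_d) (i j : 'I_N).

Definition node i (r : R) : R := 1 - beta i r.

Definition node_trunc i (r : R) : R :=
  if r <= rng i then node i r else node i (rng i).

Definition configuration P : Prop :=
  (forall i, Q (P i)) /\ (forall i j, i != j -> P i != P j).

Definition voronoi P i : set 'rV[R]_d :=
  [set q | Q q /\ forall j, j != i ->
     node j (enorm (P j - q)) <= node i (enorm (P i - q))].

Definition sensed P i : set 'rV[R]_d :=
  voronoi P i `&` closed_eball (P i) (rng i).

Definition objective P : R :=
  \sum_i vol_int (sensed P i)
           (fun q => phi q * node_trunc i (enorm (P i - q))).

(** [node i] as a function of the squared distance [s = r ^ 2].  Its
    derivative is only used at [s > 0], i.e. off the single point [P i]. *)
Definition node_sq i (s : R) : R := node i (Num.sqrt s).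

Definition density P i (q : 'rV[R]_d) : R :=
  - phi q * derive1 (node_sq i) (enorm (q - P i) ^+ 2).

Definition mass P i : R := vol_int (sensed P i) (density P i).

Definition moment P i : 'rV[R]_d :=
  \row_k vol_int (sensed P i) (fun q => q 0 k * density P i q).

(** A region of zero mass has no centroid; the convention is then that the
    "centroid" is the agent's own position, so that an agent which senses no
    density does not move. *)
Definition centroid P i : 'rV[R]_d :=
  if mass P i == 0 then P i else (mass P i)^-1 *: moment P i.

(** [g] is the gradient of the objective with respect to the position of
    agent [i], the other agents being fixed. *)
Definition is_gradient P i (g : 'rV[R]_d) : Prop :=
  is_diff (P i) (fun x : 'rV[R]_d => objective (dfwith P i x)) (dotp g).

(** The stated value of the gradient of the objective.  It accounts for the
    variation of the integrands; when the common value [node i (rng i)] is not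
    0 the spheres bounding the sensed regions may contribute a further term to
    the derivative of [objective], hence [is_gradient] is kept separate. *)
Definition objective_gradient P i : 'rV[R]_d :=
  (2 * mass P i) *: (centroid P i - P i).

(** Coinciding agents are allowed here: trajectories consist of
    configurations, but these could accumulate at a collision. *)
Definition critical_point X : Prop :=
  (forall i, Q (X i)) /\ (forall i, objective_gradient X i = 0).

(** Two facts that are automatic for [d >= 2], where [1 / |q - p|] is locally
    integrable and the tie set of two agents at distinct positions is
    negligible, but that can fail on the line: there the mass is infinite
    around an agent whose node function has nonzero slope at 0, and the node
    functions [f] and [f (. + c)] tie on a half-line for agents at distance
    [c]. *)
Definition finite_masses : Prop :=
  forall X, (forall i, Q (X i)) -> forall i,
    vol_integrable (sensed X i) (density X i).

Definition negligible_overlaps : Prop :=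
  forall X, (forall i, Q (X i)) -> forall i j, X i != X j ->
    lebesgue_tuple R d (tuple_vec @^-1` (voronoi X i `&` voronoi X j)) = 0%E.

(** Classical solutions on [0, +oo) of the closed loop
    [p_i' = - k (p_i - C_i(P))], staying among the configurations. *)
Definition trajectory (k : R) (P : R -> 'I_N -> 'rV[R]_d) : Prop :=
  [/\ forall t : R, 0 <= t -> configuration (P t),
      forall i, P s i @[s --> 0^'+] --> P 0 i &
      forall (t : R) i, 0 < t ->
        is_derive t (1 : R) (fun s : R => P s i) (- k *: (P t i - centroid (P t) i))].

End coverage.

(* Main.v *)
Require Import Defs.
From HB Require Import structures.
From mathcomp Require Import all_boot all_order all_algebra.
From mathcomp Require Import all_classical all_reals all_analysis.
From mathcomp Require Import measurable_realfun ring lra.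

Set Implicit Arguments.
Unset Strict Implicit.
Unset Printing Implicit Defensive.

Import Order.TTheory GRing.Theory Num.Theory.
Import numFieldNormedType.Exports.

Local Open Scope classical_set_scope.
Local Open Scope ring_scope.

(** The objective is not the function that the flow increases: moving an agent also
    moves the spheres bounding the sensed regions, and when the common value
    [c = f_i(R_i)] is not 0 this contributes to the variation of the objective. The
    Lyapunov function used here is
<<
      L(X) = \int_Q phi(q) max(0, max_i (f_i(|q - x_i|) - c)) dq,
>>
    whose integrand is [f_i(|q - x_i|) - c] on the region [W_i(X)] sensed by agent [i] and
    0 where nothing is sensed, so that it vanishes on the boundary of the covered region.

    Let [M_i] and [C_i] be the masses and centroids and [D(X) = \sum_i M_i |C_i - x_i|^2].
    For a configuration [X] and any [Y],
<<
      L(Y) - L(X) >= \sum_i \int_(W_i(X)) phi(q) (f_i(|q - y_i|) - f_i(|q - x_i|)) dq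
>>
    because the maximum defining [L(Y)] can only exceed the value given by the agent that was
    in charge for [X] ([lyapunov_increment]). The regions on the right do not move, so
    dominated convergence gives its rate along a solution ([gain_rate]): it is [2 k D].
    A continuous function whose upper right Dini derivatives exceed [m] grows at
    least at speed [m] ([dini_growth]), hence [L] is nondecreasing along the flow and increases
    at speed almost [2 k D] ([energy_growth]).

    The conclusion is LaSalle's argument ([flow_converges]). If the solution were far from
    the critical points at arbitrarily large times, compactness of [Q] would give a
    noncritical cluster value [X0]. Near [X0] the dissipation [D] is bounded below
    ([dissipation_lower]) and the speeds are bounded, so every visit close to [X0] would raise
    [L] by a fixed amount, but [L] is bounded.

    The lower bound on [D] is the delicate point, since agents may merge at [X0], where
    masses and centroids are discontinuous. It is obtained for the first moments
    [G_i = M_i (C_i - x_i)], which satisfy [|G_i|^2 <= M_i D]: as [X] tends to [X0], the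
    sum of the [G_j] over the agents [j] that end up at the position of agent [i] with
    the same node function tends to [G_i(X0)] ([arm_moment_limit]). This uses that two
    agents tie on a null set only. If their positions differ and [1 < d], the tie
    set has, off a null hyperplane, disjoint translates in suitable directions ([tie_vnull];
    on a line the negligibility is assumed); if the positions agree but the node functions
    do not, the tie set is a union of spheres whose radii are the
    isolated zeros of an analytic function ([analytic_zeros_vnull]). It also uses that
    masses are bounded uniformly in [X]: for [1 < d] the density is [O(1 / |q - x_i|)], whose
    integral is bounded ([mass_bounded]); on a line, either the density is bounded or
    integrability forces [phi] to vanish on the whole region ([mass_bounded_line]).

    The characterization of the critical points by the differential of the objective only
    needs that a linear form [dotp g] determines [g] ([is_gradient_unique]). *)

(** * Lebesgue measure: translations, boxes, null sets *)

Section translation.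
Context {R : realType}.
Local Notation realT := (measurableTypeR R).

(** Both sides are measures in [A] that agree on half-open intervals. *)
Lemma lebesgue_measure_translate (c : R) (A : set realT) : measurable A ->
  lebesgue_measure ((fun x : realT => x + c) @^-1` A) = lebesgue_measure A.
Proof.
have mc : measurable_fun setT (fun x : realT => x + c : realT).
  exact: measurable_funD.
move=> mA; apply/esym.
apply: (@lebesgue_measure_unique R (pushforward lebesgue_measure (fun x : realT => x + c : realT))) => // X.
move=> [[a b] _ <-] /=.
rewrite /pushforward (_ : _ @^-1` _ = `]a - c, b - c]%classic); last first.
  by apply/seteqP; split=> x /=; rewrite !in_itv /= ltrBlDr lerBrDr.
rewrite !lebesgue_measure_itv /= !lte_fin ltrD2r; case: ifP => // _.
by rewrite -!EFinD; congr (_%:E); ring.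
Qed.

Definition tuple_shift n (w : 'I_n -> R) (q : n.-tuple realT) : n.-tuple realT :=
  [tuple tnth q k + w k | k < n].

Lemma measurable_tuple_shift n (w : 'I_n -> R) :
  measurable_fun setT (tuple_shift w).
Proof.
apply/measurable_fun_tnthP => k.
rewrite (_ : _ \o _ = fun q => tnth q k + w k); last first.
  by apply/funext => q; rewrite /= tnth_mktuple.
by apply: measurable_funD => //; exact: measurable_tnth.
Qed.

Lemma tuple_shift_cons n (w : 'I_n.+1 -> R) (u : realT * n.-tuple realT) :
  tuple_shift w (tuple_cons u) =
  tuple_cons (u.1 + w ord0, tuple_shift (fun k => w (lift ord0 k)) u.2).
Proof.
apply: eq_from_tnth => k; rewrite tnth_mktuple.
case: (unliftP ord0 k) => [j|] ->; rewrite /tuple_cons ?tnthS ?tnth0 //.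
by rewrite tnth_mktuple.
Qed.

(** The measure of a set is the integral of the measures of its sections, and translating
    the set translates each section as well as the variable of integration. *)
Lemma lebesgue_tuple_shift n (w : 'I_n -> R) (A : set (n.-tuple realT)) :
  measurable A ->
  lebesgue_tuple R n (tuple_shift w @^-1` A) = lebesgue_tuple R n A.
Proof.
elim: n w A => [|n IH] w A mA.
  congr (lebesgue_tuple R 0 _).
  by apply/seteqP; split=> q /=; rewrite (tuple0 (tuple_shift _ _)) (tuple0 q).
pose B := @tuple_cons R n @^-1` A.
have mB : measurable B.
  by rewrite -[X in measurable X]setTI; exact: measurable_tuple_cons.
have secE x : xsection (@tuple_cons R n @^-1` (tuple_shift w @^-1` A)) x =
    tuple_shift (fun k => w (lift ord0 k)) @^-1` xsection B (x + w ord0).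
  apply/seteqP; split=> q; rewrite /xsection /= !inE /B /=.
    by rewrite tuple_shift_cons.
  by rewrite tuple_shift_cons.
change (\int[lebesgue_measure]_x lebesgue_tuple R n
    (xsection (@tuple_cons R n @^-1` (tuple_shift w @^-1` A)) x) =
  \int[lebesgue_measure]_x lebesgue_tuple R n (xsection B x))%E.
pose G x := lebesgue_tuple R n (xsection B x).
have mG : measurable_fun setT G by exact: measurable_fun_xsection.
pose tr (x : realT) : realT := x + w ord0.
have mc : measurable_fun setT tr.
  exact: measurable_funD.
transitivity (\int[lebesgue_measure]_x (G \o tr) x)%E.
  apply: eq_integral => x _; rewrite secE /= /G IH //.
  exact: measurable_xsection.
rewrite -[LHS](@ge0_integral_pushforward _ _ _ _ R _ mc lebesgue_measure setT G) //.
apply: eq_measure_integral => E mE _.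
exact: lebesgue_measure_translate.
Qed.

End translation.

Section volume.
Context {R : realType} {d : nat}.
Local Notation realT := (measurableTypeR R).
Implicit Types (S : set 'rV[R]_d) (q w : 'rV[R]_d).

Definition vol S : \bar R := lebesgue_tuple R d (tuple_vec @^-1` S).

(** Measurability is that of tuples: vectors carry a topology, but the measure lives on
    tuples and is transported by [tuple_vec]. *)
Definition vmeasurable S : Prop :=
  measurable (tuple_vec @^-1` S : set (d.-tuple realT)).

Lemma measurable_coord (k : 'I_d) :
  measurable_fun setT (fun x : d.-tuple realT => tuple_vec x 0 k : realT).
Proof.
rewrite (_ : (fun _ => _) = (fun x : d.-tuple realT => tnth x k)).
  exact: measurable_tnth.
by apply/funext => x; rewrite mxE.
Qed.

Lemma vmeasurable_box (a b : 'I_d -> R) :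
  vmeasurable [set q | forall k, a k < q 0 k < b k].
Proof.
rewrite /vmeasurable (_ : _ @^-1` _ = \bigcap_(k in [set: 'I_d])
   ((fun x : d.-tuple realT => tuple_vec x 0 k) @^-1` `]a k, b k[%classic)).
  apply: fin_bigcap_measurable => [|k _]; first exact: finite_finset.
  rewrite -[X in measurable X]setTI.
  by apply: measurable_coord => //; exact: measurable_itv.
apply/seteqP; split=> x /=.
  by move=> H k _ /=; rewrite in_itv /=; exact: H.
by move=> H k; have := H k I; rewrite /= in_itv.
Qed.

(** The topology of vectors and the product sigma-algebra of tuples are defined independently;
    they are related through the countable base of cubes with rational centers. *)
Lemma open_vmeasurable (U : set 'rV[R]_d) : open U -> vmeasurable U.
Proof.
move=> oU.
pose c (i : 'rV[rat]_d * nat) : 'rV[R]_d := map_mx ratr i.1.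
pose B (i : 'rV[rat]_d * nat) : set 'rV[R]_d := 
  [set q | forall k, c i 0 k - i.2.+1%:R^-1 < q 0 k < c i 0 k + i.2.+1%:R^-1].
have -> : U = \bigcup_i (if `[< B i `<=` U >] then B i else set0).
  apply/seteqP; split=> q; last first.
    by move=> [i _]; case: asboolP => // sub; exact: sub.
  move=> Uq; move: oU => /(_ _ Uq)/nbhs_ballP[e /= e0 eU].
  have [n ne] : exists n, n.+1%:R^-1 < e / 2.
    have e20 : 0 < e / 2 by rewrite divr_gt0.
    have [n _ nP] := near_infty_natSinv_lt (PosNum e20).
    by exists n; apply: (nP n) => /=.
  have n0 : 0 < n.+1%:R^-1 :> R by rewrite invr_gt0.
  have /choice[r rP] : forall k, exists x : rat,
      ratr x \in `]q 0 k - n.+1%:R^-1, q 0 k + n.+1%:R^-1[.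
    by move=> k; apply: rat_in_itvoo; rewrite ltrBlDr -addrA ltrDl addr_gt0.
  exists (\row_k r k, n) => //.
  case: asboolP => [_|].
    by move=> k /=; rewrite !mxE; rewrite ltrBlDr -[X in _ && X]ltrBlDr andbC; have := rP k; rewrite in_itv.
  case=> x Bx; apply: eU; split=> // i j; rewrite (ord1 i) /ball /=.
  have := Bx j; have := rP j; rewrite /c /= !mxE in_itv /=.
  move: (n.+1%:R^-1) ne n0 => u ue u0 /andP[? ?] /andP[? ?].
  by rewrite ltr_norml; apply/andP; split; lra.
rewrite /vmeasurable preimage_bigcup; apply: countable_bigcupT_measurable.
  exact: countableP.
move=> i; case: asboolP => _; first exact: vmeasurable_box.
by rewrite preimage_set0.
Qed.

Lemma closed_vmeasurable (K : set 'rV[R]_d) : closed K -> vmeasurable K.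
Proof.
move=> cK; rewrite /vmeasurable -(setCK K) preimage_setC; apply: measurableC.
by apply: (@open_vmeasurable (~` K)); exact: closed_openC.
Qed.

Lemma within_continuous_vmeasurable_fun (D : set 'rV[R]_d) (h : 'rV[R]_d -> R) :
  vmeasurable D -> {within D, continuous h} ->
  measurable_fun (tuple_vec @^-1` D) (h \o tuple_vec : d.-tuple realT -> realT).
Proof.
move=> mD /continuousP ch.
apply: (measurability (@RGenOInfty.G R)) => [|/= _ [_] [r] -> <-].
  exact: RGenOInfty.measurableE.
have oh : open (from_subspace D h @^-1` `]r, +oo[) by apply: ch; exact: interval_open.
have [V oV VE] := iffLR (open_subspaceP _ _) oh.
have -> : tuple_vec @^-1` D `&` (h \o tuple_vec) @^-1` `]r, +oo[ =
   tuple_vec @^-1` V `&` tuple_vec @^-1` D.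
  by rewrite -preimage_setI VE setIC.
by apply: measurableI => //; exact: open_vmeasurable.
Qed.

Lemma vol_translate S w : vmeasurable S -> vol [set q | S (q + w)] = vol S.
Proof.
move=> mS; rewrite /vol -[in RHS](lebesgue_tuple_shift (fun k => w 0 k)) //.
congr (lebesgue_tuple R d _); apply/seteqP; split=> x /=.
  by congr S; apply/rowP => k; rewrite !mxE tnth_mktuple.
by congr S; apply/rowP => k; rewrite !mxE tnth_mktuple.
Qed.

End volume.

Section boxes.
Context {R : realType}.
Local Notation realT := (measurableTypeR R).

Lemma measurable_tuple_box n (a b : 'I_n -> R) :
  measurable [set x : n.-tuple realT | forall k, a k <= tnth x k <= b k].
Proof.
rewrite (_ : mkset _ = \bigcap_(k in [set: 'I_n])
   ((fun x : n.-tuple realT => tnth x k) @^-1` `[a k, b k]%classic)).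
  apply: fin_bigcap_measurable => [|k _]; first exact: finite_finset.
  rewrite -[X in measurable X]setTI.
  by apply: measurable_tnth => //; exact: measurable_itv.
apply/seteqP; split=> x /=.
  by move=> H k _ /=; rewrite in_itv /=; exact: H.
by move=> H k; have := H k I; rewrite /= in_itv.
Qed.

Lemma lebesgue_tuple_box n (a b : 'I_n -> R) : (forall k, a k <= b k) ->
  lebesgue_tuple R n [set x | forall k, a k <= tnth x k <= b k] =
  (\prod_k (b k - a k))%:E.
Proof.
elim: n a b => [|n IH] a b ab.
  rewrite big_ord0 /= diracE (_ : _ \in _) //.
  by rewrite inE => -[].
pose A : set (n.-tuple realT) :=
  [set x | forall k, a (lift ord0 k) <= tnth x k <= b (lift ord0 k)].
have mA : measurable A by exact: measurable_tuple_box.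
pose leb : {sigma_finite_measure set realT -> \bar R} := lebesgue_measure.
transitivity ((leb \x lebesgue_tuple R n) (`[a ord0, b ord0] `*` A))%E.
  rewrite -[LHS]/((leb \x lebesgue_tuple R n)%E (@tuple_cons R n @^-1` _)).
  congr (_ _); apply/seteqP; split=> -[x y] /=.
    move=> H; split; first by have := H ord0; rewrite tnth0 in_itv.
    by move=> k; have := H (lift ord0 k); rewrite tnthS.
  move=> [+ Ay] k; rewrite in_itv /= => abx.
  by case: (unliftP ord0 k) => [j|] ->; rewrite ?tnthS ?tnth0.
rewrite product_measure1E //.
have mab : leb `[a ord0, b ord0]%classic = (b ord0 - a ord0)%:E.
  rewrite -[LHS]/(lebesgue_measure `[a ord0, b ord0]%classic).
  rewrite lebesgue_measure_itv /= lte_fin.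
  have := ab ord0; rewrite le_eqVlt => /orP[/eqP ->|->]; by rewrite ?ltxx ?subrr.
by rewrite [X in (X * _)%E]mab IH // -EFinM big_ord_recl.
Qed.

End boxes.

Section null_sets.
Context {R : realType} {d : nat}.
Local Notation realT := (measurableTypeR R).
Implicit Types (S : set 'rV[R]_d) (q w : 'rV[R]_d).

Lemma vol_box (a b : 'I_d -> R) : (forall k, a k <= b k) ->
  vol [set q : 'rV[R]_d | forall k, a k <= q 0 k <= b k] =
  (\prod_k (b k - a k))%:E.
Proof.
move=> ab; rewrite -(lebesgue_tuple_box ab); congr (lebesgue_tuple R d _).
by apply/seteqP; split=> x /= H k; have := H k; rewrite mxE.
Qed.

Lemma vmeasurable_cbox (a b : 'I_d -> R) :
  vmeasurable [set q : 'rV[R]_d | forall k, a k <= q 0 k <= b k].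
Proof.
rewrite /vmeasurable (_ : _ @^-1` _ =
  [set x : d.-tuple realT | forall k, a k <= tnth x k <= b k]).
  exact: measurable_tuple_box.
by apply/seteqP; split=> x /= H k; have := H k; rewrite mxE.
Qed.

Definition bounded_in S (K : R) := forall q, S q -> forall k, `|q 0 k| <= K.

Lemma bounded_vol_lty S K : vmeasurable S -> bounded_in S K -> (vol S < +oo)%E.
Proof.
move=> mS bS; pose K' : R := `|K|.
have K0 : - K' <= K' by rewrite ge0_cp // normr_ge0.
apply: (@le_lt_trans _ _ (vol [set q | forall k, - K' <= q 0 k <= K'])).
  apply: le_measure; rewrite ?inE //; first exact: vmeasurable_cbox.
  move=> x /= Sx k.
  by rewrite -ler_norml (le_trans (bS _ Sx k)) // ler_norm.
by rewrite (vol_box (a := fun=> - K') (b := fun=> K')) // ltry.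
Qed.

End null_sets.

Lemma cvg_sumr {R : realType} {T : Type} (F : set_system T) (I : Type)
    (r : seq I) (P : pred I) (f : I -> T -> R) (a : I -> R) :
  Filter F -> (forall i, P i -> f i x @[x --> F] --> a i) ->
  \sum_(i <- r | P i) f i x @[x --> F] --> \sum_(i <- r | P i) a i.
Proof. by move=> FF fa; apply: cvg_big => //; exact: (@add_continuous R^o). Qed.

(** * Euclidean norm *)

Section euclidean_facts.
Context {R : realType} {d : nat}.
Implicit Types (x y z : 'rV[R]_d) (a : R).

Lemma dotpC x y : dotp x y = dotp y x.
Proof. by apply: eq_bigr => k _; rewrite mulrC. Qed.

Lemma dotpDl x y z : dotp (x + y) z = dotp x z + dotp y z.
Proof. by rewrite -big_split; apply: eq_bigr => k _; rewrite !mxE mulrDl. Qed.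

Lemma dotpZl a x y : dotp (a *: x) y = a * dotp x y.
Proof. by rewrite mulr_sumr; apply: eq_bigr => k _; rewrite !mxE mulrA. Qed.

Lemma dotpNl x y : dotp (- x) y = - dotp x y.
Proof. by rewrite -scaleN1r dotpZl mulN1r. Qed.

Lemma dotpDr x y z : dotp x (y + z) = dotp x y + dotp x z.
Proof. by rewrite dotpC dotpDl !(dotpC x). Qed.

Lemma dotpZr a x y : dotp x (a *: y) = a * dotp x y.
Proof. by rewrite dotpC dotpZl (dotpC x). Qed.

Lemma dotpNr x y : dotp x (- y) = - dotp x y.
Proof. by rewrite dotpC dotpNl (dotpC x). Qed.

Lemma dotp0l x : dotp 0 x = 0.
Proof. by rewrite -(scale0r 0) dotpZl mul0r. Qed.

Definition dotpE := (dotpDl, dotpDr, dotpNl, dotpNr, dotpZl, dotpZr).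

Lemma dotp_ge0 x : 0 <= dotp x x.
Proof. by apply: sumr_ge0 => k _; rewrite -expr2 sqr_ge0. Qed.

Lemma dotp_eq0 x : (dotp x x == 0) = (x == 0).
Proof.
apply/idP/eqP => [|->]; last by rewrite dotp0l.
rewrite psumr_eq0 => [/allP H|k _]; last by rewrite -expr2 sqr_ge0.
apply/rowP => k; rewrite mxE; have := H k (mem_index_enum k).
by rewrite mulf_eq0 orbb => /eqP.
Qed.

Lemma enorm_ge0 x : 0 <= enorm x.
Proof. exact: sqrtr_ge0. Qed.

Lemma sqr_enorm x : enorm x ^+ 2 = dotp x x.
Proof. by rewrite sqr_sqrtr // dotp_ge0. Qed.

Lemma enorm0 : enorm (0 : 'rV[R]_d) = 0.
Proof. by rewrite /enorm dotp0l sqrtr0. Qed.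

Lemma enorm_eq0 x : (enorm x == 0) = (x == 0).
Proof. by rewrite -sqrf_eq0 sqr_enorm dotp_eq0. Qed.

Lemma enorm_gt0 x : (0 < enorm x) = (x != 0).
Proof. by rewrite lt_def enorm_eq0 enorm_ge0 andbT. Qed.

Lemma enormN x : enorm (- x) = enorm x.
Proof. by rewrite /enorm dotpNl dotpNr opprK. Qed.

Lemma enormBC x y : enorm (x - y) = enorm (y - x).
Proof. by rewrite -enormN opprB. Qed.

Lemma enormZ a x : enorm (a *: x) = `|a| * enorm x.
Proof.
by rewrite /enorm dotpZl dotpZr mulrA -expr2 sqrtrM ?sqr_ge0 // sqrtr_sqr.
Qed.

(** Cauchy-Schwarz: expand the square norm of [dotp y y *: x - dotp x y *: y]. *)
Lemma dotp_le_enorm x y : dotp x y <= enorm x * enorm y.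
Proof.
have [->|y0] := eqVneq y 0; first by rewrite dotpC dotp0l enorm0 mulr0.
have b0 : 0 < dotp y y by rewrite lt_def dotp_ge0 dotp_eq0 y0.
have := dotp_ge0 (dotp y y *: x - dotp x y *: y).
rewrite !dotpE (dotpC y x) => H.
apply: le_trans (ler_norm _) _.
rewrite -(@ler_pXn2r _ 2) ?nnegrE ?mulr_ge0 ?enorm_ge0 //.
rewrite exprMn !sqr_enorm real_normK ?num_real //.
rewrite -(ler_pM2l b0); nra.
Qed.

Lemma enormD x y : enorm (x + y) <= enorm x + enorm y.
Proof.
rewrite -(@ler_pXn2r _ 2) ?nnegrE ?addr_ge0 ?enorm_ge0 //.
rewrite sqrrD !sqr_enorm !dotpE (dotpC y x).
have := dotp_le_enorm x y; lra.
Qed.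

Lemma enorm_dist x y : `|enorm x - enorm y| <= enorm (x - y).
Proof.
rewrite ler_norml; apply/andP; split.
  have := enormD x (y - x); rewrite addrC subrK (enormBC y); lra.
have := enormD y (x - y); rewrite addrC subrK; lra.
Qed.

Lemma coord_le_enorm x k : `|x 0 k| <= enorm x.
Proof.
rewrite -(@ler_pXn2r _ 2) ?nnegrE ?enorm_ge0 // real_normK ?num_real //.
rewrite sqr_enorm /dotp (bigD1 k) //= expr2 lerDl.
by apply: sumr_ge0 => j _; rewrite -expr2 sqr_ge0.
Qed.

Lemma enorm_le_sum x : enorm x <= \sum_k `|x 0 k|.
Proof.
have s0 : 0 <= \sum_k `|x 0 k| by apply: sumr_ge0.
rewrite -(@ler_pXn2r _ 2) ?nnegrE ?enorm_ge0 // sqr_enorm expr2 mulr_suml.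
apply: ler_sum => k _; apply: (le_trans (ler_norm _)); rewrite normrM.
by rewrite ler_wpM2l // (bigD1 k) //= lerDl sumr_ge0.
Qed.

Lemma continuous_coord_sub x k : continuous (fun q : 'rV[R]_d => (q - x) 0 k).
Proof.
have -> : (fun q : 'rV[R]_d => (q - x) 0 k) = (fun q => q 0 k - x 0 k).
  by apply/funext => q; rewrite !mxE.
move=> q; apply: continuousB; last exact: cst_continuous.
exact: coord_continuous.
Qed.

Lemma continuous_dotp_sub x y :
  continuous (fun q : 'rV[R]_d => dotp (q - x) (q - y)).
Proof.
apply: continuous_big => [|k _ q]; first exact: (@add_continuous R^o).
by apply: continuousM; exact: continuous_coord_sub.
Qed.

Lemma continuous_dotp y z : continuous (fun q : 'rV[R]_d => dotp y (q - z)).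
Proof.
apply: continuous_big => [|k _ q]; first exact: (@add_continuous R^o).
by apply: continuousM; [exact: cst_continuous|exact: continuous_coord_sub].
Qed.

Lemma continuous_enorm_sub x : continuous (fun q : 'rV[R]_d => enorm (q - x)).
Proof.
move=> q; exact: (continuous_comp (@continuous_dotp_sub x x q) (@sqrt_continuous R _)).
Qed.

End euclidean_facts.

(** * Null sets from disjoint translates *)

Section wandering.
Context {R : realType} {d : nat}.
Local Notation realT := (measurableTypeR R).
Implicit Types (S : set 'rV[R]_d) (q w x y : 'rV[R]_d).

Definition vnull S : Prop := (lebesgue_tuple R d).-negligible (tuple_vec @^-1` S).

Lemma vmeasurableI S T : vmeasurable S -> vmeasurable T -> vmeasurable (S `&` T).
Proof. by move=> mS mT; rewrite /vmeasurable preimage_setI; exact: measurableI. Qed.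

Lemma vnullS S T : S `<=` T -> vnull T -> vnull S.
Proof. by move=> ST; apply: negligibleS => x; exact: ST. Qed.

Lemma vnullU S T : vnull S -> vnull T -> vnull (S `|` T).
Proof. exact: negligibleU. Qed.

Lemma vnull_bigcup (F : (set 'rV[R]_d)^nat) :
  (forall n, vnull (F n)) -> vnull (\bigcup_n F n).
Proof. by move=> F0; rewrite /vnull preimage_bigcup; exact: negligible_bigcup. Qed.

Lemma vnull_countable_bigcup (I : countType) (F : I -> set 'rV[R]_d) :
  (forall i, vnull (F i)) -> vnull (\bigcup_i F i).
Proof.
move=> F0.
pose G n : set 'rV[R]_d := if @unpickle I n is Some i then F i else set0.
apply: (@vnullS _ (\bigcup_n G n)).
  by move=> q [i _ Fq]; exists (pickle i) => //; rewrite /G pickleK.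
apply: vnull_bigcup => n; rewrite /G; case: unpickle => [i|]; first exact: F0.
by rewrite /vnull preimage_set0; exact: negligible_set0.
Qed.

Lemma vnull_bigcup_fin (I : finType) (F : I -> set 'rV[R]_d) :
  (forall i, vnull (F i)) -> vnull (\bigcup_i F i).
Proof. exact: vnull_countable_bigcup. Qed.

Lemma vnull_vol S : vmeasurable S -> vnull S <-> vol S = 0%E.
Proof. by move=> mS; exact: negligibleP. Qed.

(** Infinitely many translates of [S] by small multiples of [w] are disjoint, have the same
    volume and lie in a common box, which has finite volume. This replaces polar coordinates
    and Fubini in all the null set arguments below. *)
Lemma wandering_vnull S (K : R) w :
  vmeasurable S -> bounded_in S K ->
  (forall q s, 0 < s -> S q -> ~ S (q + s *: w)) -> vnull S.
Proof.
move=> mS bS wS; apply/vnull_vol => //.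
pose c (n : nat) : R := n.+1%:R^-1.
pose A n := [set q | S (q + c n *: w)].
have mA n : vmeasurable (A n).
  rewrite /vmeasurable (_ : _ @^-1` _ =
      tuple_shift (fun k => (c n *: w) 0 k) @^-1` (tuple_vec @^-1` S)); last first.
    apply/seteqP; split=> x /=; congr S; apply/rowP => k;
      by rewrite !mxE tnth_mktuple ?mxE.
  by rewrite -[X in measurable X]setTI; exact: measurable_tuple_shift.
have vA n : vol (A n) = vol S by exact: vol_translate.
have c_dec m n : (m < n)%N -> c n < c m.
  by move=> mn; rewrite /c ltf_pV2 ?posrE ?ltr0n // ltr_nat ltnS.
have disj : trivIset setT (fun n => tuple_vec @^-1` (A n) : set (d.-tuple realT)).
  apply/trivIsetP => m n _ _ mn; apply/seteqP; split=> // x [].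
  wlog ltmn : m n mn / (m < n)%N.
    move=> H Am An; case: (ltngtP m n) => [mn'|nm|eq_mn].
    - exact: (H m n).
    - by apply: (H n m) => //; rewrite eq_sym.
    - by rewrite eq_mn eqxx in mn.
  rewrite /A /= => Am An.
  apply: (wS (tuple_vec x + c n *: w) (c m - c n)) => //.
    by rewrite subr_gt0 c_dec.
  by rewrite -addrA -scalerDl [_ + (_ - _)]addrC subrK.
pose K' := K + enorm w.
have bA n q : A n q -> forall k, `|q 0 k| <= K'.
  move=> Aq k; have := bS _ Aq k; rewrite !mxE.
  have : `|c n * w 0 k| <= enorm w.
    rewrite normrM -[leRHS]mul1r ler_pM // ?coord_le_enorm //.
    by rewrite /c ger0_norm ?invr_ge0 // invf_le1 ?ltr0n // ler1n.
  rewrite /K'; move: (c n * w 0 k) => z.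
  rewrite !ler_norml => /andP[? ?] /andP[? ?].
  by apply/andP; split; lra.
pose B : set 'rV[R]_d := [set q | forall k, - `|K'| <= q 0 k <= `|K'|].
have Boo : (vol B < +oo)%E.
  apply: (@bounded_vol_lty _ _ _ `|K'|); first exact: vmeasurable_cbox.
  by move=> q Bq k; rewrite ler_norml Bq.
have le_n n : (n%:R%:E * vol S <= vol B)%E.
  have -> : (n%:R%:E * vol S = \sum_(i < n) vol (A i))%E.
    under eq_bigr do rewrite vA.
    by rewrite big_const_ord iter_addr addr0 mule_natl.
  rewrite -[leLHS](@measure_bigsetU_ord _ _ _ (lebesgue_tuple R d) n xpredT
     (fun i : 'I_n => tuple_vec @^-1` (A i))).
  - apply: le_measure; rewrite ?inE.
    + by apply: bigsetU_measurable => i _; exact: mA.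
    + exact: vmeasurable_cbox.
    + move=> x; rewrite -(bigcup_mkord n (fun i => tuple_vec @^-1` A i)) => -[i _].
      move=> /bA /= H k.
      by rewrite -ler_norml (le_trans (H k)) // ler_norm.
  - by move=> i; exact: mA.
  - by apply/trivIsetP => i j _ _ ij; have /trivIsetP := disj; apply => //.
have vS : vol S \is a fin_num.
  rewrite ge0_fin_numE; last exact: measure_ge0.
  by apply: le_lt_trans Boo; have := le_n 1%N; rewrite mul1e.
have vB : vol B \is a fin_num.
  by rewrite ge0_fin_numE //; exact: measure_ge0.
have v0 : 0 <= fine (vol S) by apply: fine_ge0; exact: measure_ge0.
rewrite -(fineK vS); congr (_%:E); apply/eqP; rewrite eq_le v0 andbT leNgt.
apply/negP => vp.
have [n nP] : exists n : nat, fine (vol B) / fine (vol S) < n%:R.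
  by exists (Num.trunc (fine (vol B) / fine (vol S))).+1; exact: Num.Theory.truncnS_gt.
have := le_n n; rewrite -(fineK vS) -(fineK vB) -EFinM lee_fin.
by rewrite leNgt -ltr_pdivrMr // nP.
Qed.

End wandering.

Section level_sets.
Context {R : realType} {d : nat}.
Implicit Types (B S : set 'rV[R]_d) (p q w x y : 'rV[R]_d).

(** Distances increase along [w] in the half-space where [w] points away from [p]. *)
Lemma sqr_enorm_shift q p w (s : R) : enorm (q + s *: w - p) ^+ 2 =
  enorm (q - p) ^+ 2 + 2 * s * dotp w (q - p) + s ^+ 2 * enorm w ^+ 2.
Proof.
have -> : q + s *: w - p = (q - p) + s *: w by rewrite addrAC.
rewrite !sqr_enorm (dotpDl (q - p)) !(dotpDr _ (q - p)) !dotpZl !dotpZr.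
rewrite (dotpC (q - p) w); ring.
Qed.

Lemma lt_enorm p q : (enorm p < enorm q) = (enorm p ^+ 2 < enorm q ^+ 2).
Proof. by rewrite ltr_pXn2r // nnegrE enorm_ge0. Qed.

Lemma closed_dotp_ge w p : closed [set q : 'rV[R]_d | 0 <= dotp w (q - p)].
Proof.
exact: (@preimage_closed _ _ (fun q => dotp w (q - p)) [set r | 0 <= r]
  (fun x _ => @continuous_dotp R d w p x) (@closed_ge R 0)).
Qed.

Lemma closed_dotp_eq w p : closed [set q : 'rV[R]_d | dotp w (q - p) = 0].
Proof.
exact: (@preimage_closed _ _ (fun q => dotp w (q - p)) [set 0]
  (fun x _ => @continuous_dotp R d w p x) (@closed_eq R 0)).
Qed.

Lemma open_dotp_gt w p : open [set q : 'rV[R]_d | 0 < dotp w (q - p)].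
Proof.
exact: (@open_comp _ _ (fun q => dotp w (q - p)) [set r | 0 < r]
  (fun x _ => @continuous_dotp R d w p x) (@open_gt R 0)).
Qed.

Lemma open_dotp_lt w p : open [set q : 'rV[R]_d | dotp w (q - p) < 0].
Proof.
exact: (@open_comp _ _ (fun q => dotp w (q - p)) [set r | r < 0]
  (fun x _ => @continuous_dotp R d w p x) (@open_lt R 0)).
Qed.

Lemma bounded_inI B S K : bounded_in B K -> bounded_in (B `&` S) K.
Proof. by move=> bB q [/bB]. Qed.

(** Each of the two half-spheres cut by a hyperplane through the center is wandering in the
    direction normal to the hyperplane. *)
Lemma sphere_vnull B K p (r : R) : (0 < d)%N ->
  vmeasurable B -> bounded_in B K -> vnull (B `&` [set q | enorm (q - p) = r]).
Proof.
move=> d0 mB bB.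
pose e : 'rV[R]_d := \row_k (k == Ordinal d0)%:R.
have e1 : enorm e ^+ 2 = 1.
  rewrite sqr_enorm /dotp (bigD1 (Ordinal d0)) //= big1 ?addr0.
    by rewrite mxE eqxx mulr1.
  by move=> k /negbTE k0; rewrite !mxE k0 mul0r.
have half w : enorm w ^+ 2 = 1 -> vnull ((B `&` [set q | enorm (q - p) = r])
    `&` [set q | 0 <= dotp w (q - p)]).
  move=> w1; apply: (@wandering_vnull _ _ _ K w).
  - apply: vmeasurableI; last by apply: closed_vmeasurable; exact: closed_dotp_ge.
    apply: vmeasurableI => //; apply: closed_vmeasurable.
    exact: (@preimage_closed _ _ (fun q => enorm (q - p)) [set r]
      (fun x _ => @continuous_enorm_sub R d p x) (@closed_eq R r)).
  - exact/bounded_inI/bounded_inI.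
  - move=> q s s0 [[_ /= qr] wq] [[_ /= qsr] _].
    have := sqr_enorm_shift q p w s; rewrite qr qsr w1.
    by have : 0 < s ^+ 2 by [exact: exprn_gt0|]; nra.
apply: (vnullS _ (vnullU (half e e1) (half (- e) _))); last by rewrite enormN.
move=> q Bq; case: (lerP 0 (dotp e (q - p))) => H; [left|right]; split=> //=.
by rewrite dotpNl oppr_ge0 ltW.
Qed.

Lemma point_vnull p : (0 < d)%N -> vnull [set p].
Proof.
move=> d0; have c1 : vmeasurable [set p].
  rewrite (_ : [set p] = [set q | forall k, p 0 k <= q 0 k <= p 0 k]).
    exact: vmeasurable_cbox.
  apply/seteqP; split=> q /=; first by move=> -> k; rewrite lexx.
  by move=> qp; apply/rowP => k; apply/eqP; rewrite eq_le andbC qp.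
have b1 : bounded_in [set p] (enorm p).
  by move=> q -> k; exact: coord_le_enorm.
apply: vnullS (@sphere_vnull [set p] _ p 0 d0 c1 b1) => q -> /=.
by split=> //=; rewrite subrr enorm0.
Qed.

Lemma hyperplane_vnull B K p w : vmeasurable B -> bounded_in B K -> w != 0 ->
  vnull (B `&` [set q | dotp w (q - p) = 0]).
Proof.
move=> mB bB w0; apply: (@wandering_vnull _ _ _ K w).
- apply: vmeasurableI => //; apply: closed_vmeasurable; exact: closed_dotp_eq.
- exact: bounded_inI.
- move=> q s s0 [_ /= wq] [_ /=]; rewrite addrAC dotpDr wq dotpZr add0r => /eqP.
  by rewrite mulf_eq0 gt_eqF //= dotp_eq0 (negbTE w0).
Qed.

(** Gives the study of ties its second direction, which a line does not have. *)
Lemma exists_orthogonal (u : 'rV[R]_d) : (1 < d)%N ->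
  exists2 v : 'rV[R]_d, v != 0 & dotp v u = 0.
Proof.
move=> d1; pose i0 := Ordinal (ltnW d1); pose i1 := Ordinal d1.
pose v (a b : R) : 'rV[R]_d := \row_k (if k == i0 then a else if k == i1 then b else 0).
have vu a b : dotp (v a b) u = a * u 0 i0 + b * u 0 i1.
  rewrite /dotp (bigD1 i0) //= (bigD1 i1) //= big1 ?addr0; first by rewrite !mxE.
  by move=> k /andP[/negbTE k0 /negbTE k1]; rewrite mxE k0 k1 mul0r.
have v0 a b : v a b = 0 -> a = 0 /\ b = 0.
  by move=> /rowP vE; have := vE i0; have := vE i1; rewrite !mxE.
have [u0|u0] := eqVneq (u 0 i0) 0.
  exists (v 1 0); last by rewrite vu u0; ring.
  by apply/eqP => /v0[/eqP]; rewrite oner_eq0.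
exists (v (u 0 i1) (- u 0 i0)); last by rewrite vu; ring.
by apply/eqP => /v0[_ /eqP]; rewrite oppr_eq0 (negbTE u0).
Qed.

(** Where the direction [w] points away from [p] and towards [p'], moving along [w] decreases the
    left-hand side and increases the right-hand side of the tie equation, so the tie set
    is wandering there. With [u = p' - p] and [v] orthogonal to [u], a point off the
    hyperplane [dotp v (q - p) = 0] is in that situation for some [w = u + s v] with [s]
    rational, and the hyperplane is null. *)
Lemma tie_vnull B K p p' (f g : R -> R) : (1 < d)%N ->
  closed B -> bounded_in B K -> p != p' ->
  continuous (fun q : 'rV[R]_d => f (enorm (q - p))) ->
  continuous (fun q : 'rV[R]_d => g (enorm (q - p'))) ->
  (forall r s, 0 <= r -> r < s -> f s < f r) ->
  (forall r s, 0 <= r -> r < s -> g s < g r) ->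
  vnull (B `&` [set q | f (enorm (q - p)) = g (enorm (q - p'))]).
Proof.
move=> d1 cB bB pp' cf cg f_dec g_dec.
set T := B `&` _; pose u := p' - p.
have cT : closed T.
  apply: closedI => //.
  have -> : [set q | f (enorm (q - p)) = g (enorm (q - p'))] =
      (fun q : 'rV[R]_d => f (enorm (q - p)) - g (enorm (q - p'))) @^-1` [set 0].
    apply/seteqP; split=> q /= => [->|/eqP]; first by rewrite subrr.
    by rewrite subr_eq0 => /eqP.
  apply: preimage_closed (@closed_eq R 0) => x _.
  by apply: continuousB; [exact: cf|exact: cg].
have bT : bounded_in T K by exact: bounded_inI.
have [v v0 vu] := exists_orthogonal u d1.
have uu : 0 < dotp u u by rewrite lt_def dotp_ge0 dotp_eq0 subr_eq0 eq_sym pp'.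
pose w (s : rat) := u + ratr s *: v.
pose slab s := T `&` ([set q | 0 < dotp (w s) (q - p)] `&` [set q | dotp (w s) (q - p') < 0]).
apply: (@vnullS _ _ _ ((B `&` [set q | dotp v (q - p) = 0]) `|` \bigcup_s slab s)).
  move=> q Tq; have [z0|z0] := eqVneq (dotp v (q - p)) 0.
    by left; split=> //; case: Tq.
  right; pose z := dotp v (q - p); pose a := dotp u (q - p).
  (* as v is orthogonal to u, the products of w with q - p and q - p' are a + s z and
     a + s z - |u|^2 *)
  have [s sP] : exists s : rat, 0 < a + ratr s * z < dotp u u.
    case: (ltrP 0 z) => zs.
      have /rat_in_itvoo[s] : - a / z < (dotp u u - a) / z.
        by rewrite ltr_pM2r ?invr_gt0 //; lra.
      rewrite in_itv /= ltr_pdivrMr // ltr_pdivlMr // => /andP[s1 s2].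
      by exists s; apply/andP; split; lra.
    have {}zs : z < 0 by rewrite lt_neqAle z0.
    have /rat_in_itvoo[s] : (dotp u u - a) / z < - a / z.
      by rewrite ltr_nM2r ?invr_lt0 //; lra.
    rewrite in_itv /= ltr_ndivrMr // ltr_ndivlMr // => /andP[s1 s2].
    by exists s; apply/andP; split; lra.
  have wE y : dotp (w s) y = dotp u y + ratr s * dotp v y.
    by rewrite /w dotpDl dotpZl.
  exists s => //; split=> //; split=> /=; rewrite wE.
    by case/andP: sP.
  have -> : q - p' = (q - p) - u by rewrite /u opprB addrA subrK.
  by rewrite !(dotpDr _ (q - p)) !(dotpNr _ u) vu -/a -/z; case/andP: sP; lra.
apply: vnullU; first exact: hyperplane_vnull (closed_vmeasurable cB) bB v0.
apply: vnull_countable_bigcup => s; apply: (@wandering_vnull _ _ _ K (w s)).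
- apply: vmeasurableI; first exact: closed_vmeasurable.
  apply: vmeasurableI; apply: open_vmeasurable; first exact: open_dotp_gt.
  exact: open_dotp_lt.
- exact: bounded_inI.
- move=> q t t0 [[_ /= qT] [/= qp qp']] [[_ /= qT'] [/= _ qp'2]].
  have w0 : w s != 0 by apply: contraTneq qp => ->; rewrite dotp0l ltxx.
  have tw0 : 0 < t ^+ 2 * enorm (w s) ^+ 2.
    by rewrite mulr_gt0 ?exprn_gt0 // enorm_gt0.
  have up : enorm (q - p) < enorm (q + t *: w s - p).
    rewrite lt_enorm sqr_enorm_shift -addrA ltrDl.
    by apply: addr_gt0; [exact/mulr_gt0/qp/mulr_gt0|exact: tw0].
  have up' : enorm (q + t *: w s - p') < enorm (q - p').
    move: qp'2; set q2 := q + _ => qp'2.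
    have := sqr_enorm_shift q2 p' (w s) (- t).
    have -> : q2 + (- t) *: w s - p' = q - p' by rewrite scaleNr addrK.
    rewrite lt_enorm => ->; rewrite -[ltRHS]addrA ltrDl sqrrN.
    apply: addr_gt0; last exact: tw0.
    by rewrite mulrN mulNr oppr_gt0 pmulr_rlt0 // mulr_gt0.
  have := f_dec _ _ (enorm_ge0 _) up; have := g_dec _ _ (enorm_ge0 _) up'.
  by rewrite qT qT'; lra.
Qed.

End level_sets.

(** * Integrability of the inverse distance *)

Section newtonian_bound.
Context {R : realType} {d : nat}.
Local Notation realT := (measurableTypeR R).
Implicit Types (B : set 'rV[R]_d) (p q : 'rV[R]_d).

Lemma continuous_vmeasurable_fun (h : 'rV[R]_d -> R) : continuous h ->
  measurable_fun setT (h \o tuple_vec : d.-tuple realT -> realT).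
Proof.
move=> ch; rewrite -(preimage_setT (tuple_vec : d.-tuple realT -> 'rV[R]_d)).
apply: within_continuous_vmeasurable_fun; first exact: open_vmeasurable openT.
exact: continuous_subspaceT.
Qed.

(** Radial densities may be singular at their center, hence continuity away from 0 only. *)
Lemma measurable_radial (g : R -> R) p : (forall r, 0 < r -> {for r, continuous g}) ->
  measurable_fun setT (fun x : d.-tuple realT => g (enorm (tuple_vec x - p)) : realT).
Proof.
move=> cg; pose G : realT -> realT := g.
have mg : measurable_fun (`]0, +oo[%classic `|` [set 0] : set realT) G.
  apply/measurable_funU => //; split; last exact: measurable_fun_set1.
  apply: open_continuous_measurable_fun; first exact: interval_open.
  by move=> r; rewrite inE /= in_itv /= andbT => /cg.
apply: (measurable_comp _ _ mg) => //.
- exact: measurableU.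
- move=> _ [x _ <-]; have := enorm_ge0 (tuple_vec x - p).
  rewrite le_eqVlt => /orP[/eqP <-|x0]; first by right.
  by left; rewrite /= in_itv /= x0.
- exact: continuous_vmeasurable_fun (@continuous_enorm_sub R d p).
Qed.

(** A crude bound of order [e ^ 2], valid in all dimensions at least 2, obtained by boxing
    the ball in two coordinates only and [B] in the others. *)
Lemma vol_ball_le B K : (1 < d)%N -> vmeasurable B -> bounded_in B K ->
  exists2 C : R, 0 <= C & forall p e, 0 < e ->
    (vol (B `&` [set q | (enorm (q - p) <= e)%R]) <= (C * e ^+ 2)%:E)%E.
Proof.
move=> d1 mB bB.
pose i0 := Ordinal (ltnW d1); pose i1 := Ordinal d1.
pose K' : R := `|K|.
exists (4 * \prod_(k < d | (k != i0) && (k != i1)) (2 * K')).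
  by rewrite mulr_ge0 // prodr_ge0 // => k _; rewrite mulr_ge0 // normr_ge0.
move=> p e e0.
pose a k := if (k != i0) && (k != i1) then - K' else p 0 k - e.
pose b k := if (k != i0) && (k != i1) then K' else p 0 k + e.
apply: (@le_trans _ _ (vol [set q : 'rV[R]_d | forall k, a k <= q 0 k <= b k])).
  apply: le_measure; rewrite ?inE.
  - apply: vmeasurableI => //; apply: closed_vmeasurable.
    exact: (@preimage_closed _ _ (fun q => enorm (q - p)) [set r | r <= e]
      (fun x _ => @continuous_enorm_sub R d p x) (@closed_le R e)).
  - exact: vmeasurable_cbox.
  - move=> x [/= /bB Bx xe] k; rewrite /a /b; case: ifP => _.
      by rewrite -ler_norml (le_trans (Bx k)) // ler_norm.
    have := le_trans (coord_le_enorm _ k) xe.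
    by rewrite !mxE ler_norml => /andP[? ?]; apply/andP; split; lra.
rewrite vol_box.
  have ab0 : b i0 - a i0 = 2 * e by rewrite /a /b eqxx /=; ring.
  have ab1 : b i1 - a i1 = 2 * e by rewrite /a /b eqxx andbF; ring.
  rewrite lee_fin (bigD1 i0) //= (bigD1 i1) //= ab0 ab1.
  rewrite (eq_bigr (fun=> 2 * K')); last by move=> k H; rewrite /a /b H; ring.
  by rewrite le_eqVlt; apply/orP; left; apply/eqP; ring.
move=> k; rewrite /a /b; case: ifP => _; last lra.
by rewrite ge0_cp // normr_ge0.
Qed.

(** On dyadic balls the inverse distance is at most [2 ^ (k + 1)] while the volume is of order
    [4 ^ - k], which sums to a bound independent of the pole [p]. *)
Lemma integral_inv_dist_le B K : (1 < d)%N -> vmeasurable B -> bounded_in B K ->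
  exists C : R, forall p,
    (\int[lebesgue_tuple R d]_(x in tuple_vec @^-1` B)
        ((enorm (tuple_vec x - p))^-1)%:E <= C%:E)%E.
Proof.
move=> d1 mB bB; have [C C0 hC] := vol_ball_le d1 mB bB.
have vB : vol B \is a fin_num.
  by rewrite ge0_fin_numE ?measure_ge0 //; exact: bounded_vol_lty mB bB.
exists (fine (vol B) + 4 * C) => p.
pose mu := lebesgue_tuple R d; pose D : set (d.-tuple realT) := tuple_vec @^-1` B.
pose A k : set (d.-tuple realT) := [set x | enorm (tuple_vec x - p) <= (2 ^ k)%:R^-1].
have mA k : measurable (A k).
  apply: (@closed_vmeasurable _ _ [set q | enorm (q - p) <= (2 ^ k)%:R^-1]).
  exact: (@preimage_closed _ _ (fun q => enorm (q - p)) [set r | r <= (2 ^ k)%:R^-1]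
      (fun x _ => @continuous_enorm_sub R d p x) (@closed_le R _)).
pose u k (x : d.-tuple realT) : \bar R := ((2 ^ k.+1)%:R * \1_(A k) x)%:E.
have mu_ k : measurable_fun D (u k).
  by apply/measurable_EFinP; apply: measurable_funM => //.
have u0 k x : (0 <= u k x)%E by rewrite lee_fin mulr_ge0.
have minv : measurable_fun D (fun x => ((enorm (tuple_vec x - p))^-1)%:E).
  apply/measurable_EFinP; apply: (measurable_funS measurableT) => //.
  apply: (@measurable_radial (fun r => r^-1)) => r r0.
  by apply: inv_continuous; rewrite gt_eqF.
have ptw x : D x -> (((enorm (tuple_vec x - p))^-1)%:E <=
    1 + \sum_(0 <= k <oo) u k x)%E.
  move=> _; set r := enorm _.
  have r0 : 0 <= r by exact: enorm_ge0.
  have sum0 : (0 <= \sum_(0 <= k <oo) u k x)%E by apply: nneseries_ge0.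
  have [r1|r1] := leP 1 r.
    apply: (@le_trans _ _ 1%E); last by rewrite leeDl.
    by rewrite lee_fin invf_le1 // (lt_le_trans _ r1).
  have [->|rn0] := eqVneq r 0; first by rewrite invr0 adde_ge0.
  have rp : 0 < r by rewrite lt_def rn0.
  have exk : exists k, (2 ^ k.+1)%:R^-1 < r.
    have [n _ nP] := near_infty_natSinv_lt (PosNum rp).
    exists n; apply: le_lt_trans (nP n (leqnn n)).
    rewrite lef_pV2 ?posrE ?ltr0n ?expn_gt0 // ler_nat.
    by apply: ltnW; exact: ltn_expl.
  have := ex_minnP exk; case=> k kr kmin.
  have rk : r <= (2 ^ k)%:R^-1.
    case: k kr kmin => [|k] kr kmin; first by rewrite expn0 invr1 ltW.
    by rewrite leNgt; apply/negP => /kmin; rewrite ltnn.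
  apply: (@le_trans _ _ (u k x)).
    rewrite /u lee_fin indicE mem_set // mulr1.
    by rewrite -[leRHS]invrK lef_pV2 ?posrE ?invr_gt0 ?ltr0n ?expn_gt0 // ltW.
  apply: (@le_trans _ _ (\sum_(0 <= k <oo) u k x)%E); last by rewrite leeDr.
  apply: le_trans (nneseries_lim_ge k.+1 _) => //.
  by rewrite big_nat_recr //= leeDr // sume_ge0.
apply: le_trans (ge0_le_integral mu mB _ minv _ ptw) _.
- by move=> x _; rewrite lee_fin invr_ge0 enorm_ge0.
- apply: emeasurable_funD => //; apply: ge0_emeasurable_sum => //.
rewrite ge0_integralD //=; last 2 first.
- by move=> x _; exact: nneseries_ge0.
- exact: ge0_emeasurable_sum.
rewrite integral_cst // mul1e integral_nneseries // EFinD.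
apply: leeD.
  by rewrite fineK.
apply: le_trans (epsilon_trick0 xpredT (_ : 0 <= 4 * C)); last by rewrite mulr_ge0.
apply: lee_nneseries => [k _ _|k _]; first exact: integral_ge0.
rewrite (integralZl_indic mB (fun=> A k)) //; last by rewrite ltNge ler0n.
rewrite integral_indic // setIC.
apply: (@le_trans _ _ ((2 ^ k.+1)%:R%:E * (C * (2 ^ k)%:R^-1 ^+ 2)%:E)%E).
  apply: lee_wpmul2l; first by rewrite lee_fin.
  by apply: hC; rewrite invr_gt0 ltr0n expn_gt0.
rewrite -EFinM lee_fin !natrX exprS le_eqVlt; apply/orP; left; apply/eqP.
have : (2 : R) ^+ k != 0 by rewrite expf_neq0.
by move: (2 ^+ k) => z z0; field.
Qed.

End newtonian_bound.

(** * Analytic functions on the half-line *)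

Section power_series.
Context {R : realType}.
Implicit Types (a : R^nat) (x y z r : R).

Definition pssum a z : R := limn (pseries a z).

(** Bounds the terms of the derived series by those of the original one at a larger radius. *)
Lemma bernoulli_pow x h n : 0 <= x -> 0 <= h ->
  n.+1%:R * x ^+ n * h <= (x + h) ^+ n.+1.
Proof.
move=> x0 h0; elim: n => [|n IH]; first by rewrite expr0 mulr1 mul1r expr1 lerDr.
rewrite [leRHS]exprS [leRHS]mulrDl.
have xhn : x ^+ n.+1 <= (x + h) ^+ n.+1 by rewrite lerXn2r ?nnegrE ?addr_ge0 // lerDl.
have -> : n.+2%:R * x ^+ n.+1 * h = x * (n.+1%:R * x ^+ n * h) + h * x ^+ n.+1.
  by rewrite -natr1 exprS; ring.
by apply: lerD; apply: ler_wpM2l.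
Qed.

Lemma is_cvg_pseries_diffs a K z : cvgn (pseries a K) -> `|z| < `|K| ->
  cvgn (pseries (pseries_diffs a) z).
Proof.
move=> aK zK; pose w := (`|z| + `|K|) / 2.
have zw : `|z| < w by rewrite /w; lra.
have wK : w < `|K| by rewrite /w; lra.
have w0 : 0 <= w by rewrite (le_trans (normr_ge0 z)) // ltW.
have h0 : 0 < w - `|z| by rewrite subr_gt0.
have cw : cvgn (pseries (fun i => `|a i|) w).
  by apply: is_cvg_pseries_inside_norm aK _; rewrite ger0_norm.
apply: normed_cvg.
pose v : R^nat := fun i => (w - `|z|)^-1 * (`|a i.+1| * w ^+ i.+1).
apply: (@series_le_cvg _ _ v) => [n|n|n|].
- exact: normr_ge0.
- by rewrite /v mulr_ge0 ?mulr_ge0 ?exprn_ge0 // invr_ge0 ltW.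
- rewrite /= /pseries_diffs /v !normrM normrX ger0_norm //.
  rewrite -(ler_pM2l h0) mulVKf ?gt_eqF //.
  have := @bernoulli_pow `|z| (w - `|z|) n (normr_ge0 _) (ltW h0).
  rewrite [`|z| + _]addrC subrK => H.
  rewrite [leLHS](_ : _ = `|a n.+1| * (n.+1%:R * `|z| ^+ n * (w - `|z|))); last by ring.
  exact: ler_wpM2l.
apply: is_cvg_seriesZ.
pose g i := `|a i| * w ^+ i.
have -> : series (fun i => g i.+1) = (fun n => series g n.+1 - g 0%N).
  by apply/funext => n; rewrite /series /= big_nat_recl //= addrC addKr.
apply: is_cvgB; last exact: is_cvg_cst.
by have /cvg_ex[l lP] := cw; apply: (cvgP l); rewrite (cvg_shiftS (series g)).
Qed.

Lemma pssum_derive a r z : (forall K, 0 < K < r -> cvgn (pseries a K)) ->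
  `|z| < r -> is_derive z (1 : R) (pssum a) (pssum (pseries_diffs a) z).
Proof.
move=> ar zr; pose h := (r - `|z|) / 4.
have h0 : 0 < h by rewrite /h; lra.
have zn := normr_ge0 z.
pose w (m : R) := `|z| + m * h.
have wE m : 0 <= m -> `|w m| = w m.
  by move=> m0; rewrite ger0_norm // addr_ge0 // mulr_ge0 // ltW.
have c3 : cvgn (pseries a (w 3)).
  by apply: ar; apply/andP; split; rewrite /w /h; lra.
have c2 : cvgn (pseries (pseries_diffs a) (w 2)).
  by apply: is_cvg_pseries_diffs c3 _; rewrite !wE // /w; lra.
apply: (@pseries_snd_diffs _ _ (w 1)).
- by apply: is_cvg_pseries_inside c3 _; rewrite !wE // /w; lra.
- by apply: is_cvg_pseries_inside c2 _; rewrite !wE // /w; lra.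
- by apply: is_cvg_pseries_diffs c2 _; rewrite !wE // /w; lra.
- by rewrite wE // /w; lra.
Qed.

Lemma is_cvg_pseries_diffs_radius a r :
  (forall K, 0 < K < r -> cvgn (pseries a K)) ->
  (forall K, 0 < K < r -> cvgn (pseries (pseries_diffs a) K)).
Proof.
move=> ar K /andP[K0 Kr]; apply: (@is_cvg_pseries_diffs _ ((K + r) / 2)).
  by apply: ar; apply/andP; split; lra.
by rewrite !ger0_norm; lra.
Qed.

Lemma is_cvg_pseries_radius a r z :
  (forall K, 0 < K < r -> cvgn (pseries a K)) -> `|z| < r -> cvgn (pseries a z).
Proof.
move=> ar zr; have zn := normr_ge0 z.
apply: (@is_cvg_pseries_inside _ _ ((`|z| + r) / 2)).
  by apply: ar; apply/andP; split; lra.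
by rewrite [ltRHS]ger0_norm; lra.
Qed.

Lemma pseries_shift a z n :
  pseries a z n.+1 = a 0%N + z * pseries (fun i => a i.+1) z n.
Proof.
rewrite /pseries /series /= big_nat_recl //= expr0 mulr1; congr (_ + _).
by rewrite mulr_sumr; apply: eq_bigr => i _; rewrite exprS; ring.
Qed.

Lemma is_cvg_pseries_shift a r : (forall K, 0 < K < r -> cvgn (pseries a K)) ->
  (forall K, 0 < K < r -> cvgn (pseries (fun i => a i.+1) K)).
Proof.
move=> ar K KP; have /andP[K0 _] := KP.
have -> : pseries (fun i => a i.+1) K = (fun n => (pseries a K n.+1 - a 0%N) * K^-1).
  by apply/funext => n; rewrite pseries_shift addrC addKr mulrC mulKf // gt_eqF.
apply: is_cvgM; last exact: is_cvg_cst.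
apply: is_cvgB; last exact: is_cvg_cst.
by have /cvg_ex[l lP] := ar _ KP; apply: (cvgP l); rewrite (cvg_shiftS (pseries a K)).
Qed.

Lemma pssum_shift a r z : (forall K, 0 < K < r -> cvgn (pseries a K)) ->
  `|z| < r -> pssum a z = a 0%N + z * pssum (fun i => a i.+1) z.
Proof.
move=> ar zr; apply: cvg_lim => //; rewrite -cvg_shiftS /=.
have -> : (fun n => pseries a z n.+1) =
    (fun n => a 0%N + z * pseries (fun i => a i.+1) z n).
  by apply/funext => n; exact: pseries_shift.
apply: cvgD; first exact: cvg_cst.
apply: cvgMr; exact: (is_cvg_pseries_radius (is_cvg_pseries_shift ar) zr).
Qed.

Lemma pssum0 a : pssum a 0 = a 0%N.
Proof.
apply/cvg_lim => //; apply: cvg_near_cst; exists 1%N => // n /= n0.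
rewrite /pseries /series /= big_ltn // big_nat big1 ?addr0 ?expr0 ?mulr1 //.
by move=> i /andP[i0 _]; rewrite expr0n gtn_eqF // mulr0.
Qed.

End power_series.

Section analytic.
Context {R : realType}.
Implicit Types (a : R^nat) (f g : R -> R) (x y z r : R).

Lemma pssum_continuous a r z : (forall K, 0 < K < r -> cvgn (pseries a K)) ->
  `|z| < r -> {for z, continuous (pssum a)}.
Proof.
move=> ar zr; have H := pssum_derive ar zr.
apply: differentiable_continuous; apply/derivable1_diffP; exact: ex_derive.
Qed.

(** Factor out the power of the variable at the first nonzero coefficient: the cofactor is
    continuous and does not vanish at 0. *)
Lemma pssum_isolated_zeros a r : 0 < r ->
  (forall K, 0 < K < r -> cvgn (pseries a K)) ->
  (forall i, a i = 0) \/
  (exists2 e, 0 < e & forall z, 0 < `|z| < e -> pssum a z != 0).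
Proof.
move=> r0 ar; have [a0|/existsNP[i /eqP ai]] := pselect (forall i, a i = 0); [by left|right].
have exi : exists i, a i != 0 by exists i.
have := ex_minnP exi; case=> m am mmin {i ai exi}.
have {}mmin i : (i < m)%N -> a i = 0.
  by move=> im; apply/eqP; apply/negPn/negP => /mmin; rewrite leqNgt im.
elim: m a ar am mmin => [|m IH] a ar am mmin.
  have : {for 0, continuous (pssum a)} by apply: pssum_continuous ar _; rewrite normr0.
  move=> /(_ [set y | y != 0]) /=.
  have : nbhs (pssum a 0) [set y | y != 0].
    by rewrite pssum0; apply: open_nbhs_nbhs; split => //; exact: open_neq.
  move=> H /(_ H) /nbhs_ballP[e /= e0 eP]; exists e => // z /andP[_ ze].
  by apply: eP; rewrite /ball /= sub0r normrN.
have [|e e0 eP] := IH (fun i => a i.+1) (is_cvg_pseries_shift ar) am.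
  by move=> i im; exact: mmin.
exists (Num.min e r); first by rewrite lt_min e0.
move=> z /andP[z0]; rewrite lt_min => /andP[ze zr].
rewrite (pssum_shift ar zr) mmin // add0r mulf_neq0 ?eP ?z0 //.
by rewrite -normr_gt0.
Qed.

(** A function that is analytic on the half-line is, near each of its points, the restriction
    of the sum of a power series on a two-sided interval, also at the endpoint 0. *)
Lemma analytic_localP f x : analytic_nonneg f -> 0 <= x ->
  exists a r, [/\ 0 < r, forall K, 0 < K < r -> cvgn (pseries a K) &
    forall y, 0 <= y -> `|y - x| < r -> f y = pssum a (y - x)].
Proof.
move=> af x0; have [a [r [r0 fE]]] := af _ x0.
exists a, r; split => // [K /andP[K0 Kr]|y y0 yx].
  have xK : x + K - x = K by rewrite addrC addKr.
  have := fE (x + K); rewrite xK => H; apply/cvg_ex; exists (f (x + K)).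
  by apply: H; [rewrite addr_ge0 // ltW|rewrite gtr0_norm].
by apply/esym/cvg_lim => //; exact: fE.
Qed.

Lemma pseriesB a (b : R^nat) z n :
  pseries (fun i => a i - b i) z n = pseries a z n - pseries b z n.
Proof.
by rewrite /pseries /series /= -sumrB; apply: eq_bigr => i _; rewrite mulrBl.
Qed.

Lemma analytic_nonnegB f g : analytic_nonneg f -> analytic_nonneg g ->
  analytic_nonneg (fun x => f x - g x).
Proof.
move=> af ag x x0; have [a [r [r0 fE]]] := af _ x0; have [b [s [s0 gE]]] := ag _ x0.
exists (fun i => a i - b i), (Num.min r s); rewrite lt_min r0 s0; split=> // y y0.
rewrite lt_min => /andP[yr ys].
rewrite (_ : pseries _ _ = pseries a (y - x) - pseries b (y - x)).
  by apply: cvgB; [exact: fE|exact: gE].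
by apply/funext => n; rewrite pseriesB.
Qed.

Lemma analytic_nonneg_cst1B f : analytic_nonneg f -> analytic_nonneg (fun x => 1 - f x).
Proof.
apply: analytic_nonnegB => x x0; exists (fun i => (i == 0%N)%:R), 1; split=> // y y0 _.
apply: cvg_near_cst; exists 1%N => // n /= n0.
rewrite /pseries /series /= big_ltn // big_nat big1 ?addr0 ?expr0 ?mulr1 //.
by move=> i /andP[i0 _]; rewrite gtn_eqF // mul0r.
Qed.

(** The points near which [f] vanishes and the points that are isolated from the other zeros
    form a partition of the half-line into two relatively open sets, and the half-line
    is connected. *)
Lemma analytic_zeros f : analytic_nonneg f ->
  (forall x, 0 <= x -> f x = 0) \/
  (forall x, 0 <= x -> exists2 e, 0 < e &
     forall y, 0 <= y -> 0 < `|y - x| < e -> f y != 0).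
Proof.
move=> af.
pose C : set R := [set x | exists2 e, 0 < e & forall y, 0 <= y -> `|y - x| < e -> f y = 0].
pose D : set R := [set x | exists2 e, 0 < e & forall y, 0 <= y -> 0 < `|y - x| < e -> f y != 0].
have dich x : 0 <= x -> C x \/ D x.
  move=> x0; have [a [r [r0 ar fE]]] := analytic_localP af x0.
  have [a0|[e e0 eP]] := pssum_isolated_zeros r0 ar; [left|right].
    exists r => // y y0 yr; rewrite fE // /pssum.
    rewrite (_ : pseries a _ = cst 0) ?lim_cst //.
    apply/funext => n; rewrite /pseries /series /= big1 // => i _.
    by rewrite a0 mul0r.
  exists (Num.min r e); first by rewrite lt_min r0.
  move=> y y0; rewrite lt_min => /and3P[yx yr ye].
  by rewrite fE // eP // yx.
have oC : open C.
  rewrite openE => x [e e0 eP]; apply/nbhs_ballP; exists (e / 2); first by rewrite /= divr_gt0.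
  move=> y; rewrite /ball /= => xy; exists (e / 2); first by rewrite divr_gt0.
  move=> z z0 zy; apply: eP => //.
  have -> : z - x = (z - y) - (x - y) by ring.
  by rewrite (le_lt_trans (ler_normB _ _)) // (splitr e) ltrD.
have oD : open D.
  rewrite openE => x [e e0 eP]; apply/nbhs_ballP; exists (e / 2); first by rewrite /= divr_gt0.
  move=> y; rewrite /ball /= => xy; have [<-|xny] := eqVneq x y; first by exists e.
  have xy0 : 0 < `|x - y| by rewrite normr_gt0 subr_eq0.
  exists (Num.min (e / 2) `|x - y|); first by rewrite lt_min xy0 divr_gt0.
  move=> z z0; rewrite lt_min => /and3P[zy zye zyx]; apply: eP => //.
  apply/andP; split.
    rewrite normr_gt0 subr_eq0; apply: contraTneq zyx => ->.
    by rewrite ltxx.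
  have -> : z - x = (z - y) - (x - y) by ring.
  by rewrite (le_lt_trans (ler_normB _ _)) // (splitr e) ltrD.
have CD0 x : 0 <= x -> C x -> D x -> False.
  move=> x0 [e e0 eP] [e' e'0 e'P]; pose m := Num.min e e' / 2.
  have mm : 0 < Num.min e e' by rewrite lt_min e0.
  have m0 : 0 < m by rewrite divr_gt0.
  have xm0 : 0 <= x + m by rewrite addr_ge0 // ltW.
  have mlt : `|x + m - x| < Num.min e e'.
    by rewrite addrC addKr gtr0_norm // /m; lra.
  move: (mlt); rewrite lt_min => /andP[me me'].
  have /eqP := eP _ xm0 me; apply/negP; apply: e'P => //.
  by rewrite me' andbT addrC addKr normr_gt0 gt_eqF.
have [[x [x0 Cx]]|nC] := pselect (exists x, 0 <= x /\ C x); [left|right]; last first.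
  by move=> x x0; have [Cx|//] := dich _ x0; exfalso; apply: nC; exists x.
pose E : set R := [set y | 0 <= y].
have cE : connected E.
  apply/connected_intervalP => u v u0 v0 z /andP[uz _].
  exact: le_trans u0 uz.
have CE : E `&` C = E.
  apply: cE.
  - by exists x.
  - by exists C.
  - exists (~` D); first exact: open_closedC.
    apply/seteqP; split=> y [y0 Cy]; split=> //.
      by move=> Dy; exact: CD0 y0 Cy Dy.
    by case: (dich _ y0).
move=> y y0; have : (E `&` C) y by rewrite CE.
by move=> [_ [e e0 eP]]; apply: eP => //; rewrite subrr normr0.
Qed.

End analytic.

Lemma near_eq_continuous {R : realType} {T : topologicalType} (f g : T -> R) (x : T) :
  (\forall y \near x, f y = g y) -> {for x, continuous g} -> {for x, continuous f}.
Proof.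
move=> fg cg; rewrite /prop_for /continuous_at (nbhs_singleton fg).
apply: cvg_trans cg; apply: near_eq_cvg; apply: filterS fg => y /= ->.
by [].
Qed.

Section analytic_derivative.
Context {R : realType}.
Implicit Types (f : R -> R) (x y r : R).

Lemma continuous_max0 : continuous (fun y : R => Num.max y 0).
Proof.
move=> x; apply: (@continuous_max _ _ (fun y : R => y) (cst 0) x) => //.
exact: cst_continuous.
Qed.

Lemma max0_ge0 y : 0 <= Num.max y (0 : R).
Proof. by rewrite le_max lexx orbT. Qed.

Lemma near_ball (x r : R) : 0 < r -> \forall y \near x, `|y - x| < r.
Proof.
by move=> r0; apply/nbhs_ballP; exists r => // y; rewrite /ball /= distrC.
Qed.

(** The hypothesis does not constrain [f] on the negative numbers, hence the truncation. *)
Lemma analytic_continuous f : analytic_nonneg f -> continuous (fun y => f (Num.max y 0)).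
Proof.
move=> af x; have := max0_ge0 x; set m := Num.max x 0 => m0.
have [a [r [r0 ar fE]]] := analytic_localP af m0.
have cm : \forall y \near x, `|Num.max y 0 - m| < r.
  exact: (continuous_max0 (near_ball m r0)).
apply: (near_eq_continuous (g := fun y => pssum a (Num.max y 0 - m))).
  by apply: filterS cm => y; apply: fE; exact: max0_ge0.
apply: (@continuous_comp _ _ _ (fun y => Num.max y 0 - m) (pssum a)).
  by apply: continuousB; [exact: continuous_max0|exact: cst_continuous].
by apply: pssum_continuous ar _; rewrite subrr normr0.
Qed.

Lemma analytic_is_derive f a r x :
  (forall K, 0 < K < r -> cvgn (pseries a K)) ->
  (forall y, 0 <= y -> `|y - x| < r -> f y = pssum a (y - x)) ->
  forall y, 0 < y -> `|y - x| < r ->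
  is_derive y (1 : R) f (pssum (pseries_diffs a) (y - x)).
Proof.
move=> ar fE y y0 yx.
apply: (near_eq_is_derive _ (f := fun y => pssum a (y - x))).
  near=> z; apply/esym/fE.
    by apply: ltW; near: z; exact: lt_nbhsr.
  have : `|z - y| < r - `|y - x| by near: z; apply: near_ball; rewrite subr_gt0.
  rewrite ltrBrDr; apply: le_lt_trans.
  have -> : z - x = (z - y) + (y - x) by ring.
  exact: ler_normD.
have D := pssum_derive ar yx.
have D1 : is_derive y (1 : R) (fun y : R => y - x) 1.
  by apply: is_derive_eq; rewrite subr0.
have := @is_derive1_comp R (pssum a) (fun y : R => y - x) y _ _ D D1.
by rewrite mulr1; apply.
Unshelve. all: by end_near. Qed.

(** [G] is the derivative, extended to the left of 0 by its right limit there. When it vanishes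
    at 0 its expansion starts in degree 1, hence the linear bound; in that case the derivative
    in the squared distance, [G r / (2 r)], is bounded. *)
Lemma analytic_derivative f : analytic_nonneg f -> exists G : R -> R,
  [/\ continuous G,
      forall x, 0 < x -> is_derive x (1 : R) f (G x) &
      G 0 = 0 -> exists M e, 0 < e /\ forall x, 0 <= x < e -> `|G x| <= M * x].
Proof.
move=> af.
have [a0 [r0 [r00 ar0 fE0]]] := analytic_localP af (lexx 0).
pose G y := if 0 < y then derive1 f y else a0 1%N.
have GE a r x : 0 <= x -> 0 < r -> (forall K, 0 < K < r -> cvgn (pseries a K)) ->
    (forall y, 0 <= y -> `|y - x| < r -> f y = pssum a (y - x)) ->
    forall y, 0 < y -> `|y - x| < r -> G y = pssum (pseries_diffs a) (y - x).
  move=> x0 r1 ar fE y y0 yx; have := analytic_is_derive ar fE y0 yx.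
  by move=> D; rewrite /G y0 derive1E; exact: derive_val.
have G0 y : y <= 0 -> G y = pssum (pseries_diffs a0) 0.
  by move=> y0; rewrite /G ltNge y0 /= pssum0 /pseries_diffs mul1r.
have G0E y : `|y| < r0 -> G y = pssum (pseries_diffs a0) (Num.max y 0).
  move=> yr; rewrite maxEle; case: leP => y0; first exact: G0.
  by rewrite -[in RHS](subr0 y); apply: (GE a0 r0 0) => //; rewrite subr0.
exists G; split.
- move=> x; have [x0|x0] := ltP 0 x.
    have [a [r [r1 ar fE]]] := analytic_localP af (ltW x0).
    apply: (near_eq_continuous (g := fun y => pssum (pseries_diffs a) (y - x))).
      near=> y; have y0 : 0 < y by near: y; exact: lt_nbhsr.
      have yx : `|y - x| < r by near: y; exact: near_ball.
      exact: GE (ltW x0) r1 ar fE y y0 yx.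
    apply: (@continuous_comp _ _ _ (fun y => y - x) (pssum (pseries_diffs a))).
      by apply: continuousB => //; exact: cst_continuous.
    apply: pssum_continuous (is_cvg_pseries_diffs_radius ar) _.
    by rewrite subrr normr0.
  apply: (near_eq_continuous (g := fun y => pssum (pseries_diffs a0) (Num.max y 0))).
    near=> y; have yb : `|y - x| < r0 by near: y; exact: near_ball.
    have [y0|y0] := leP y 0; first exact: G0.
    have := G0E y; rewrite (max_l (ltW y0)); apply.
    by move: yb; rewrite !gtr0_norm; lra.
  apply: (@continuous_comp _ _ _ (fun y => Num.max y 0) (pssum (pseries_diffs a0))).
    exact: continuous_max0.
  apply: pssum_continuous (is_cvg_pseries_diffs_radius ar0) _.
  by rewrite maxEle x0 normr0.
- move=> x x0; have [a [r [r1 ar fE]]] := analytic_localP af (ltW x0).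
  have xx : `|x - x| < r by rewrite subrr normr0.
  rewrite (GE a r x (ltW x0) r1 ar fE x x0 xx).
  exact: analytic_is_derive ar fE x x0 xx.
- move=> G00; have ar1 := is_cvg_pseries_diffs_radius ar0.
  have n0 : `|0 : R| < r0 by rewrite normr0.
  pose b i := pseries_diffs a0 i.+1.
  have cb : {for 0, continuous (pssum b)}.
    by apply: pssum_continuous (is_cvg_pseries_shift ar1) n0.
  have [e e0 eP] : exists2 e, 0 < e & forall y, `|y| < e -> `|pssum b y| <= `|pssum b 0| + 1.
    have /nbhs_ballP[e /= e0 eP] := cb _ (near_ball (pssum b 0) ltr01).
    exists e => // y ye; have := eP y; rewrite /ball /= sub0r normrN => /(_ ye) H.
    have -> : pssum b y = (pssum b y - pssum b 0) + pssum b 0 by rewrite subrK.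
    by rewrite (le_trans (ler_normD _ _)) // addrC lerD2l ltW.
  exists (`|pssum b 0| + 1), (Num.min e r0); rewrite lt_min e0; split=> // x.
  rewrite lt_min => /and3P[x0 xe xr].
  have nx : `|x| = x by rewrite ger0_norm.
  rewrite G0E ?nx // (max_l x0) (pssum_shift ar1) ?nx //.
  have -> : pseries_diffs a0 0%N = 0 by rewrite -(pssum0 (pseries_diffs a0)) -(G0 0).
  by rewrite add0r normrM nx mulrC ler_wpM2r // eP ?nx.
Unshelve. all: by end_near. Qed.

Lemma bounded_continuous (G : R -> R) (K : R) : continuous G ->
  exists2 M, 0 <= M & forall x, 0 <= x <= K -> `|G x| <= M.
Proof.
move=> cG; have [K0|K0] := leP 0 K; last first.
  by exists 0 => // x /andP[x0 xK]; lra.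
have cN : {within `[0, K], continuous (fun x => `|G x|)}.
  apply: continuous_subspaceT => x.
  by apply: continuous_comp; [exact: cG|exact: norm_continuous].
have [c cK cP] := EVT_max K0 cN.
by exists `|G c| => // x xK; apply: cP; rewrite in_itv.
Qed.

Lemma analytic_lipschitz f (G : R -> R) (K M : R) : analytic_nonneg f ->
  (forall x, 0 < x -> is_derive x (1 : R) f (G x)) ->
  (forall x, 0 <= x <= K -> `|G x| <= M) ->
  forall x y, 0 <= x <= K -> 0 <= y <= K -> `|f x - f y| <= M * `|x - y|.
Proof.
move=> af fG GM x y; wlog xy : x y / x <= y.
  move=> H xK yK; have [xy|/ltW yx] := leP x y; first exact: H.
  by rewrite distrC (distrC x) H.
move=> /andP[x0 xK] /andP[y0 yK].
pose h y := f (Num.max y 0).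
have ch : {within `[x, y], continuous h}.
  by apply: continuous_subspaceT; exact: analytic_continuous.
have hE z : 0 <= z -> h z = f z by move=> z0; rewrite /h maxEle; case: leP => // z0'; congr f; lra.
have dh z : z \in `]x, y[ -> is_derive z (1 : R) h (G z).
  rewrite in_itv /= => /andP[xz zy]; have z0 : 0 < z by exact: le_lt_trans xz.
  apply: near_eq_is_derive (fG _ z0); near=> w; rewrite hE //.
  by apply: ltW; near: w; exact: lt_nbhsr.
have [c cxy] := MVT_segment xy dh ch.
rewrite !hE // => E; rewrite distrC E normrM (distrC x).
apply: ler_wpM2r => //; apply: GM; move: cxy; rewrite in_itv /= => /andP[? ?].
by apply/andP; split; lra.
Unshelve. all: by end_near. Qed.

End analytic_derivative.

Section radial.
Context {R : realType}.

(** The density is defined by differentiating in the squared distance. *)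
Lemma is_derive_sqr_radius (f G : R -> R) (r : R) :
  (forall x : R, 0 < x -> is_derive x (1 : R) f (G x)) -> 0 < r ->
  is_derive (r ^+ 2) (1 : R) (fun s : R => f (Num.sqrt s)) (G r / (2 * r)).
Proof.
move=> fG r0; have rr : Num.sqrt (r ^+ 2) = r by rewrite sqrtr_sqr gtr0_norm.
have s0 : 0 < r ^+ 2 by rewrite exprn_gt0.
have D1 := is_derive1_sqrt s0; rewrite rr in D1.
have D2 : is_derive (Num.sqrt (r ^+ 2)) (1 : R) f (G r) by rewrite rr; exact: fG.
exact: (is_derive1_comp D2 D1).
Qed.

(** The radii are isolated, hence countably many, so that the set is a countable union of
    spheres. Instead of enumerating the radii, each is isolated in an interval with
    rational ends. *)
Lemma analytic_zeros_vnull d (B : set 'rV[R]_d) (K : R) (p : 'rV[R]_d) (h : R -> R) :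
  (0 < d)%N -> vmeasurable B -> bounded_in B K -> analytic_nonneg h ->
  (exists2 x, 0 <= x & h x != 0) ->
  vnull (B `&` [set q | h (enorm (q - p)) = 0]).
Proof.
move=> d0 mB bB ah [x0 x00 /eqP hx0].
have [/(_ _ x00)//|iso] := analytic_zeros ah.
pose U (ab : rat * rat) (s : R) := [/\ 0 <= s, ratr ab.1 < s < ratr ab.2 & h s = 0].
pose Z ab := B `&` [set q | U ab (enorm (q - p)) /\
  forall s, U ab s -> s = enorm (q - p)].
apply: (@vnullS _ _ _ (\bigcup_ab Z ab)); last first.
  apply: vnull_countable_bigcup => ab.
  have [[q0 [Bq0 [U0 u0]]]|nZ] := pselect (exists q, Z ab q).
    apply: vnullS (sphere_vnull p (enorm (q0 - p)) d0 mB bB) => q [Bq [Uq uq]].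
    by split=> //=; exact: u0.
  rewrite (_ : Z ab = set0); first by rewrite /vnull preimage_set0; exact: negligible_set0.
  by apply/seteqP; split=> q // Zq; apply: nZ; exists q.
move=> q [Bq /= hq]; set r := enorm (q - p).
have [e e0 eP] := iso _ (enorm_ge0 (q - p)); rewrite -/r in eP.
have [a] : exists a : rat, ratr a \in `]r - e, r[ by apply: rat_in_itvoo; lra.
have [b] : exists b : rat, ratr b \in `]r, r + e[ by apply: rat_in_itvoo; lra.
rewrite !in_itv /= => /andP[b1 b2] /andP[a1 a2].
exists (a, b) => //; split => //; split; first by split; rewrite ?enorm_ge0 //= a2 b1.
move=> s [/= s0 /andP[sa sb] hs]; apply/eqP; rewrite -subr_eq0 -normr_eq0.
apply/negPn/negP => srn; have := eP _ s0; rewrite hs eqxx => /(_ _)/negP.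
by apply => //; rewrite lt_def srn normr_ge0 /= ltr_norml; apply/andP; split; lra.
Qed.

End radial.

(** * Convex polytopes *)

Section polytope.
Context {R : realType} {d : nat}.
Variables (Q : set 'rV[R]_d).
Hypothesis HQ : convex_polytope Q.

Lemma polytope_bounded : exists K, bounded_in Q K.
Proof.
have [n [v QE]] := HQ; exists (\sum_j enorm (v j)) => q.
rewrite QE => -[w [w0 w1 ->]] k; rewrite summxE.
apply: le_trans (ler_norm_sum _ _ _) _; apply: ler_sum => j _.
rewrite mxE normrM ger0_norm //.
have wj1 : w j <= 1.
  by rewrite -w1 (bigD1 j) //= lerDl; apply: sumr_ge0 => i _.
by rewrite -[leRHS]mul1r; apply: ler_pM => //; exact: coord_le_enorm.
Qed.

Lemma polytope_convex q q' (t : R) : 0 <= t <= 1 -> Q q -> Q q' ->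
  Q (q + t *: (q' - q)).
Proof.
have [n [v QE]] := HQ; move=> /andP[t0 t1]; rewrite QE => -[w [w0 w1 ->]] [u [u0 u1 ->]].
exists (fun j => w j + t * (u j - w j)); split.
- move=> j; have -> : w j + t * (u j - w j) = (1 - t) * w j + t * u j by ring.
  by rewrite addr_ge0 // mulr_ge0 // subr_ge0.
- by rewrite big_split /= w1 -mulr_sumr sumrB u1 w1 subrr mulr0 addr0.
- rewrite -sumrB scaler_sumr -big_split /=; apply: eq_bigr => j _.
  by rewrite scalerDl -scalerA scalerBl.
Qed.

(** [Q] is the continuous image of the compact simplex of weights. *)
Lemma polytope_compact : compact Q.
Proof.
have [n [v QE]] := HQ.
pose S : set 'rV[R]_n.+1 := [set w | forall j, w 0 j \in `[0, 1]] `&` [set w | \sum_j w 0 j = 1].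
have cS : compact S.
  apply: compact_closedI.
    exact: (@rV_compact R n.+1 (fun=> `[0, 1]%classic) (fun=> @segment_compact R 0 1)).
  apply: (@preimage_closed _ _ (fun w : 'rV[R]_n.+1 => \sum_j w 0 j) [set 1]); last exact: closed_eq.
  move=> w _; apply: continuous_big => [|j _]; first exact: (@add_continuous R^o).
  exact: coord_continuous.
have -> : Q = (fun w : 'rV[R]_n.+1 => \sum_j w 0 j *: v j) @` S.
  rewrite QE; apply/seteqP; split=> q /=.
    move=> [w [w0 w1 qE]]; exists (\row_j w j); last first.
      by rewrite qE; apply: eq_bigr => j _; rewrite mxE.
    split=> /=; last by under eq_bigr do rewrite mxE.
    move=> j; rewrite mxE in_itv /= w0 -w1 (bigD1 j) //= lerDl.
    by apply: sumr_ge0 => i _.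
  move=> [w [wI w1] <-]; exists (fun j => w 0 j); split=> // j.
  by have := wI j; rewrite in_itv => /andP[].
apply: continuous_compact cS; apply: continuous_subspaceT.
apply: continuous_big => [|j _ w]; first exact: add_continuous.
by apply: continuousZr_tmp; exact: coord_continuous.
Qed.

Lemma polytope_closed : closed Q.
Proof. by apply: compact_closed polytope_compact; exact: norm_hausdorff. Qed.

End polytope.

(** * Real-valued integrals and growth from Dini derivatives *)

Section real_integrals.
Context {dT : measure_display} {T : measurableType dT} {R : realType}.
Context (mu : {measure set T -> \bar R}) (D : set T).
Hypothesis mD : measurable D.

(** [g] is replaced by the maximum of [f] and [g], which equals it almost everywhere and
    dominates [f] everywhere. *)
Lemma ae_le_Rintegral (f g : T -> R) :
  mu.-integrable D (EFin \o f) -> mu.-integrable D (EFin \o g) ->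
  {ae mu, forall x, D x -> f x <= g x} ->
  \int[mu]_(x in D) f x <= \int[mu]_(x in D) g x.
Proof.
move=> intf intg fg.
have mf : measurable_fun D f by apply/measurable_EFinP; case/integrableP: intf.
have mg : measurable_fun D g by apply/measurable_EFinP; case/integrableP: intg.
pose h x := Num.max (f x) (g x).
have hg : ae_eq mu D (EFin \o g) (EFin \o h).
  by apply: filterS fg => x /[apply] xfg; rewrite /= /h; congr EFin; rewrite max_r.
have mh : measurable_fun D h by exact: measurable_maxr.
have inth : mu.-integrable D (EFin \o h).
  have intfg := integrableD mD (integrable_norm intf) (integrable_norm intg).
  apply: le_integrable intfg => //; first exact/measurable_EFinP.
  move=> x _; change ((`|h x|)%:E <= (`| `|f x| + `|g x| |)%:E)%E.
  rewrite lee_fin [leRHS]ger0_norm ?addr_ge0 //.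
  by rewrite /h maxEle; case: ifP => _; rewrite ?lerDr ?lerDl.
have -> : \int[mu]_(x in D) g x = \int[mu]_(x in D) h x.
  congr fine; apply: ae_eq_integral => //; exact/measurable_EFinP.
by apply: le_Rintegral => // x _; rewrite /h le_max lexx.
Qed.

Lemma Rintegral_subset (E : set T) (f : T -> R) : E `<=` D ->
  \int[mu]_(x in E) f x = \int[mu]_(x in D) (\1_E x * f x).
Proof.
move=> ED; rewrite Rintegral_mkcond [RHS]Rintegral_mkcond.
apply: eq_Rintegral => x _; rewrite /patch indicE.
have [xE|xE] := boolP (x \in E); last by rewrite mul0r if_same.
by rewrite mul1r ifT //; apply/mem_set/ED; exact: set_mem.
Qed.

Lemma integrable_sumr (I : Type) (r : seq I) (f : I -> T -> R) :
  (forall i, mu.-integrable D (EFin \o f i)) ->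
  mu.-integrable D (EFin \o (fun x => \sum_(i <- r) f i x)).
Proof.
move=> intf.
have := @integrable_sum _ _ _ mu D mD _ r xpredT (fun i => EFin \o f i) (fun i _ => intf i).
by congr integrable; apply/funext => x; rewrite /= sumEFin.
Qed.

Lemma integrable_scaler (f : T -> R) (c : R) : mu.-integrable D (EFin \o f) ->
  mu.-integrable D (EFin \o (fun x => c * f x)).
Proof. by move=> /(integrableZl mD c); congr integrable; exact/funext. Qed.

Lemma Rintegral_sum (I : Type) (r : seq I) (f : I -> T -> R) :
  (forall i, mu.-integrable D (EFin \o f i)) ->
  \int[mu]_(x in D) (\sum_(i <- r) f i x) = \sum_(i <- r) \int[mu]_(x in D) f i x.
Proof.
move=> intf; elim: r => [|i r IH].
  rewrite big_nil; under eq_Rintegral do rewrite big_nil.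
  by rewrite Rintegral_cst // mul0r.
rewrite big_cons -IH -RintegralD //; last exact: integrable_sumr.
by apply: eq_Rintegral => x _; rewrite big_cons.
Qed.

Hypothesis Doo : (mu D < +oo)%E.

Lemma bounded_integrable (f : T -> R) (C : R) : measurable_fun D f ->
  (forall x, D x -> `|f x| <= C) -> mu.-integrable D (EFin \o f).
Proof.
move=> mf fC; apply: measurable_bounded_integrable => //.
exists C; split; first exact: num_real.
by move=> y Cy x /fC xC; exact: le_trans xC (ltW Cy).
Qed.

Lemma normr_Rintegral_le (f : T -> R) (C : R) : measurable_fun D f ->
  (forall x, D x -> `|f x| <= C) ->
  `|\int[mu]_(x in D) f x| <= C * fine (mu D).
Proof.
move=> mf fC; have intf := bounded_integrable mf fC.
apply: le_trans (le_normr_Rintegral mD intf) _.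
rewrite -(Rintegral_cst _ mD); apply: le_Rintegral => //.
  exact: integrable_norm.
exact: (bounded_integrable (C := `|C|)).
Qed.

(** Dominated convergence on a region of finite measure, with a constant as dominant. *)
Lemma bounded_Rintegral_cvg (f : (T -> R)^nat) (g : T -> R) (C : R) :
  (forall n, measurable_fun D (f n)) -> measurable_fun D g ->
  (forall n x, D x -> `|f n x| <= C) ->
  {ae mu, forall x, D x -> f n x @[n --> \oo] --> g x} ->
  \int[mu]_(x in D) f n x @[n --> \oo] --> \int[mu]_(x in D) g x.
Proof.
move=> mf mg fC fg.
have [|||||intg _ cv] := @dominated_convergence _ _ _ mu D mD
    (fun n => EFin \o f n) (EFin \o g) (cst `|C|%:E).
- by move=> n; exact/measurable_EFinP.
- exact/measurable_EFinP.
- apply: filterS fg => x /[apply] /= cx.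
  by apply/fine_cvgP; split; [exact: nearW|exact: cx].
- by apply: (bounded_integrable (f := cst `|C|) (C := `|C|)) => // x _; rewrite /= normr_id.
- apply: aeW => x n Dx; rewrite lee_fin; exact: le_trans (fC n x Dx) (ler_norm _).
have fin : (\int[mu]_(x in D) (g x)%:E)%E \is a fin_num by exact: integrable_fin_num.
rewrite /Rintegral; apply: fine_cvg; by rewrite fineK.
Qed.

End real_integrals.

(** Let [t] be the supremum of the points at which the growth estimate from [a] holds: by
    continuity it holds at [t], and if [t < b] an increment at [t] would extend it. *)
Lemma dini_growth {R : realType} (l : R -> R) (a b m : R) : a <= b ->
  (forall t, a <= t <= b -> {for t, continuous l}) ->
  (forall t, a <= t < b -> forall e, 0 < e ->
     exists2 h, 0 < h < e & m * h <= l (t + h) - l t) ->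
  m * (b - a) <= l b - l a.
Proof.
move=> ab cl step; pose g s := l s - l a - m * (s - a).
pose S : set R := [set s | a <= s <= b /\ 0 <= g s].
have Sa : S a by rewrite /S /= lexx ab /g !subrr mulr0 subrr.
have hS : has_sup S by split; [exists a|exists b => s [/andP[]]].
have leS s : S s -> s <= sup S by move=> Ss; apply: ub_le_sup => //; exact: hS.2.
set t := sup S in leS *.
have ta : a <= t by exact: leS.
have tb : t <= b by apply: ge_sup; [exists a|move=> s [/andP[]]].
have cg : {for t, continuous g}.
  apply: continuousB; first by apply: continuousB; [apply: cl; rewrite ta|exact: cst_continuous].
  apply: continuousM; first exact: cst_continuous.
  by apply: continuousB => //; exact: cst_continuous.
have gt : 0 <= g t.
  rewrite leNgt; apply/negP => gt0.
  have /nbhs_ballP[e /= e0 eP] : \forall s \near t, g s < 0.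
    exact: (cg _ (lt_nbhsl gt0)).
  have [s [[sab gs] st]] := sup_adherent e0 hS.
  have sle : s <= t by exact: leS.
  have := eP s; rewrite /ball /= ltr_norml => H.
  suff : g s < 0 by rewrite ltNge gs.
  by apply: H; apply/andP; split; rewrite -/t in st; lra.
have {tb} : t = b.
  apply/eqP; rewrite eq_le tb leNgt; apply/negP => tltb.
  have tin : a <= t < b by rewrite ta.
  have ebt : 0 < b - t by rewrite subr_gt0.
  have [h /andP[h0 hb] hP] := step _ tin _ ebt.
  have : S (t + h).
    split; first by apply/andP; split; lra.
    by move: gt; rewrite /g; lra.
  by move=> /leS; lra.
by move=> tb; move: gt; rewrite tb /g; lra.
Qed.

(** * Node functions *)

Section node_functions.
Context {R : realType} {N : nat}.
Variable beta : 'I_N -> R -> R.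
Hypothesis Hbeta01 : forall i (r : R), 0 <= r -> 0 <= beta i r <= 1.
Hypothesis Hbeta_incr : forall i (r s : R), 0 <= r -> r < s -> beta i r < beta i s.
Hypothesis Hbeta_analytic : forall i, analytic_nonneg (beta i).

Lemma node_analytic i : analytic_nonneg (node beta i).
Proof. exact: analytic_nonneg_cst1B. Qed.

Lemma node_decr i (r s : R) : 0 <= r -> r < s -> node beta i s < node beta i r.
Proof. by move=> r0 rs; rewrite /node ltrD2l ltrN2 Hbeta_incr. Qed.

Lemma node_nincr i (r s : R) : 0 <= r -> r <= s -> node beta i s <= node beta i r.
Proof.
by move=> r0; rewrite le_eqVlt => /orP[/eqP ->//|rs]; exact/ltW/node_decr.
Qed.

Lemma node01 i (r : R) : 0 <= r -> 0 <= node beta i r <= 1.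
Proof. by move=> /(Hbeta01 i) /andP[? ?]; rewrite /node; apply/andP; split; lra. Qed.

(** The factor of [phi] in the density: minus the derivative of the node function in the
    squared distance. *)
Definition slope i (r : R) : R := - derive1 (node_sq beta i) (r ^+ 2).

(** [G] is the derivative in the distance. It is continuous up to 0, so that the slope has at
    most a simple pole there, and no pole if [G 0 = 0]. *)
Lemma node_derivative i : exists G : R -> R,
  [/\ continuous G,
      forall x : R, 0 < x -> is_derive x (1 : R) (node beta i) (G x),
      forall x, 0 <= x -> G x <= 0,
      forall r, 0 < r -> slope i r = - G r / (2 * r) &
      G 0 = 0 -> exists M e, 0 < e /\ forall x, 0 <= x < e -> `|G x| <= M * x].
Proof.
have [G [cG dG G0]] := analytic_derivative (node_analytic i).
have Gpos (x : R) : 0 < x -> G x <= 0.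
  move=> x0; have [D <-] := dG x x0; rewrite -derive1E.
  apply: (@decr_derive1_le0_itvy _ _ true 0).
  - by move=> y; rewrite inE /= in_itv /= andbT => /dG [].
  - move=> y z; rewrite !in_itv /= !andbT => y0 z0 yz.
    exact: node_decr.
  - by rewrite in_itv /= x0.
have Gle x : 0 <= x -> G x <= 0.
  rewrite le_eqVlt => /orP[/eqP <-|/Gpos //].
  rewrite leNgt; apply/negP => G00.
  have [e /= e0 eP] := iffLR (nbhs_ballP _ _) (cG 0 _ (lt_nbhsr G00)).
  have e2 : 0 < e / 2 by rewrite divr_gt0.
  have := Gpos _ e2; rewrite leNgt => /negP; apply; apply: eP.
  by rewrite /ball /= sub0r normrN gtr0_norm //; lra.
exists G; split => // r r0; rewrite /slope derive1E.
have := is_derive_sqr_radius dG r0.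
by move=> [_ E]; rewrite /node_sq E mulNr.
Qed.

Lemma node_is_derive_sq i (r : R) : 0 < r ->
  is_derive (r ^+ 2) (1 : R) (node_sq beta i) (- slope i r).
Proof.
move=> r0; have [G [_ dG _ sE _]] := node_derivative i.
rewrite sE // mulNr opprK; exact: is_derive_sqr_radius.
Qed.

Lemma slope_continuous i (r : R) : 0 < r -> {for r, continuous (slope i)}.
Proof.
move=> r0; have [G [cG dG _ sE _]] := node_derivative i.
apply: (near_eq_continuous (g := fun r => - G r / (2 * r))).
  by near=> s; apply: sE; near: s; exact: lt_nbhsr.
apply: continuousM; first by apply: continuousN; exact: cG.
apply: continuousV; first by rewrite mulf_neq0 // gt_eqF.
by apply: continuousM => //; exact: cst_continuous.
Unshelve. all: by end_near. Qed.

Lemma slope_ge0 i (r : R) : 0 < r -> 0 <= slope i r.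
Proof.
move=> r0; have [G [_ _ G0 sE _]] := node_derivative i.
by rewrite sE // divr_ge0 ?oppr_ge0 ?G0 // ?mulr_ge0 // ltW.
Qed.

(** One constant for all the agents: the node functions are Lipschitz, and the pole of the
    slopes at 0 is at most simple. *)
Lemma node_bounds (K : R) : exists2 L, 0 <= L & forall i,
  (forall r s, 0 <= r <= K -> 0 <= s <= K ->
     `|node beta i r - node beta i s| <= L * `|r - s|) /\
  (forall r, 0 < r <= K -> slope i r * r <= L).
Proof.
have /choice[Li LP] : forall i, exists L, 0 <= L /\
  ((forall r s, 0 <= r <= K -> 0 <= s <= K ->
     `|node beta i r - node beta i s| <= L * `|r - s|) /\
  (forall r, 0 < r <= K -> slope i r * r <= L)).
  move=> i; have [G [cG dG Gle sE _]] := node_derivative i.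
  have [M M0 MP] := bounded_continuous K cG.
  exists M; split=> //; split.
    exact: analytic_lipschitz (node_analytic i) dG MP.
  move=> r /andP[r0 rK]; rewrite sE //.
  have -> : - G r / (2 * r) * r = - G r / 2 by field; rewrite gt_eqF.
  have : - G r <= M.
    rewrite -ler0_norm; last by apply: Gle; exact: ltW.
    by apply: MP; rewrite (ltW r0).
  by move: M0; lra.
have L0 : 0 <= \sum_i Li i by apply: sumr_ge0 => i _; have [] := LP i.
have Lle i : Li i <= \sum_i Li i.
  by rewrite (bigD1 i) //= lerDl; apply: sumr_ge0 => j _; have [] := LP j.
exists (\sum_i Li i) => // i; have [_ [lip sl]] := LP i; split.
  move=> r s rK sK; apply: le_trans (lip _ _ rK sK) _.
  by rewrite ler_wpM2r.
by move=> r rK; exact: le_trans (sl r rK) (Lle i).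
Qed.

End node_functions.

(** * The Lyapunov function *)

Section lyapunov.
Context {R : realType} {d N : nat}.
Local Notation realT := (measurableTypeR R).
Variables (Q : set 'rV[R]_d) (phi : 'rV[R]_d -> R).
Variables (beta : 'I_N -> R -> R) (rng : 'I_N -> R).
Hypothesis Hphi : {within Q, continuous phi}.
Hypothesis Hphi01 : forall q, Q q -> 0 <= phi q <= 1.
Hypothesis Hbeta01 : forall i (r : R), 0 <= r -> 0 <= beta i r <= 1.
Hypothesis Hbeta_incr : forall i (r s : R), 0 <= r -> r < s -> beta i r < beta i s.
Hypothesis Hbeta_analytic : forall i, analytic_nonneg (beta i).
Hypothesis Hrng : forall i, 0 < rng i.
Hypothesis Hrng_eq : forall i j, node beta i (rng i) = node beta j (rng j).
Hypothesis cQ : closed Q.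
Variable K : R.
Hypothesis bQ : bounded_in Q K.
Hypothesis Hoverlap : forall X : 'I_N -> 'rV[R]_d, (forall i, Q (X i)) ->
  forall i j, X i != X j -> vnull (voronoi Q beta X i `&` voronoi Q beta X j).

Implicit Types (X Y : 'I_N -> 'rV[R]_d) (i j : 'I_N) (q p : 'rV[R]_d).

Local Notation f := (node beta).
Local Notation mu := (lebesgue_tuple R d).
Let D : set (d.-tuple realT) := tuple_vec @^-1` Q.

Let mD : measurable D. Proof. exact: closed_vmeasurable. Qed.

Let Doo : (mu D < +oo)%E. Proof. exact: bounded_vol_lty bQ. Qed.

Let mphi : measurable_fun D (phi \o tuple_vec : d.-tuple realT -> realT).
Proof. exact: within_continuous_vmeasurable_fun. Qed.

Lemma continuous_node i p : continuous (fun q : 'rV[R]_d => f i (enorm (q - p))).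
Proof.
have -> : (fun q => f i (enorm (q - p))) = (fun q => f i (Num.max (enorm (q - p)) 0)).
  by apply/funext => q; rewrite (max_l (enorm_ge0 _)).
move=> q; apply: (@continuous_comp _ _ _ (fun q => enorm (q - p)) (fun r => f i (Num.max r 0))).
  exact: continuous_enorm_sub.
exact/analytic_continuous/node_analytic.
Qed.

Lemma closed_voronoi X i : closed (voronoi Q beta X i).
Proof.
have -> : voronoi Q beta X i = Q `&` \bigcap_(j in [set j | j != i])
   [set q | f j (enorm (q - X j)) <= f i (enorm (q - X i))].
  apply/seteqP; split=> q /= [Qq H]; split=> // j ji /=.
    by rewrite !(enormBC q) H.
  by have := H j ji; rewrite /= !(enormBC q).
apply: closedI => //; apply: closed_bigI => j _.
have -> : [set q | f j (enorm (q - X j)) <= f i (enorm (q - X i))] =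
   (fun q => f j (enorm (q - X j)) - f i (enorm (q - X i))) @^-1` [set r | r <= 0].
  by apply/seteqP; split=> q /=; rewrite subr_le0.
apply: preimage_closed (@closed_le R 0) => q _.
exact: (continuousB (@continuous_node j (X j) q) (@continuous_node i (X i) q)).
Qed.

Lemma closed_sensed X i : closed (sensed Q beta rng X i).
Proof.
apply: closedI; first exact: closed_voronoi.
exact: (@preimage_closed _ _ (fun q => enorm (q - X i)) [set r | r <= rng i]
      (fun x _ => @continuous_enorm_sub R d (X i) x) (@closed_le R _)).
Qed.

Lemma sensed_sub X i : sensed Q beta rng X i `<=` Q.
Proof. by move=> q [[]]. Qed.

(** The subtracted value is the same for all agents, so that comparing excesses amounts to
    comparing the node functions as the cells do. *)
Definition excess X i q : R := f i (enorm (q - X i)) - f i (rng i).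

(** The truncation at 0 encodes the limited ranges: a point has positive cover only if
    some agent senses it. *)
Definition cover X q : R := \big[Num.max/0]_i excess X i q.

Lemma cover_ge0 X q : 0 <= cover X q.
Proof. exact: bigmax_ge_id. Qed.

Lemma excess_le_cover X i q : excess X i q <= cover X q.
Proof. exact: le_bigmax. Qed.

Lemma cover_cases X q : cover X q = 0 \/ exists i, cover X q = excess X i q.
Proof.
rewrite /cover; elim/big_rec: _ => [|i x _ IH]; first by left.
rewrite maxEle; case: ifP => _ //.
by right; exists i.
Qed.

Lemma cover_le1 X q : cover X q <= 1.
Proof.
have [->|[i ->]] := cover_cases X q; first exact: ler01.
have /andP[_ a] := node01 Hbeta01 i (enorm_ge0 (q - X i)).
have /andP[b _] := node01 Hbeta01 i (ltW (Hrng i)).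
by rewrite /excess; lra.
Qed.

Lemma continuous_excess X i : continuous (excess X i).
Proof.
by move=> q; exact: (continuousB (@continuous_node i (X i) q) (@cst_continuous _ _ (f i (rng i)) q)).
Qed.

Lemma continuous_cover X : continuous (cover X).
Proof.
rewrite /cover; elim: (index_enum _) => [|i r IH].
  by under eq_fun do rewrite big_nil; exact: cst_continuous.
under eq_fun do rewrite big_cons.
move=> q; apply: (@continuous_max _ _ (excess X i) _ q); last exact: IH.
exact: continuous_excess.
Qed.

Lemma le_rng X i q : f i (rng i) <= f i (enorm (q - X i)) -> enorm (q - X i) <= rng i.
Proof.
rewrite leNgt => /negP H; rewrite leNgt; apply/negP => rq; apply: H.
by apply: node_decr => //; exact: ltW.
Qed.

(** In the cell of [i] the excess of [i] is the largest, and within range it is nonnegative. *)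
Lemma sensed_cover X i q : sensed Q beta rng X i q -> cover X q = excess X i q.
Proof.
move=> [[Qq Hv] Hr]; apply/eqP; rewrite eq_le excess_le_cover andbT.
have e0 : 0 <= excess X i q.
  by rewrite /excess subr_ge0; apply: node_nincr => //; exact: enorm_ge0.
apply: bigmax_le => // j _; have [->//|ji] := eqVneq j i.
by rewrite /excess (Hrng_eq j i) lerD2r !(enormBC q) Hv.
Qed.

Lemma cover_gt0_sensed X q : Q q -> 0 < cover X q -> exists i, sensed Q beta rng X i q.
Proof.
move=> Qq c0; have [c00|[i cE]] := cover_cases X q; first by rewrite c00 ltxx in c0.
exists i; split; [split=> // j ji|].
  have := excess_le_cover X j q; rewrite cE /excess (Hrng_eq j i) lerD2r.
  by rewrite !(enormBC q).
apply: (@le_rng X); have := cover_ge0 X q; rewrite cE /excess; lra.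
Qed.

Definition lyapunov X : R := \int[mu]_(x in D) (phi (tuple_vec x) * cover X (tuple_vec x)).

Let mcover X : measurable_fun D (fun x => cover X (tuple_vec x) : realT).
Proof.
apply: (measurable_funS measurableT) => //.
exact: continuous_vmeasurable_fun (@continuous_cover X).
Qed.

Lemma measurable_lyapunov X :
  measurable_fun D (fun x => phi (tuple_vec x) * cover X (tuple_vec x) : realT).
Proof. by apply: measurable_funM; [exact: mphi|exact: mcover]. Qed.

Lemma phi_cover_bound X x : D x -> `|phi (tuple_vec x) * cover X (tuple_vec x)| <= 1.
Proof.
move=> Dx; have /andP[p0 p1] := Hphi01 Dx.
rewrite normrM !ger0_norm ?cover_ge0 // -[leRHS]mul1r; apply: ler_pM => //.
  exact: cover_ge0.
exact: cover_le1.
Qed.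

Lemma integrable_lyapunov X :
  mu.-integrable D (EFin \o (fun x => phi (tuple_vec x) * cover X (tuple_vec x))).
Proof.
exact: (bounded_integrable mD Doo (measurable_lyapunov X) (@phi_cover_bound X)).
Qed.

Lemma lyapunov_le X : lyapunov X <= fine (mu D).
Proof.
rewrite -[leRHS]mul1r; apply: le_trans (ler_norm _) _.
by apply: normr_Rintegral_le => //; [exact: measurable_lyapunov|exact: phi_cover_bound].
Qed.

Lemma ae_sensed_unique X : configuration Q X -> {ae mu, forall x, D x ->
  forall i j, sensed Q beta rng X i (tuple_vec x) ->
    sensed Q beta rng X j (tuple_vec x) -> i = j}.
Proof.
move=> [QX Xinj].
have : vnull (\bigcup_(ij : 'I_N * 'I_N) (if ij.1 == ij.2 then set0 else
    voronoi Q beta X ij.1 `&` voronoi Q beta X ij.2)).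
  apply: vnull_bigcup_fin => -[i j] /=; case: eqVneq => [_|ij].
    by rewrite /vnull preimage_set0; exact: negligible_set0.
  by apply: Hoverlap => //; exact: Xinj.
apply: negligibleS => x /= H; apply: contrapT => H2; apply: H => Dx i j [Vi _] [Vj _].
apply/eqP; apply/negPn/negP => ij; apply: H2; exists (i, j) => //=.
by rewrite (negbTE ij).
Qed.

(** The change of detection when the agents move from [X] to [Y] while each remains in charge
    of the region that it sensed at [X]. *)
Definition gain X Y q : R := \sum_i \1_(sensed Q beta rng X i) q *
  (f i (enorm (q - Y i)) - f i (enorm (q - X i))).

Lemma measurable_sensed_indic X i :
  measurable_fun D (fun x => \1_(sensed Q beta rng X i) (tuple_vec x) : realT).
Proof.
rewrite (_ : (fun x => _) = \1_(tuple_vec @^-1` sensed Q beta rng X i)).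
  by apply: measurable_indic; apply: closed_vmeasurable; exact: closed_sensed.
by apply/funext => x; rewrite !indicE; congr (_%:R); apply/idP/idP; rewrite !inE.
Qed.

Lemma measurable_node i p :
  measurable_fun D (fun x => f i (enorm (tuple_vec x - p)) : realT).
Proof.
apply: (measurable_funS measurableT) => //.
exact: continuous_vmeasurable_fun (@continuous_node i p).
Qed.

Lemma measurable_gain X Y : measurable_fun D (fun x => gain X Y (tuple_vec x) : realT).
Proof.
apply: measurable_sum => i; apply: measurable_funM; first exact: measurable_sensed_indic.
by apply: measurable_funB; exact: measurable_node.
Qed.

(** The agent in charge at [X] is one of the competitors in the maximum that defines the
    cover at [Y]; where nothing is sensed the cover can only increase from 0. *)
Lemma gain_le_cover X Y q : Q q ->
  (forall i j, sensed Q beta rng X i q -> sensed Q beta rng X j q -> i = j) ->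
  gain X Y q <= cover Y q - cover X q.
Proof.
move=> Qq uniq; have [[i si]|nos] := pselect (exists i, sensed Q beta rng X i q).
  rewrite /gain (bigD1 i) //= big1 ?addr0; last first.
    move=> j ji; rewrite indicE memNset ?mul0r // => sj.
    by move: ji; rewrite (uniq _ _ sj si) eqxx.
  rewrite indicE mem_set // mul1r (sensed_cover si) /excess.
  have := excess_le_cover Y i q; rewrite /excess; lra.
have c0 : cover X q = 0.
  apply/eqP; rewrite eq_le cover_ge0 andbT leNgt; apply/negP => /(cover_gt0_sensed Qq).
  exact: nos.
rewrite c0 subr0 /gain big1 ?cover_ge0 // => i _.
by rewrite indicE memNset ?mul0r // => si; apply: nos; exists i.
Qed.

Variables (diam L : R).
Hypothesis diamP : forall p q, Q p -> Q q -> enorm (p - q) <= diam.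
Hypothesis L0 : 0 <= L.
Hypothesis LP : forall i r s, 0 <= r <= diam -> 0 <= s <= diam ->
  `|f i r - f i s| <= L * `|r - s|.

Lemma node_dist_le i q p p' : Q q -> Q p -> Q p' ->
  `|f i (enorm (q - p)) - f i (enorm (q - p'))| <= L * enorm (p - p').
Proof.
move=> Qq Qp Qp'; apply: le_trans (LP _ _ _) _; rewrite ?enorm_ge0 ?diamP //.
apply: ler_wpM2l => //; apply: le_trans (enorm_dist _ _) _.
have -> : q - p - (q - p') = p' - p by rewrite opprB addrC addrA subrK.
by rewrite enormBC.
Qed.

Lemma gain_bound X Y q : Q q -> (forall i, Q (X i)) -> (forall i, Q (Y i)) ->
  `|gain X Y q| <= L * \sum_i enorm (Y i - X i).
Proof.
move=> Qq QX QY; rewrite mulr_sumr; apply: le_trans (ler_norm_sum _ _ _) _.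
apply: ler_sum => i _; rewrite normrM.
apply: le_trans (node_dist_le i Qq (QY i) (QX i)).
rewrite -[leRHS]mul1r; apply: ler_wpM2r => //.
by rewrite indicE; case: (_ \in _); rewrite ?normr1 ?normr0.
Qed.

Lemma phi_gain_bound X Y x : D x -> (forall i, Q (X i)) -> (forall i, Q (Y i)) ->
  `|phi (tuple_vec x) * gain X Y (tuple_vec x)| <= L * \sum_i enorm (Y i - X i).
Proof.
move=> Dx QX QY; have /andP[p0 p1] := Hphi01 Dx.
rewrite normrM ger0_norm // -[leRHS]mul1r; apply: ler_pM => //.
exact: gain_bound.
Qed.

Lemma lyapunov_increment X Y : configuration Q X -> (forall i, Q (Y i)) ->
  \int[mu]_(x in D) (phi (tuple_vec x) * gain X Y (tuple_vec x)) <=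
  lyapunov Y - lyapunov X.
Proof.
move=> cX QY; have [QX _] := cX.
rewrite /lyapunov -RintegralB //; try exact: integrable_lyapunov.
apply: ae_le_Rintegral => //.
- apply: (bounded_integrable mD Doo (C := L * \sum_i enorm (Y i - X i))).
    by apply: measurable_funM; [exact: mphi|exact: measurable_gain].
  by move=> x Dx; exact: phi_gain_bound.
- have := integrableB mD (integrable_lyapunov Y) (integrable_lyapunov X).
  by apply: eq_integrable => // x _; rewrite /= EFinB.
- have := ae_sensed_unique cX; apply: filterS => x uniq Dx.
  rewrite -mulrBr; apply: ler_wpM2l; first by have /andP[] := Hphi01 Dx.
  exact: gain_le_cover (uniq Dx).
Qed.

(** The increment inequality, applied in both directions. *)
Lemma lyapunov_lipschitz X Y : configuration Q X -> configuration Q Y ->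
  `|lyapunov Y - lyapunov X| <= L * fine (mu D) * \sum_i enorm (Y i - X i).
Proof.
have half (X' Y' : 'I_N -> 'rV[R]_d) : configuration Q X' -> configuration Q Y' ->
    - (L * fine (mu D) * \sum_i enorm (Y' i - X' i)) <= lyapunov Y' - lyapunov X'.
  move=> cX cY; have [QX _] := cX; have [QY _] := cY.
  apply: le_trans (lyapunov_increment cX QY).
  rewrite lerNl; apply: le_trans (ler_norm _) _; rewrite normrN mulrAC.
  apply: normr_Rintegral_le => //.
    by apply: measurable_funM; [exact: mphi|exact: measurable_gain].
  by move=> x Dx; exact: phi_gain_bound.
move=> cX cY; rewrite ler_norml half //= -lerN2 opprB.
have <- : \sum_i enorm (X i - Y i) = \sum_i enorm (Y i - X i).
  by apply: eq_bigr => i _; exact: enormBC.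
exact: half.
Qed.

(** * First moments and dissipation *)

Hypothesis d0 : (0 < d)%N.
Hypothesis slopeP : forall i r, 0 < r <= diam -> slope beta i r * r <= L.
Variable Mx : R.
Hypothesis Hmass : forall X, (forall i, Q (X i)) -> forall i,
  vol_integrable (sensed Q beta rng X i) (density phi beta X i) /\
  mass Q phi beta rng X i <= Mx.

Lemma densityE X i q : density phi beta X i q = phi q * slope beta i (enorm (q - X i)).
Proof. by rewrite /density /slope mulrN mulNr. Qed.

(** The arm [q - p] compensates the pole of the slope, so first moments about the agent have a
    bounded integrand even though the density may be unbounded. *)
Lemma slope_arm_le i q p k : Q q -> Q p ->
  `|slope beta i (enorm (q - p)) * (q - p) 0 k| <= L.
Proof.
move=> Qq Qp; have [->|qp] := eqVneq q p; first by rewrite subrr mxE mulr0 normr0.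
have r0 : 0 < enorm (q - p) by rewrite enorm_gt0 subr_eq0.
have s0 : 0 <= slope beta i (enorm (q - p)) by exact: slope_ge0.
have rd : 0 < enorm (q - p) <= diam by rewrite r0 diamP.
rewrite normrM ger0_norm //; apply: le_trans (slopeP i rd).
by rewrite ler_wpM2l // coord_le_enorm.
Qed.

Lemma density_ge0 X i q : Q q -> Q (X i) -> q != X i ->
  0 <= density phi beta X i q.
Proof.
move=> Qq QX qX; rewrite densityE mulr_ge0 //; first by have /andP[] := Hphi01 Qq.
by apply: slope_ge0 => //; rewrite enorm_gt0 subr_eq0.
Qed.

(** The coordinates of [\int (q - x_i) density], that is of [M_i (C_i - x_i)]. The region is
    encoded by an indicator so that moments of different agents and configurations
    are integrals over the same set. *)
Definition arm_moment X i (k : 'I_d) : R := \int[mu]_(x in D) (phi (tuple_vec x) *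
  (\1_(sensed Q beta rng X i) (tuple_vec x) *
   (slope beta i (enorm (tuple_vec x - X i)) * (tuple_vec x - X i) 0 k))).

Let E X i : set (d.-tuple realT) := tuple_vec @^-1` sensed Q beta rng X i.

Let mE X i : measurable (E X i).
Proof. by apply: closed_vmeasurable; exact: closed_sensed. Qed.

Let ED X i : E X i `<=` D.
Proof. by move=> x; exact: sensed_sub. Qed.

Lemma measurable_slope i p : measurable_fun D
  (fun x => slope beta i (enorm (tuple_vec x - p)) : realT).
Proof.
apply: (measurable_funS measurableT) => //; apply: measurable_radial => r.
exact: slope_continuous.
Qed.

Lemma measurable_arm p k : measurable_fun D (fun x => (tuple_vec x - p) 0 k : realT).
Proof.
apply: (measurable_funS measurableT) => //.
exact: continuous_vmeasurable_fun (@continuous_coord_sub R d p k).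
Qed.

Lemma measurable_arm_moment X i k : measurable_fun D (fun x => phi (tuple_vec x) *
  (\1_(sensed Q beta rng X i) (tuple_vec x) *
   (slope beta i (enorm (tuple_vec x - X i)) * (tuple_vec x - X i) 0 k)) : realT).
Proof.
apply: measurable_funM; first exact: mphi.
apply: measurable_funM; first exact: measurable_sensed_indic.
by apply: measurable_funM; [exact: measurable_slope|exact: measurable_arm].
Qed.

Lemma arm_moment_integrand_le X i k x : D x -> Q (X i) -> `|phi (tuple_vec x) *
  (\1_(sensed Q beta rng X i) (tuple_vec x) *
   (slope beta i (enorm (tuple_vec x - X i)) * (tuple_vec x - X i) 0 k))| <= L.
Proof.
move=> Dx QX; have /andP[p0 p1] := Hphi01 Dx.
rewrite normrM ger0_norm // -[leRHS]mul1r; apply: ler_pM => //.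
rewrite normrM -[leRHS]mul1r; apply: ler_pM => //; last exact: slope_arm_le.
by rewrite indicE; case: (_ \in _); rewrite ?normr1 ?normr0.
Qed.

Lemma arm_moment_sensed X i k : arm_moment X i k =
  \int[mu]_(x in E X i) (density phi beta X i (tuple_vec x) * (tuple_vec x - X i) 0 k).
Proof.
rewrite (Rintegral_subset _ _ (@ED X i)); apply: eq_Rintegral => x _.
rewrite densityE (_ : \1_(E X i) x = \1_(sensed Q beta rng X i) (tuple_vec x)).
  by ring.
by rewrite !indicE; congr (_%:R); apply/idP/idP; rewrite !inE.
Qed.

(** The value of the density at the agent itself is meaningless. *)
Lemma ae_off_center p : {ae mu, forall x, D x -> tuple_vec x != p}.
Proof.
apply: negligibleS (point_vnull p d0) => x /= H; apply: contrapT => xp; apply: H => _.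
by apply/eqP.
Qed.

Let int_density X i : (forall i, Q (X i)) ->
  mu.-integrable (E X i) (EFin \o (fun x => density phi beta X i (tuple_vec x))).
Proof. by move=> QX; have [] := Hmass QX i. Qed.

Lemma mass_ge0 X i : (forall i, Q (X i)) -> 0 <= mass Q phi beta rng X i.
Proof.
move=> QX; have int_dens := int_density i QX.
have -> : 0 = \int[mu]_(x in E X i) (0 : R) by rewrite Rintegral_cst // mul0r.
apply: ae_le_Rintegral => //.
  by apply: (eq_integrable (mE X i) _ (cst 0%E)) => //; exact: integrable0.
apply: filterS (ae_off_center (X i)) => x xX Ex; have Dx := ED Ex.
by apply: density_ge0 => //; exact: xX.
Qed.

Lemma integrable_arm X i k : (forall i, Q (X i)) ->
  mu.-integrable (E X i) (EFin \o (fun x =>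
    density phi beta X i (tuple_vec x) * (tuple_vec x) 0 k)).
Proof.
move=> QX; have int_dens := int_density i QX.
have mk : measurable_fun (E X i) (fun x : d.-tuple realT => tuple_vec x 0 k : realT).
  by apply: (measurable_funS measurableT) => //; exact: measurable_coord.
have bk : [bounded (tuple_vec x : 'rV[R]_d) 0 k | x in E X i].
  exists K; split; first exact: num_real.
  by move=> y Ky x /ED /bQ xK; exact: le_trans (xK k) (ltW Ky).
have := integrableMr (mE X i) mk bk int_dens.
apply: eq_integrable => // x _; rewrite /= -EFinM; congr EFin; exact: mulrC.
Qed.

Lemma arm_moment_recenter X i k : (forall i, Q (X i)) ->
  arm_moment X i k = moment Q phi beta rng X i 0 k - X i 0 k * mass Q phi beta rng X i.
Proof.
move=> QX; have int_dens := int_density i QX.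
rewrite arm_moment_sensed.
transitivity (\int[mu]_(x in E X i) (density phi beta X i (tuple_vec x) * tuple_vec x 0 k
    - X i 0 k * density phi beta X i (tuple_vec x))).
  by apply: eq_Rintegral => x _; rewrite !mxE; ring.
have int_Z := integrableZl (mE X i) (X i 0 k) int_dens.
rewrite RintegralB //; last exact: integrable_arm.
rewrite RintegralZl //; congr (_ - _); rewrite mxE; apply: eq_Rintegral => x _.
exact: mulrC.
Qed.

(** Gives the vanishing of the moment of a massless region, which makes [arm_moment] consistent
    with the convention on centroids, and the bound on the distance to the centroid. *)
Lemma arm_moment_le_mass X i k : (forall i, Q (X i)) ->
  `|arm_moment X i k| <= diam * mass Q phi beta rng X i.
Proof.
move=> QX; have int_dens := int_density i QX.
have int_t : mu.-integrable (E X i) (EFin \o (fun x =>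
    density phi beta X i (tuple_vec x) * (tuple_vec x - X i) 0 k)).
  have int_Z := integrableZl (mE X i) (X i 0 k) int_dens.
  have := integrableB (mE X i) (integrable_arm i k QX) int_Z.
  apply: eq_integrable => // x _.
  change ((density phi beta X i (tuple_vec x) * tuple_vec x 0 k
    - X i 0 k * density phi beta X i (tuple_vec x))%:E =
    (density phi beta X i (tuple_vec x) * (tuple_vec x - X i) 0 k)%:E).
  by congr EFin; rewrite !mxE; ring.
have int_Z := integrableZl (mE X i) diam int_dens.
have -> : diam * mass Q phi beta rng X i =
    \int[mu]_(x in E X i) (diam * density phi beta X i (tuple_vec x)).
  by rewrite RintegralZl.
rewrite arm_moment_sensed; apply: le_trans (le_normr_Rintegral (mE X i) int_t) _.
apply: ae_le_Rintegral => //; first exact: integrable_norm.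
apply: filterS (ae_off_center (X i)) => x xX Ex; have Dx := ED Ex.
have d1 : 0 <= density phi beta X i (tuple_vec x).
  by apply: density_ge0 => //; exact: xX.
rewrite normrM ger0_norm // mulrC; apply: ler_wpM2r => //.
exact: le_trans (coord_le_enorm _ _) (diamP _ _).
Qed.

Lemma arm_momentE X i k : (forall i, Q (X i)) -> arm_moment X i k =
  mass Q phi beta rng X i * (centroid Q phi beta rng X i - X i) 0 k.
Proof.
move=> QX; rewrite /centroid; case: eqVneq => [m0|m0].
  rewrite m0 mul0r; apply/eqP; rewrite -normr_le0.
  by apply: le_trans (arm_moment_le_mass i k QX) _; rewrite m0 mulr0.
rewrite arm_moment_recenter // !mxE; field.
exact: m0.
Qed.

Lemma centroid_dist X i k : (forall i, Q (X i)) ->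
  `|(centroid Q phi beta rng X i - X i) 0 k| <= diam.
Proof.
move=> QX; have [m0|m0] := eqVneq (mass Q phi beta rng X i) 0.
  rewrite /centroid m0 eqxx subrr mxE normr0.
  by apply: le_trans (diamP (QX i) (QX i)); exact: enorm_ge0.
have mp : 0 < mass Q phi beta rng X i by rewrite lt_def m0 mass_ge0.
rewrite -(ler_pM2l mp) mulrC [leRHS]mulrC; apply: le_trans (arm_moment_le_mass i k QX).
by rewrite arm_momentE // normrM (gtr0_norm mp) mulrC.
Qed.

(** Up to the factor [2 k], the growth rate of the Lyapunov function along the flow. *)
Definition dissipation X : R :=
  \sum_i mass Q phi beta rng X i * enorm (centroid Q phi beta rng X i - X i) ^+ 2.

Lemma dissipation_ge0 X : (forall i, Q (X i)) -> 0 <= dissipation X.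
Proof.
by move=> QX; apply: sumr_ge0 => i _; rewrite mulr_ge0 ?mass_ge0 // sqr_ge0.
Qed.

(** [|G_i|^2 = M_i (M_i |C_i - x_i|^2)], and the second factor is one term of the dissipation. *)
Lemma sqr_arm_moment_le X i k : (forall i, Q (X i)) ->
  arm_moment X i k ^+ 2 <= Mx * dissipation X.
Proof.
move=> QX; rewrite arm_momentE //; set m := mass _ _ _ _ _ _; set v := _ - _.
have m0 : 0 <= m by exact: mass_ge0.
have [_ mM] := Hmass QX i.
have le1 : m * enorm v ^+ 2 <= dissipation X.
  rewrite /dissipation (bigD1 i) //= lerDl; apply: sumr_ge0 => j _.
  by rewrite mulr_ge0 ?mass_ge0 // sqr_ge0.
have le2 : v 0 k ^+ 2 <= enorm v ^+ 2.
  rewrite -real_normK ?num_real //; apply: lerXn2r; rewrite ?nnegrE ?enorm_ge0 //.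
  exact: coord_le_enorm.
rewrite exprMn expr2 -mulrA; apply: ler_pM => //.
  by rewrite mulr_ge0 // sqr_ge0.
by apply: le_trans le1; apply: ler_wpM2l.
Qed.

Lemma critical_arm_moment X : critical_point Q phi beta rng X <->
  (forall i, Q (X i)) /\ forall i k, arm_moment X i k = 0.
Proof.
split=> -[QX H]; split=> // i.
  move=> k; have /rowP/(_ k) := H i; rewrite !mxE arm_momentE // !mxE -mulrA.
  by move/eqP; rewrite mulf_eq0 pnatr_eq0 /= => /eqP.
apply/rowP => k; rewrite /objective_gradient -scalerA mxE.
by have := H i k; rewrite arm_momentE // [X in _ * X = _ -> _]mxE !mxE => ->; rewrite mulr0.
Qed.

(** * Growth rate along a motion *)

Lemma is_derive_coord (p : R -> 'rV[R]_d) (t : R) (v : 'rV[R]_d) k :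
  is_derive t (1 : R) p v -> is_derive t (1 : R) (fun s => p s 0 k) (v 0 k).
Proof.
move=> [dp pv]; have dk := (iffLR (derivable_mxP p t 1) dp) 0 k.
apply: DeriveDef => //; rewrite -pv derive_mx // mxE //.
Qed.

Lemma is_derive_sqr_dist (p : R -> 'rV[R]_d) (t : R) (v : 'rV[R]_d) q :
  is_derive t (1 : R) p v ->
  is_derive t (1 : R) (fun s => enorm (q - p s) ^+ 2) (- 2 * dotp v (q - p t)).
Proof.
move=> dp.
have dk k : is_derive t (1 : R) (fun s => (q 0 k - p s 0 k) ^+ 2)
    (- 2 * (v 0 k * (q - p t) 0 k)).
  have dpk := is_derive_coord k dp.
  by apply: is_derive_eq; rewrite !mxE /GRing.scale /=; ring.
have -> : (fun s => enorm (q - p s) ^+ 2) =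
    \sum_k (fun s => (q 0 k - p s 0 k) ^+ 2).
  apply/funext => s; rewrite sqr_enorm fct_sumE; apply: eq_bigr => k _.
  by rewrite !mxE expr2.
by rewrite /dotp mulr_sumr; exact: is_derive_sum.
Qed.

Lemma is_derive_node (p : R -> 'rV[R]_d) (t : R) (v : 'rV[R]_d) i q :
  is_derive t (1 : R) p v -> q != p t ->
  is_derive t (1 : R) (fun s => f i (enorm (q - p s)))
    (2 * slope beta i (enorm (q - p t)) * dotp v (q - p t)).
Proof.
move=> dp qp; have r0 : 0 < enorm (q - p t) by rewrite enorm_gt0 subr_eq0.
have -> : (fun s => f i (enorm (q - p s))) =
    node_sq beta i \o (fun s => enorm (q - p s) ^+ 2).
  by apply/funext => s; rewrite /= /node_sq sqrtr_sqr ger0_norm // enorm_ge0.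
have D1 := node_is_derive_sq Hbeta_incr Hbeta_analytic i r0.
have D2 := is_derive_sqr_dist q dp.
have := @is_derive1_comp R (node_sq beta i) (fun s => enorm (q - p s) ^+ 2) t _ _ D1 D2.
by congr is_derive; ring.
Qed.

Lemma is_derive_seq (V : normedModType R) (u : R -> V) (t : R) (du : V) : is_derive t (1 : R) u du ->
  n.+1%:R *: (u (t + n.+1%:R^-1) - u t) @[n --> \oo] --> du.
Proof.
move=> [du1 <-].
have cv : h^-1 *: ((u \o shift t) (h *: (1 : R)) - u t) @[h --> 0^'] --> 'D_1 u t by exact: du1.
have hn : (n.+1%:R^-1 : R) @[n --> \oo] --> (0 : R)^'.
  move=> A /= [e /= e0 eA].
  have [m _ mP] := near_infty_natSinv_lt (PosNum e0).
  exists m => // n /= mn; apply: eA => /=; last by rewrite gt_eqF // invr_gt0.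
  by rewrite sub0r normrN gtr0_norm ?invr_gt0 //; exact: mP.
have := cvg_comp _ _ hn cv; apply: cvg_trans; apply: near_eq_cvg; apply: nearW => n /=.
have -> : n.+1%:R^-1%:A = n.+1%:R^-1 :> R by exact: mulr1.
by rewrite invrK [_ + t]addrC.
Qed.

(** The regions in [gain] are those at time [t], so only the integrand varies. The difference
    quotients are bounded because node functions are Lipschitz and the motion is
    differentiable at [t]; off the agents the integrand converges. *)
Lemma gain_rate (P : R -> 'I_N -> 'rV[R]_d) (t : R) (v : 'I_N -> 'rV[R]_d) :
  (forall s i, t <= s -> Q (P s i)) ->
  (forall i, is_derive t (1 : R) (fun s => P s i) (v i)) ->
  n.+1%:R * (\int[mu]_(x in D) (phi (tuple_vec x) *
     gain (P t) (P (t + n.+1%:R^-1)) (tuple_vec x))) @[n --> \oo] -->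
  2 * \sum_i \sum_k v i 0 k * arm_moment (P t) i k.
Proof.
move=> QP dP.
pose F n x : R := n.+1%:R * (phi (tuple_vec x) *
     gain (P t) (P (t + n.+1%:R^-1)) (tuple_vec x)).
pose G (x : d.-tuple realT) : R := \sum_i \sum_k (2 * v i 0 k) * (phi (tuple_vec x) *
  (\1_(sensed Q beta rng (P t) i) (tuple_vec x) *
   (slope beta i (enorm (tuple_vec x - P t i)) * (tuple_vec x - P t i) 0 k))).
have Qt i : Q (P t i) by exact: QP.
have Qn n i : Q (P (t + n.+1%:R^-1) i) by apply: QP; rewrite lerDl invr_ge0.
have mG n : measurable_fun D (fun x => phi (tuple_vec x) *
     gain (P t) (P (t + n.+1%:R^-1)) (tuple_vec x) : realT).
  by apply: measurable_funM; [exact: mphi|exact: measurable_gain].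
have intT i k := bounded_integrable mD Doo (measurable_arm_moment (P t) i k)
  (fun x Dx => arm_moment_integrand_le k Dx (Qt i)).
have -> : 2 * \sum_i \sum_k v i 0 k * arm_moment (P t) i k = \int[mu]_(x in D) G x.
  rewrite /G Rintegral_sum //; last first.
    by move=> i; apply: integrable_sumr => // k; exact: integrable_scaler.
  rewrite mulr_sumr; apply: eq_bigr => i _.
  rewrite Rintegral_sum //; last by move=> k; exact: integrable_scaler.
  rewrite mulr_sumr; apply: eq_bigr => k _.
  by rewrite RintegralZl // mulrA.
have -> : (fun n => n.+1%:R * (\int[mu]_(x in D) (phi (tuple_vec x) *
     gain (P t) (P (t + n.+1%:R^-1)) (tuple_vec x)))) =
   (fun n => \int[mu]_(x in D) F n x).
  apply/funext => n; rewrite /F RintegralZl //.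
  exact: (bounded_integrable mD Doo (mG n) (fun x Dx => phi_gain_bound Dx Qt (Qn n))).
(* the difference quotients of the positions converge, hence are bounded *)
have [C CP] : exists C : R, forall n i, enorm (n.+1%:R *: (P (t + n.+1%:R^-1) i - P t i)) <= C.
  have /choice[C CP] : forall i, exists C : R, forall n,
      enorm (n.+1%:R *: (P (t + n.+1%:R^-1) i - P t i)) <= C.
    move=> i; have := is_derive_seq (dP i).
    move=> /(continuous_cvg _ (@continuous_enorm_sub R d 0 (v i))) cv.
    have /cvg_seq_bounded[M [_ MP]] := cvgP _ cv.
    have M1 : M < `|M| + 1 by rewrite (le_lt_trans (ler_norm M)) // ltrDl.
    exists (`|M| + 1) => n; have := MP _ M1 n I.
    by rewrite /= subr0 ger0_norm ?enorm_ge0.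
  exists (\sum_i C i) => n i; apply: le_trans (CP i n) _.
  rewrite (bigD1 i) //= lerDl; apply: sumr_ge0 => j _.
  exact: le_trans (enorm_ge0 _) (CP j 0%N).
apply: (bounded_Rintegral_cvg mD Doo (C := L * (N%:R * C))).
- by move=> n; apply: measurable_funM => //; exact: mG.
- apply: measurable_sum => i; apply: measurable_sum => k; apply: measurable_funM => //.
  exact: measurable_arm_moment.
- move=> n x Dx; rewrite /F normrM ger0_norm //.
  apply: le_trans (ler_wpM2l _ (phi_gain_bound Dx Qt (Qn n))) _ => //.
  rewrite mulrCA; apply: ler_wpM2l => //; rewrite mulr_sumr.
  apply: le_trans (ler_sum _ _) _ => [i _|].
    apply: le_trans (CP n i); rewrite enormZ ger0_norm //.
  by rewrite sumr_const card_ord mulr_natl.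
- have : {ae mu, forall x, D x -> forall i, tuple_vec x != P t i}.
    have offc : \forall x \ae mu, forall i, D x -> tuple_vec x != P t i.
      by apply: filter_forall => i; exact: ae_off_center.
    by apply: filterS offc => x xP Dx i; exact: xP.
  apply: filterS => x xP Dx; set q := tuple_vec x.
  have -> : (fun n => F n x) = (fun n => \sum_i phi q * \1_(sensed Q beta rng (P t) i) q *
      (n.+1%:R *: (f i (enorm (q - P (t + n.+1%:R^-1) i)) - f i (enorm (q - P t i)) : R^o))).
    apply/funext => n; rewrite /F /gain mulrA mulr_sumr; apply: eq_bigr => i _.
    by rewrite /GRing.scale /=; ring.
  have -> : G x = \sum_i phi q * \1_(sensed Q beta rng (P t) i) q *
      (2 * slope beta i (enorm (q - P t i)) * dotp (v i) (q - P t i)).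
    rewrite /G; apply: eq_bigr => i _; rewrite /dotp !mulr_sumr; apply: eq_bigr => k _.
    by rewrite -/q; ring.
  apply: cvg_sumr => i _; apply: cvgMr.
  apply: (is_derive_seq (u := fun s => f i (enorm (q - P s i)))).
  by apply: (is_derive_node (p := fun s => P s i)) => //; exact: xP.
Qed.

(** * Lower bound on the dissipation near a noncritical limit *)

Lemma cvg_node_seq (Y : nat -> 'rV[R]_d) p i q :
  Y n @[n --> \oo] --> p -> f i (enorm (q - Y n)) @[n --> \oo] --> f i (enorm (q - p)).
Proof.
move=> Yp; under eq_fun do rewrite enormBC; rewrite (enormBC q).
exact: (continuous_cvg _ (@continuous_node i q p) Yp).
Qed.

Lemma cvg_slope_arm (Y : nat -> 'rV[R]_d) p i q k : q != p ->
  Y n @[n --> \oo] --> p ->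
  slope beta i (enorm (q - Y n)) * (q - Y n) 0 k @[n --> \oo] -->
    slope beta i (enorm (q - p)) * (q - p) 0 k.
Proof.
move=> qp Yp; have r0 : 0 < enorm (q - p) by rewrite enorm_gt0 subr_eq0.
have cr : enorm (q - Y n) @[n --> \oo] --> enorm (q - p).
  under eq_fun do rewrite enormBC; rewrite (enormBC q).
  exact: (continuous_cvg _ (@continuous_enorm_sub R d q p) Yp).
apply: cvgM.
  exact: (cvg_comp _ _ cr (@slope_continuous _ _ _ Hbeta_incr Hbeta_analytic i _ r0)).
have -> : (fun n => (q - Y n) 0 k) = (fun n => - (Y n - q) 0 k).
  by apply/funext => n; rewrite !mxE opprB.
have -> : (q - p) 0 k = - (p - q) 0 k by rewrite !mxE opprB.
by apply: cvgN; exact: (continuous_cvg _ (@continuous_coord_sub R d q k p) Yp).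
Qed.

Section limit_configuration.
Variables (Y : nat -> 'I_N -> 'rV[R]_d) (X0 : 'I_N -> 'rV[R]_d) (i : 'I_N) (k : 'I_d).
Hypothesis cY : forall n, configuration Q (Y n).
Hypothesis QX0 : forall j, Q (X0 j).
Hypothesis YX0 : forall j, Y n j @[n --> \oo] --> X0 j.

(** The agents that become indistinguishable from [i] in the limit. Before the limit they
    share among themselves, in a way that may oscillate, the region of [i] at [X0]. *)
Let twin j := `[< X0 j = X0 i /\ forall r, 0 <= r -> f j r = f i r >].

(** Almost every point avoids the position and the sphere of [i], is not tied between [i] and
    a distinguishable agent at the limit, and is never sensed by two agents before it. *)
Let good q := [/\ q != X0 i, enorm (q - X0 i) != rng i,
  (forall j, voronoi Q beta X0 i q -> f j (enorm (q - X0 j)) = f i (enorm (q - X0 i)) -> twin j) &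
  forall n j l, sensed Q beta rng (Y n) j q -> sensed Q beta rng (Y n) l q -> j = l].

(** A tie with a distinguishable agent is negligible for one of two reasons: at different
    positions by the hypothesis on overlapping cells, and at the same position because the
    difference of the node functions is analytic and not identically zero. *)
Let ae_good : {ae mu, forall x, D x -> good (tuple_vec x)}.
Proof.
have h1 := ae_off_center (X0 i).
have h2 : {ae mu, forall x, D x -> enorm (tuple_vec x - X0 i) != rng i}.
  apply: negligibleS (sphere_vnull (X0 i) (rng i) d0 mD bQ) => x /= H.
  apply: contrapT => H2; apply: H => Dx; apply/eqP => e; apply: H2; split => //.
have h3 j : {ae mu, forall x, D x -> voronoi Q beta X0 i (tuple_vec x) ->
    f j (enorm (tuple_vec x - X0 j)) = f i (enorm (tuple_vec x - X0 i)) -> twin j}.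
  have [tj|ntj] := boolP (twin j); first exact: aeW.
  have [ji|ji] := eqVneq (X0 j) (X0 i).
    have [r r0 fr] : exists2 r, 0 <= r & f j r - f i r != 0.
      apply: contrapT => nr; move/negP: ntj; apply; apply/asboolP; split=> // r r0.
      apply/eqP; rewrite -subr_eq0; apply/negPn/negP => fr; apply: nr; exists r => //.
    have an := analytic_nonnegB (node_analytic Hbeta_analytic j) (node_analytic Hbeta_analytic i).
    apply: negligibleS (analytic_zeros_vnull (X0 i) d0 mD bQ an (ex_intro2 _ _ r r0 fr)) => x /= H.
    apply: contrapT => H2; apply: H => Dx Vi; rewrite ji => e; exfalso; apply: H2.
    by split => //; rewrite e subrr.
  have ij : X0 i != X0 j by rewrite eq_sym.
  apply: negligibleS (Hoverlap QX0 ij) => x /= H.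
  apply: contrapT => H2; apply: H => Dx Vi e; exfalso; apply: H2.
  split=> //; split=> // l lj; have [_ Vl] := Vi.
  rewrite (enormBC (X0 j)) e -(enormBC (X0 i)).
  by have [->//|li] := eqVneq l i; exact: Vl.
have h4 : {ae mu, forall x, D x -> forall n j l, sensed Q beta rng (Y n) j (tuple_vec x) ->
    sensed Q beta rng (Y n) l (tuple_vec x) -> j = l}.
  have : {ae mu, forall x, forall n, D x -> forall j l, sensed Q beta rng (Y n) j (tuple_vec x) ->
    sensed Q beta rng (Y n) l (tuple_vec x) -> j = l}.
    by apply/ae_foralln => n; exact: ae_sensed_unique.
  by apply: filterS => x xP Dx n; exact: xP.
have h3' : \forall x \ae mu, forall j, D x -> voronoi Q beta X0 i (tuple_vec x) ->
    f j (enorm (tuple_vec x - X0 j)) = f i (enorm (tuple_vec x - X0 i)) -> twin j.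
  exact: filter_forall.
near=> x => Dx; split.
- exact: (near h1 x).
- exact: (near h2 x).
- by move=> j; exact: (near h3' x).
- exact: (near h4 x).
Unshelve. all: by end_near. Qed.

Let term n j q := phi q * (\1_(sensed Q beta rng (Y n) j) q *
   (slope beta j (enorm (q - Y n j)) * (q - Y n j) 0 k)).

(** At a point sensed by [i] at [X0], eventually exactly one agent senses the point, and it
    is a twin of [i], whose slope is that of [i]; at a point not sensed by [i] at [X0],
    eventually no twin senses it. *)
Let term_cvg q : Q q -> good q -> (\sum_(j | twin j) term n j q) @[n --> \oo] -->
  phi q * (\1_(sensed Q beta rng X0 i) q * (slope beta i (enorm (q - X0 i)) * (q - X0 i) 0 k)).
Proof.
move=> Qq [qX qR gtwin uniq].
have twin_slope j : twin j -> slope beta j = slope beta i.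
  move=> /asboolP[_ fji]; rewrite /slope (_ : node_sq beta j = node_sq beta i) //.
  by apply/funext => s; rewrite /node_sq fji // sqrtr_ge0.
have twin_node j : twin j -> f j (enorm (q - X0 j)) = f i (enorm (q - X0 i)).
  by move=> /asboolP[-> fji]; rewrite fji // enorm_ge0.
have [si|nsi] := pselect (sensed Q beta rng X0 i q).
  rewrite indicE mem_set // mul1r.
  pose a := phi q * (slope beta i (enorm (q - X0 i)) * (q - X0 i) 0 k).
  have Vi := si.1.
  have lev : f i (rng i) < f i (enorm (q - X0 i)).
    apply: node_decr => //; first exact: enorm_ge0.
    by rewrite lt_neqAle qR; exact: si.2.
  (* within range the point stays sensed by some agent, and only a twin can win *)
  have above : \forall n \near \oo, f i (rng i) < f i (enorm (q - Y n i)).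
    have cv := @cvg_node_seq (fun n => Y n i) (X0 i) i q (@YX0 i).
    exact: (cv _ (lt_nbhsr lev)).
  have below : \forall n \near \oo, forall j, ~~ twin j ->
      f j (enorm (q - Y n j)) < f i (enorm (q - Y n i)).
    apply: filter_forall => j; have [tj|ntj] := boolP (twin j); first exact: nearW.
    have ltji : f j (enorm (q - X0 j)) < f i (enorm (q - X0 i)).
      rewrite lt_neqAle; apply/andP; split.
        by apply: contra ntj => /eqP; exact: gtwin.
      rewrite !(enormBC q); have [_ V] := Vi; have [->//|ji] := eqVneq j i; exact: V.
    have dcv : f i (enorm (q - Y n i)) - f j (enorm (q - Y n j)) @[n --> \oo] -->
        f i (enorm (q - X0 i)) - f j (enorm (q - X0 j)).
      by apply: cvgB; exact: cvg_node_seq.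
    have d0' : 0 < f i (enorm (q - X0 i)) - f j (enorm (q - X0 j)) by rewrite subr_gt0.
    have H : \forall n \near \oo, 0 < f i (enorm (q - Y n i)) - f j (enorm (q - Y n j)).
      exact: (dcv _ (lt_nbhsr d0')).
    by apply: filterS H => n; rewrite subr_gt0.
  apply/cvgrPdist_lt => e e0.
  have close : \forall n \near \oo, forall j, twin j ->
      `|a - phi q * (slope beta j (enorm (q - Y n j)) * (q - Y n j) 0 k)| < e.
    apply: filter_forall => j; have [tj|ntj] := boolP (twin j); last exact: nearW.
    have [Xji _] := asboolP _ tj.
    have qj : q != X0 j by rewrite Xji.
    have cv : phi q * (slope beta j (enorm (q - Y n j)) * (q - Y n j) 0 k) @[n --> \oo] -->
        phi q * (slope beta j (enorm (q - X0 j)) * (q - X0 j) 0 k).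
      by apply: cvgMr; exact: (@cvg_slope_arm (fun n => Y n j) (X0 j) j q k qj (@YX0 j)).
    have H' : \forall n \near \oo, `|phi q * (slope beta j (enorm (q - X0 j)) * (q - X0 j) 0 k)
        - phi q * (slope beta j (enorm (q - Y n j)) * (q - Y n j) 0 k)| < e.
      exact: (iffLR (cvgrPdist_lt _ _) cv e e0).
    apply: filterS H' => n H _.
    by move: H; rewrite Xji (twin_slope j tj).
  near=> n.
  have cpos : 0 < cover (Y n) q.
    apply: lt_le_trans (excess_le_cover (Y n) i q).
    by rewrite subr_gt0; near: n.
  have [j sj] := cover_gt0_sensed Qq cpos.
  have tj : twin j.
    apply/negPn/negP => ntj.
    have ltji : f j (enorm (q - Y n j)) < f i (enorm (q - Y n i)).
      by move: j ntj {sj}; near: n.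
    have ij : i != j by apply: contraTneq ltji => ->; rewrite ltxx.
    have [[_ Vj] _] := sj; have := Vj i ij.
    by rewrite -!(enormBC q) leNgt ltji.
  rewrite (bigD1 j) //= big1 ?addr0; last first.
    move=> l /andP[_ lj]; rewrite /term indicE memNset ?mul0r ?mulr0 // => sl.
    by move: lj; rewrite (uniq n l j sl sj) eqxx.
  rewrite /term indicE mem_set // mul1r.
  by move: j tj {sj}; near: n.
rewrite indicE memNset // mul0r mulr0.
apply: cvg_near_cst.
have far : \forall n \near \oo, forall j, twin j -> ~ sensed Q beta rng (Y n) j q.
  apply: filter_forall => j; have [tj|ntj] := boolP (twin j); last exact: nearW.
  have [lev|lev] := ltP (f i (enorm (q - X0 i))) (f i (rng i)).
    have cv := @cvg_node_seq (fun n => Y n j) (X0 j) j q (@YX0 j).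
    rewrite (twin_node j tj) in cv.
    have H' : \forall n \near \oo, f j (enorm (q - Y n j)) < f i (rng i).
      exact: (cv _ (lt_nbhsl lev)).
    apply: filterS H' => n H _ [_ sj].
    move: H; rewrite (Hrng_eq i j) ltNge => /negP; apply.
    by apply: node_nincr => //; exact: enorm_ge0.
  have [l [li ltl]] : exists l, l != i /\ f i (enorm (q - X0 i)) < f l (enorm (q - X0 l)).
    apply: contrapT => nl; apply: nsi; split; last exact: (@le_rng X0).
    split=> // l li; rewrite leNgt; apply/negP => H; apply: nl; exists l; split=> //.
    by rewrite !(enormBC q).
  have dcv : f l (enorm (q - Y n l)) - f j (enorm (q - Y n j)) @[n --> \oo] -->
      f l (enorm (q - X0 l)) - f j (enorm (q - X0 j)).
    by apply: cvgB; exact: cvg_node_seq.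
  have d0' : 0 < f l (enorm (q - X0 l)) - f j (enorm (q - X0 j)).
    by rewrite subr_gt0 (twin_node j tj).
  have H' : \forall n \near \oo, 0 < f l (enorm (q - Y n l)) - f j (enorm (q - Y n j)).
    exact: (dcv _ (lt_nbhsr d0')).
  apply: filterS H' => n; rewrite subr_gt0 => H _ [[_ Vj] _].
  have lj : l != j by apply: contraTneq H => ->; rewrite ltxx.
  by have := Vj l lj; rewrite -!(enormBC q) leNgt H.
apply: filterS far => n nP; rewrite big1 // => j tj.
by rewrite /term indicE memNset ?mul0r ?mulr0 //; exact: nP.
Unshelve. all: by end_near. Qed.

Lemma arm_moment_limit :
  (\sum_(j | twin j) arm_moment (Y n) j k) @[n --> \oo] --> arm_moment X0 i k.
Proof.
have QY n j : Q (Y n j) by have [] := cY n.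
have int_term n j : mu.-integrable D (EFin \o (fun x => term n j (tuple_vec x))).
  apply: (bounded_integrable mD Doo (measurable_arm_moment (Y n) j k)) => x Dx.
  exact: (@arm_moment_integrand_le (Y n) j k x Dx (QY n j)).
have -> : (fun n => \sum_(j | twin j) arm_moment (Y n) j k) =
    (fun n => \int[mu]_(x in D) (\sum_(j | twin j) term n j (tuple_vec x))).
  apply/funext => n; under [RHS]eq_Rintegral do rewrite -big_filter.
  by rewrite Rintegral_sum // big_filter.
apply: (bounded_Rintegral_cvg mD Doo (C := N%:R * L)).
- move=> n; apply/measurable_EFinP.
  under eq_fun do rewrite -big_filter.
  by have /integrableP[] := integrable_sumr mD [seq j <- index_enum _ | twin j] (int_term n).
- exact: measurable_arm_moment.
- move=> n x Dx; apply: le_trans (ler_norm_sum _ _ _) _.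
  apply: (@le_trans _ _ (\sum_(j < N) L)).
    rewrite big_mkcond /=; apply: ler_sum => j _; case: ifP => _ //.
    exact: (@arm_moment_integrand_le (Y n) j k x Dx (QY n j)).
  by rewrite sumr_const card_ord mulr_natl.
- by apply: filterS ae_good => x xP Dx; exact: term_cvg (xP Dx).
Qed.

End limit_configuration.

Lemma cvg_enorm_seq (Y : nat -> 'rV[R]_d) p (u : nat -> R) :
  (forall n, enorm (Y n - p) <= u n) -> u n @[n --> \oo] --> 0 -> Y n @[n --> \oo] --> p.
Proof.
move=> Yu u0; apply/cvg_ballP => e e0.
have H : \forall n \near \oo, u n < e by exact: (u0 _ (lt_nbhsl e0)).
apply: filterS H => n ue; split=> // a k; rewrite (ord1 a) /ball /= distrC.
apply: le_lt_trans ue; apply: le_trans (Yu n).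
by have := coord_le_enorm (Y n - p) k; rewrite !mxE.
Qed.

Lemma cvg_inv_succ : (n.+1%:R^-1 : R) @[n --> \oo] --> 0.
Proof.
apply/cvgrPdist_lt => e e0; have := near_infty_natSinv_lt (PosNum e0).
by apply: filterS => n /=; rewrite sub0r normrN ger0_norm ?invr_ge0.
Qed.

(** Along a sequence of configurations tending to [X0] whose dissipation tends to 0 all first
    moments would tend to 0, hence so would the sums over twins, and the first moments at
    [X0] would vanish. *)
Lemma dissipation_lower (X0 : 'I_N -> 'rV[R]_d) : (forall i, Q (X0 i)) ->
  ~ critical_point Q phi beta rng X0 ->
  exists e c, [/\ 0 < e, 0 < c & forall X, configuration Q X ->
    (forall i, enorm (X i - X0 i) < e) -> c <= dissipation X].
Proof.
move=> QX0 ncrit; apply: contrapT => nlow; apply: ncrit.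
have /choice[Y YP] : forall n : nat, exists X, [/\ configuration Q X,
    forall i, enorm (X i - X0 i) < n.+1%:R^-1 & dissipation X < n.+1%:R^-1].
  move=> n; apply: contrapT => nX; apply: nlow.
  exists n.+1%:R^-1, n.+1%:R^-1; split; rewrite ?invr_gt0 // => X cX Xe.
  by rewrite leNgt; apply/negP => dX; apply: nX; exists X.
have cY n : configuration Q (Y n) by have [] := YP n.
have QY n i : Q (Y n i) by have [] := cY n.
have YX0 i : Y n i @[n --> \oo] --> X0 i.
  apply: (cvg_enorm_seq _ cvg_inv_succ) => n; have [_ H _] := YP n; exact/ltW/H.
have moment0 i k : arm_moment (Y n) i k @[n --> \oo] --> 0.
  apply/cvgrPdist_lt => e e0.
  have e20 : 0 < e ^+ 2 / (`|Mx| + 1) by rewrite divr_gt0 ?exprn_gt0 // ltr_pwDr.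
  have := near_infty_natSinv_lt (PosNum e20); apply: filterS => n /= ne.
  have [_ _ dn] := YP n.
  rewrite sub0r normrN -(@ltr_pXn2r _ 2) ?nnegrE ?(ltW e0) // real_normK ?num_real //.
  apply: le_lt_trans (sqr_arm_moment_le i k (QY n)) _.
  have D0 := dissipation_ge0 (QY n).
  have M1 : 0 < `|Mx| + 1 by rewrite ltr_pwDr.
  apply: (@le_lt_trans _ _ ((`|Mx| + 1) * dissipation (Y n))).
    by rewrite ler_wpM2r // (le_trans (ler_norm _)) // lerDl.
  by rewrite mulrC -ltr_pdivlMr //; exact: lt_trans dn ne.
apply/critical_arm_moment; split=> // i k.
pose twin j := `[< X0 j = X0 i /\ forall r, 0 <= r -> f j r = f i r >].
have lim : (\sum_(j | twin j) arm_moment (Y n) j k) @[n --> \oo] --> arm_moment X0 i k.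
  exact: arm_moment_limit.
have lim0 : (\sum_(j | twin j) arm_moment (Y n) j k) @[n --> \oo] --> (0 : R).
  have sum0 : \sum_(j | twin j) 0 = 0 :> R by rewrite big1.
  by rewrite -[X in _ --> X]sum0; apply: cvg_sumr => j _; exact: moment0.
exact: (cvg_unique _ lim lim0).
Qed.

(** * Convergence of the flow *)

Section flow.
Variables (k : R) (P : R -> 'I_N -> 'rV[R]_d).
Hypothesis k0 : 0 < k.
Hypothesis HP : trajectory Q phi beta rng k P.

Let cP t : 0 <= t -> configuration Q (P t). Proof. by have [H _ _] := HP; exact: H. Qed.

Let QP t i : 0 <= t -> Q (P t i). Proof. by move=> /cP[]. Qed.

Let dP (t : R) i : 0 < t -> is_derive t (1 : R) (fun s => P s i)
  (- k *: (P t i - centroid Q phi beta rng (P t) i)).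
Proof. by have [_ _ H] := HP; exact: H. Qed.

Let energy t := lyapunov (P t).

Lemma energy_continuous (t : R) : 0 < t -> {for t, continuous energy}.
Proof.
move=> t0; pose C := L * fine (mu D); pose u s := C * \sum_i enorm (P s i - P t i).
have cu : u s @[s --> t] --> 0.
  have -> : 0 = C * \sum_(i < N) (0 : R) by rewrite big1 // mulr0.
  apply: cvgMr; apply: cvg_sumr => i _.
  have ct : {for t, continuous (fun s => P s i)}.
    by apply: differentiable_continuous; apply/derivable1_diffP; have [] := dP i t0.
  have := continuous_cvg _ (@continuous_enorm_sub R d (P t i) (P t i)) ct.
  by rewrite subrr enorm0; apply.
apply/cvgrPdist_lt => e e0.
have H1 : \forall s \near t, u s < e by exact: (cu _ (lt_nbhsl e0)).
near=> s; have s0 : 0 < s by near: s; exact: lt_nbhsr.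
rewrite distrC; apply: le_lt_trans (lyapunov_lipschitz (cP (ltW t0)) (cP (ltW s0))) _.
by near: s; exact: H1.
Unshelve. all: by end_near. Qed.

(** The strict inequality leaves room for replacing the limit of the increments divided by
    the time step by one of its terms. *)
Lemma energy_growth (a b m : R) : 0 < a -> a <= b ->
  (forall t, a <= t <= b -> m < 2 * k * dissipation (P t)) ->
  m * (b - a) <= energy b - energy a.
Proof.
move=> a0 ab mD'; apply: dini_growth => // [t /andP[at_ _]|t /andP[at_ tb] e e0].
  by apply: energy_continuous; exact: lt_le_trans a0 at_.
have t0 : 0 < t by exact: lt_le_trans a0 at_.
have QPt s i : t <= s -> Q (P s i) by move=> ts; apply: QP; exact: le_trans (ltW t0) ts.
have := gain_rate QPt (fun i => dP i t0).
have -> : 2 * \sum_i \sum_k0 (- k *: (P t i - centroid Q phi beta rng (P t) i)) 0 k0 *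
    arm_moment (P t) i k0 = 2 * k * dissipation (P t).
  rewrite -mulrA; congr (2 * _); rewrite /dissipation mulr_sumr; apply: eq_bigr => i _.
  rewrite sqr_enorm /dotp !mulr_sumr; apply: eq_bigr => j _.
  rewrite arm_momentE; last by move=> l; exact: QPt.
  by rewrite !mxE; ring.
move=> cv; have mt : m < 2 * k * dissipation (P t) by apply: mD'; rewrite at_ ltW.
have H1 : \forall n \near \oo, m < n.+1%:R * (\int[mu]_(x in D) (phi (tuple_vec x) *
     gain (P t) (P (t + n.+1%:R^-1)) (tuple_vec x))).
  exact: (cv _ (lt_nbhsr mt)).
have H2 := near_infty_natSinv_lt (PosNum e0).
have [n [/= n1 n2]] := filter_ex (filterI H1 H2).
have n0 : 0 < n.+1%:R :> R by rewrite ltr0n.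
exists n.+1%:R^-1; first by rewrite invr_gt0 n0.
have QPn i : Q (P (t + n.+1%:R^-1) i) by apply: QPt; rewrite lerDl invr_ge0.
apply: le_trans (lyapunov_increment (cP (ltW t0)) QPn).
by rewrite ler_pdivrMr // mulrC ltW.
Qed.

Lemma energy_ndecr (a b : R) : 0 < a -> a <= b -> energy a <= energy b.
Proof.
move=> a0 ab; have [->//|anb] := eqVneq a b.
have ba : 0 < b - a by rewrite subr_gt0 lt_neqAle anb.
rewrite leNgt; apply/negP => ltE.
set Ea := energy a in ltE; set Eb := energy b in ltE.
pose m : R := (Eb - Ea) / (b - a) / 2.
have m0 : m < 0.
  by rewrite /m -mulrA nmulr_rlt0 ?subr_lt0 // divr_gt0 // invr_gt0.
have slopeE : m * (b - a) = (Eb - Ea) / 2.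
  by rewrite /m mulrAC divfK // gt_eqF.
have : m * (b - a) <= Eb - Ea.
  apply: (energy_growth a0 ab) => t /andP[at_ _]; apply: lt_le_trans m0 _.
  rewrite mulr_ge0 ?mulr_ge0 ?(ltW k0) //; apply: dissipation_ge0 => i; apply: QP.
  exact: le_trans (ltW a0) at_.
have E0 : (Eb - Ea) / 2 < 0 by rewrite pmulr_llt0 ?invr_gt0 // subr_lt0.
by apply/negP; rewrite slopeE -ltNge {1}(splitr (Eb - Ea)) gtrDl.
Qed.
(** Coordinatewise mean value theorem: an agent is at distance at most [diam] from its centroid. *)
Lemma speed_bound (a b : R) i : 0 < a -> a <= b ->
  enorm (P b i - P a i) <= d%:R * (k * diam) * (b - a).
Proof.
move=> a0 ab; apply: le_trans (enorm_le_sum _) _.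
apply: (@le_trans _ _ (\sum_(j < d) (k * diam) * (b - a))); last first.
  by rewrite sumr_const card_ord -[d%:R * _ * _]mulrA mulr_natl.
apply: ler_sum => j _.
pose p (s : R) := P s i 0 j.
pose dp (s : R) := (- k *: (P s i - centroid Q phi beta rng (P s) i)) 0 j.
have D1 (s : R) : 0 < s -> is_derive s (1 : R) p (dp s).
  by move=> s0; apply: (is_derive_coord j (dP i s0)).
have cp : {within `[a, b], continuous p}.
  apply: derivable_within_continuous => s; rewrite in_itv /= => /andP[as_ _].
  by have [] := D1 s (lt_le_trans a0 as_).
have D2 (s : R) : s \in `]a, b[ -> is_derive s (1 : R) p (dp s).
  by rewrite in_itv /= => /andP[as_ _]; apply: D1; exact: lt_trans a0 as_.
have [c] := MVT_segment ab D2 cp; rewrite in_itv /= => /andP[ac _] pE.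
have -> : (P b i - P a i) 0 j = p b - p a by rewrite !mxE.
rewrite pE normrM (ger0_norm (_ : 0 <= b - a)) ?subr_ge0 // ler_wpM2r ?subr_ge0 //.
rewrite /dp mxE normrM normrN (gtr0_norm k0) ler_wpM2l ?(ltW k0) //.
have Qc l : Q (P c l) by apply: QP; exact: le_trans (ltW a0) ac.
have := centroid_dist i j Qc.
by rewrite -normrN; congr (`|_| <= _); rewrite !mxE opprB.
Qed.

(** LaSalle's argument, with an ultrafilter on the bad times in place of subsequences. *)
Lemma flow_converges (cptQ : compact Q) (e : R) : 0 < e ->
  \forall t \near +oo, exists2 X, critical_point Q phi beta rng X &
    forall i, enorm (P t i - X i) < e.
Proof.
move=> e0; apply: contrapT => notnear.
pose bad t := ~ exists2 X, critical_point Q phi beta rng X &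
    forall i, enorm (P t i - X i) < e.
have badP T : exists t, T < t /\ bad t.
  apply: contrapT => nb; apply: notnear; exists T; split; first exact: num_real.
  by move=> t Tt; apply: contrapT => bt; apply: nb; exists t.
pose F : set_system R := [set A | exists T, forall t, T < t -> bad t -> A t].
have FF : ProperFilter F.
  split; first by move=> [T H]; have [t [Tt bt]] := badP T; exact: H Tt bt.
  split.
  - by exists 0.
  - move=> A B [T1 H1] [T2 H2]; exists (Num.max T1 T2) => t.
    by rewrite gt_max => /andP[t1 t2] bt; split; [exact: H1|exact: H2].
  - by move=> A B AB [T H]; exists T => t Tt bt; exact/AB/H.
have [G [UG FG]] := ultraFilterLemma FF.
have Glarge T : G [set t | T < t /\ bad t].
  by apply: FG; exists T => t Tt bt.
have /choice[X0 X0P] : forall i, exists p, Q p /\ P t i @[t --> G] --> p.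
  move=> i; have GQ : (P t i @[t --> G]) Q.
    by apply: (filterS (F := G) _ (Glarge 0)) => t [t0 _]; apply: QP; exact: ltW.
  have [p [Qp clp]] := cptQ (P t i @[t --> G]) _ GQ.
  exists p; split=> // A Ap.
  have [//|GnA] := in_ultra_setVsetC (fun t => A (P t i)) UG.
  by have [q [nAq Aq]] := clp (~` A) A GnA Ap.
have QX0 i : Q (X0 i) by have [] := X0P i.
have close (r : R) : 0 < r -> G [set t | forall i, enorm (P t i - X0 i) < r].
  move=> r0; apply: (@filter_forall _ _ (fun i => [set t | enorm (P t i - X0 i) < r])) => i.
  have [_ cv] := X0P i.
  have := continuous_cvg _ (@continuous_enorm_sub R d (X0 i) (X0 i)) cv.
  by rewrite subrr enorm0 => /(_ _ _ (lt_nbhsl r0)).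
have ncrit : ~ critical_point Q phi beta rng X0.
  move=> cX0; have [t [[_ bt] H]] := @filter_ex _ G _ _ (filterI (Glarge 0) (close e e0)).
  by apply: bt; exists X0.
have [r [c [r0 c0 low]]] := dissipation_lower QX0 ncrit.
have diam0 : 0 <= diam.
  case: (pickP (fun _ : 'I_N => true)) => [i _|noI].
    by apply: le_trans (diamP (QX0 i) (QX0 i)); exact: enorm_ge0.
  exfalso; apply: ncrit; split=> // i; have := noI i; by [].
(* within time tau of a visit to the ball of radius r / 2 the agents stay in the ball of
   radius r *)
pose V := d%:R * (k * diam) + 1.
have V0 : 0 < V by rewrite ltr_pwDr // mulr_ge0 // mulr_ge0 // ltW.
pose tau := r / 2 / V.
have tau0 : 0 < tau by rewrite !divr_gt0.
pose S := [set energy t | t in [set t | 0 < t]].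
have hS : has_sup S.
  split; first by exists (energy 1), 1 => //=; exact: ltr01.
  by exists (fine (mu D)) => _ [t _ <-]; exact: lyapunov_le.
(* after a time T at which the Lyapunov function is within k c tau of its supremum, one more
   visit exceeds the supremum *)
have step0 : 0 < k * c * tau by exact: mulr_gt0 (mulr_gt0 k0 c0) tau0.
have [_ [T /= T0 <-] supT] := sup_adherent step0 hS.
have [t [[Tt _] tX0]] := @filter_ex _ G _ _ (filterI (Glarge T) (close (r / 2) (divr_gt0 r0 (ltr0Sn _ 1)))).
have t0 : 0 < t by exact: lt_trans T0 Tt.
have tt : t <= t + tau by rewrite lerDl ltW.
have grow : k * c * (t + tau - t) <= energy (t + tau) - energy t.
  apply: energy_growth => // s /andP[ts st].
  have s0 : 0 <= s by exact: le_trans (ltW t0) ts.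
  have : c <= dissipation (P s).
    apply: low; first exact: cP.
    move=> i; have -> : P s i - X0 i = (P s i - P t i) + (P t i - X0 i).
      by rewrite addrA subrK.
    apply: le_lt_trans (enormD _ _) _; rewrite (splitr r).
    apply: ler_ltD; last exact: tX0.
    apply: le_trans (speed_bound i t0 ts) _.
    apply: (@le_trans _ _ (V * tau)).
      apply: ler_pM => //; rewrite ?subr_ge0 //.
        by rewrite mulr_ge0 // mulr_ge0 // ltW.
        by rewrite /V lerDl.
      by rewrite lerBlDl.
    by rewrite /tau mulrC divfK // gt_eqF.
  move=> cD; have kc : 0 < k * c by rewrite mulr_gt0.
  rewrite -mulrA mulrA; nra.
rewrite addrAC subrr add0r lerBrDr in grow.
suff : sup S < energy (t + tau).
  rewrite ltNge => /negP; apply; apply: ub_le_sup; first exact: hS.2.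
  by exists (t + tau) => //=; exact: lt_le_trans t0 tt.
apply: lt_le_trans grow; rewrite -ltrBlDl; apply: lt_le_trans supT _.
exact: energy_ndecr T0 (ltW Tt).
Qed.

End flow.
End lyapunov.

(** * Uniform bounds on masses and negligibility of ties *)

Lemma bounded_in_diameter {R : realType} {d : nat} (Q : set 'rV[R]_d) (K : R) :
  bounded_in Q K -> exists diam, forall p q, Q p -> Q q -> enorm (p - q) <= diam.
Proof.
move=> bQ; exists (\sum_(k < d) (2 * K)) => p q Qp Qq.
apply: le_trans (enorm_le_sum _) _; apply: ler_sum => k _.
rewrite !mxE mulr_natl mulr2n; apply: le_trans (ler_normB _ _) _.
by apply: lerD; exact: bQ.
Qed.

Section mass_and_ties.
Context {R : realType} {d N : nat}.
Local Notation realT := (measurableTypeR R).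
Variables (Q : set 'rV[R]_d) (phi : 'rV[R]_d -> R).
Variables (beta : 'I_N -> R -> R) (rng : 'I_N -> R).
Hypothesis HQ : convex_polytope Q.
Hypothesis Hphi : {within Q, continuous phi}.
Hypothesis Hphi01 : forall q, Q q -> 0 <= phi q <= 1.
Hypothesis Hbeta_incr : forall i (r s : R), 0 <= r -> r < s -> beta i r < beta i s.
Hypothesis Hbeta_analytic : forall i, analytic_nonneg (beta i).
Hypothesis Hrng : forall i, 0 < rng i.
Local Notation f := (node beta).
Local Notation mu := (lebesgue_tuple R d).

Let cQ : closed Q. Proof. exact: polytope_closed. Qed.

Lemma voronoi_overlap_vnull : (1 < d)%N -> forall X : 'I_N -> 'rV[R]_d,
  forall i j, X i != X j -> vnull (voronoi Q beta X i `&` voronoi Q beta X j).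
Proof.
move=> d1 X i j Xij; have [K bQ] := polytope_bounded HQ.
have nij : i != j by apply: contraNneq Xij => ->.
have tie := tie_vnull d1 cQ bQ Xij (@continuous_node _ _ _ beta Hbeta_analytic i (X i))
  (@continuous_node _ _ _ beta Hbeta_analytic j (X j))
  (@node_decr R N beta Hbeta_incr i) (@node_decr R N beta Hbeta_incr j).
apply: vnullS tie => q [[Qq qi] [_ qj]]; split=> //=; apply: le_anti.
rewrite 2!(enormBC q); apply/andP; split; first exact: qj.
by apply: qi; rewrite eq_sym.
Qed.

Lemma voronoi_overlap_vnull1 : negligible_overlaps Q beta ->
  forall X : 'I_N -> 'rV[R]_d, (forall i, Q (X i)) ->
  forall i j, X i != X j -> vnull (voronoi Q beta X i `&` voronoi Q beta X j).
Proof.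
move=> H X QX i j Xij; apply/vnull_vol; last exact: H.
by apply: vmeasurableI; apply: closed_vmeasurable;
  exact: (@closed_voronoi _ _ _ _ _ Hbeta_analytic cQ).
Qed.

Let mE X i : measurable (tuple_vec @^-1` sensed Q beta rng X i : set (d.-tuple realT)).
Proof.
by apply: closed_vmeasurable; exact: (@closed_sensed _ _ _ _ _ _ Hbeta_analytic cQ).
Qed.

Let measurable_density X i : measurable_fun
  (tuple_vec @^-1` sensed Q beta rng X i)
  (fun x : d.-tuple realT => density phi beta X i (tuple_vec x) : realT).
Proof.
have mD : measurable (tuple_vec @^-1` Q : set (d.-tuple realT)) by exact: closed_vmeasurable.
apply: (@measurable_funS _ _ _ _ (tuple_vec @^-1` Q)) => //; first by move=> x /sensed_sub.
under eq_fun do rewrite densityE.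
apply: measurable_funM; first exact: within_continuous_vmeasurable_fun.
exact: measurable_slope.
Qed.

(** In dimension at least 2 the density is dominated by a multiple of the inverse distance to
    the agent, whose integral over [Q] is bounded independently of the agent. *)
Lemma mass_bounded (d1 : (1 < d)%N) : exists Mx, forall X, (forall i, Q (X i)) ->
  forall i, vol_integrable (sensed Q beta rng X i) (density phi beta X i) /\
    mass Q phi beta rng X i <= Mx.
Proof.
have [K bQ] := polytope_bounded HQ.
have vQ : vmeasurable Q by exact: closed_vmeasurable.
have [C CP] := integral_inv_dist_le d1 vQ bQ.
have [diam diamP] := bounded_in_diameter bQ.
have [L L0 LP] := node_bounds Hbeta_incr Hbeta_analytic diam.
exists (L * C) => X QX i.
pose h (x : d.-tuple realT) := (`|density phi beta X i (tuple_vec x)|%:E : \bar R).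
pose g (x : d.-tuple realT) := ((enorm (tuple_vec x - X i))^-1%:E : \bar R).
have mg : measurable_fun setT g.
  apply/measurable_EFinP; apply: measurable_radial => r r0.
  by apply: continuousV; [rewrite gt_eqF|exact: id].
have hle : (\int[mu]_(x in tuple_vec @^-1` sensed Q beta rng X i) h x <= (L * C)%:E)%E.
  apply: (@le_trans _ _ (\int[mu]_(x in tuple_vec @^-1` sensed Q beta rng X i)
    (L%:E * g x))%E).
    apply: ae_ge0_le_integral => //.
    - by move=> x _; rewrite lee_fin.
    - apply/measurable_EFinP/measurableT_comp => //; exact: measurable_density.
    - by move=> x _; rewrite mule_ge0 // lee_fin // invr_ge0 enorm_ge0.
    - apply: measurable_funeM; exact: measurable_funS mg.
    - apply: filterS (ae_off_center Q (ltnW d1) (X i)) => x H Ex.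
      have Qx : Q (tuple_vec x) by exact: sensed_sub Ex.
      have xX := H Qx; have dens0 := density_ge0 Hphi01 Hbeta_incr Hbeta_analytic Qx (QX i) xX.
      rewrite /h /g -EFinM lee_fin ger0_norm // densityE.
      have r0 : 0 < enorm (tuple_vec x - X i) by rewrite enorm_gt0 subr_eq0.
      rewrite ler_pdivlMr // -mulrA -[leRHS]mul1r.
      have /andP[p0 p1] := Hphi01 Qx.
      have s0 := slope_ge0 Hbeta_incr Hbeta_analytic i r0.
      apply: ler_pM => //; first by rewrite mulr_ge0 // ltW.
      by have [_] := LP i; apply; rewrite r0 diamP.
  rewrite ge0_integralZl //; last 2 first.
    - by apply: measurable_funS mg.
    - by move=> x _; rewrite lee_fin invr_ge0 enorm_ge0.
  rewrite EFinM lee_wpmul2l ?lee_fin //; apply: le_trans (CP (X i)).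
  apply: ge0_subset_integral => //.
  - by apply: measurable_funS mg.
  - by move=> x _; rewrite lee_fin invr_ge0 enorm_ge0.
  - by move=> x /sensed_sub.
have int : mu.-integrable (tuple_vec @^-1` sensed Q beta rng X i)
    (fun x => (density phi beta X i (tuple_vec x))%:E).
  apply/integrableP; split; first by apply/measurable_EFinP; exact: measurable_density.
  apply: (@le_lt_trans _ _ (\int[mu]_(x in tuple_vec @^-1` sensed Q beta rng X i) h x)%E).
    exact: lexx.
  by apply: le_lt_trans hle _; exact: ltry.
split=> //; rewrite /mass /vol_int /Rintegral.
rewrite -lee_fin fineK; last exact: integrable_fin_num.
apply: le_trans hle; apply: le_integral => //.
  exact: integrable_abse int.
by move=> x _; rewrite lee_fin ler_norm.
Qed.

Lemma ord_line : d = 1%N -> forall k l : 'I_d, k = l.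
Proof. by move=> ->; move=> k l; rewrite !ord1. Qed.

Lemma enorm_line (k0 : 'I_d) (x : 'rV[R]_d) : d = 1%N -> enorm x = `|x 0 k0|.
Proof.
move=> d1; apply/le_anti; rewrite coord_le_enorm andbT.
apply: le_trans (enorm_le_sum _) _.
have -> : \sum_k `|x 0 k| = \sum_(k < d) `|x 0 k0|.
  apply: eq_bigr => k _; congr (`|x 0 _|); exact: ord_line.
by move: (`|x 0 k0|) => r; rewrite sumr_const card_ord d1 mulr1n.
Qed.

(** An agent moved to a point of its own region senses a neighborhood of that point, because
    it was not dominated there and its node function is now at its strict maximum. *)
Lemma sensed_near_pole X i q : (forall j, Q (X j)) -> sensed Q beta rng X i q -> q != X i ->
  \forall y \near q, Q y -> sensed Q beta rng (dfwith X i q) i y.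
Proof.
move=> QX [[Qq qi] _] qX.
have r0 : 0 < enorm (q - X i) by rewrite enorm_gt0 subr_eq0.
have near_j : \forall y \near q, forall j, j != i ->
    f j (enorm (y - X j)) < f i (enorm (y - q)).
  apply: (@filter_forall _ _ (fun j => [set y | j != i ->
    f j (enorm (y - X j)) < f i (enorm (y - q))]) (nbhs q) _) => j; have [->|ji] := eqVneq j i; first by apply: nearW.
  have lt0 : f j (enorm (q - X j)) - f i (enorm (q - q)) < 0.
    rewrite subr_lt0 subrr enorm0 (enormBC q); apply: le_lt_trans (qi j ji) _.
    by rewrite enormBC; exact: node_decr.
  have cv : (fun y => f j (enorm (y - X j)) - f i (enorm (y - q))) @ q -->
      f j (enorm (q - X j)) - f i (enorm (q - q)).
    exact: (cvgB (@continuous_node _ _ _ beta Hbeta_analytic j (X j) q)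
                 (@continuous_node _ _ _ beta Hbeta_analytic i q q)).
  have H : \forall y \near q, f j (enorm (y - X j)) - f i (enorm (y - q)) < 0.
    exact: (cv _ (lt_nbhsl lt0)).
  by apply: filterS H => y; rewrite /= subr_lt0.
have near_r : \forall y \near q, enorm (y - q) < rng i.
  have cv := @continuous_enorm_sub R d q q.
  have lt0 : enorm (q - q) < rng i by rewrite subrr enorm0.
  exact: (cv _ (lt_nbhsl lt0)).
near=> y => Qy; split.
  split=> // j ji; rewrite dfwithin dfwithout 1?eq_sym //.
  rewrite (enormBC (X j)) (enormBC q); apply: ltW; move: j ji; near: y; exact: near_j.
rewrite /closed_eball /= dfwithin; apply: ltW; near: y; exact: near_r.
Unshelve. all: by end_near. Qed.

(** A nonzero slope of the node function at 0 makes the density behave as the inverse distance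
    to the agent, which is not integrable on a line. Moving the agent to any point [q] of its
    region then contradicts the finiteness of its mass unless [phi] vanishes at [q].
    Non-integrability is detected on the short intervals [box t], over which the
    integral does not tend to 0 with [t]; they lie on the segment from [q] to the former position,
    which is contained in [Q] by convexity. *)
Lemma pole_uncertainty0 (d1 : d = 1%N) (fin : finite_masses Q phi beta rng) i (G : R -> R) X q :
  continuous G -> (forall r, 0 < r -> slope beta i r = - G r / (2 * r)) -> G 0 < 0 ->
  (forall j, Q (X j)) -> sensed Q beta rng X i q -> q != X i -> phi q = 0.
Proof.
move=> cG sE G0 QX Wq qX; have Qq : Q q by have [[]] := Wq.
apply: contrapT => /eqP phi0.
have {}phi0 : 0 < phi q by rewrite lt0r phi0; have /andP[] := Hphi01 Qq.
have d0 : (0 < d)%N by rewrite d1.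
pose k0 : 'I_d := Ordinal d0; have k0E k : k = k0 by exact: ord_line.
have enormE (x : 'rV[R]_d) : enorm x = `|x 0 k0| by exact: enorm_line.
pose w := (X i - q) 0 k0; have w0 : 0 < `|w|.
  by rewrite -enormE enorm_gt0 subr_eq0 eq_sym.
pose X' := dfwith X i q.
have QX' j : Q (X' j).
  by rewrite /X'; case: dfwithP.
have X'i : X' i = q by rewrite /X' dfwithin.
(* the density near q is at least c over the distance to q *)
pose c := phi q / 2 * (- G 0 / 4).
have c0 : 0 < c by rewrite mulr_gt0 // divr_gt0 // oppr_gt0.
have near_dens : \forall y \near q, Q y -> y != q ->
    sensed Q beta rng X' i y /\ c / enorm (y - q) <= density phi beta X' i y.
  have nW := sensed_near_pole QX Wq qX.
  have nphi : \forall y \near q, Q y -> phi q / 2 < phi y.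
    have cv := iffLR (subspace_continuousP _ _) Hphi q Qq.
    have lt2 : phi q / 2 < phi q by lra.
    exact: (cv _ (lt_nbhsr lt2)).
  have nG : \forall y \near q, G (enorm (y - q)) < G 0 / 2.
    have cv : (fun y => G (enorm (y - q))) @ q --> G (enorm (q - q)).
      by apply: continuous_comp; [exact: continuous_enorm_sub|exact: cG].
    have lt2 : G (enorm (q - q)) < G 0 / 2 by rewrite subrr enorm0; lra.
    exact: (cv _ (lt_nbhsl lt2)).
  near=> y => Qy yq; split; first by move: Qy; near: y; exact: nW.
  have r0 : 0 < enorm (y - q) by rewrite enorm_gt0 subr_eq0.
  rewrite densityE X'i sE // ler_pdivrMr // /c.
  have -> : phi y * (- G (enorm (y - q)) / (2 * enorm (y - q))) * enorm (y - q) =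
      phi y * (- G (enorm (y - q)) / 2).
    by field; rewrite gt_eqF.
  have p2 : phi q / 2 < phi y by move: Qy; near: y; exact: nphi.
  have G2 : G (enorm (y - q)) < G 0 / 2 by near: y; exact: nG.
  apply: ler_pM; [|by lra|exact: ltW|by lra].
  by apply: ltW; rewrite divr_gt0.
have [e /= e0 eP] := iffLR (nbhs_ballP _ _) near_dens.
(* the points q + s (X i - q) with t / 2 <= s <= t *)
pose lo t (k : 'I_d) := q 0 k + 3 / 4 * t * w - t * `|w| / 4.
pose hi t (k : 'I_d) := q 0 k + 3 / 4 * t * w + t * `|w| / 4.
pose box t := [set y : 'rV[R]_d | forall k, lo t k <= y 0 k <= hi t k].
have vbox t : 0 < t -> vol (box t) = (t * `|w| / 2)%:E.
  move=> t0; have tw0 : 0 < t * `|w| by rewrite mulr_gt0.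
  rewrite vol_box => [|k]; last by rewrite /lo /hi; lra.
  have -> : \prod_k (hi t k - lo t k) = \prod_(k < d) (t * `|w| / 2).
    by apply: eq_bigr => k _; rewrite /lo /hi; lra.
  by move: (t * `|w| / 2) => r; rewrite prodr_const card_ord d1 expr1.
have boxP t y : 0 < t -> t <= 1 -> box t y -> [/\ Q y, y != q & enorm (y - q) <= t * `|w|].
  move=> t0 t1 /(_ k0); rewrite /lo /hi => yb; rewrite enormE !mxE.
  have wn0 : w != 0 by rewrite -normr_gt0.
  pose s := (y 0 k0 - q 0 k0) / w; have ysw : y 0 k0 = q 0 k0 + s * w.
    by rewrite /s divfK // addrC subrK.
  have sb : t / 2 <= s <= t.
    move: yb; rewrite ysw -!addrA !lerD2l.
    have [wp|wp] : 0 < w \/ w < 0 by apply/orP; rewrite orbC -neq_lt.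
      rewrite gtr0_norm // => /andP[y1 y2]; apply/andP; split.
        by rewrite -(ler_pM2r wp); lra.
      by rewrite -(ler_pM2r wp); lra.
    rewrite ltr0_norm // => /andP[y1 y2]; apply/andP; split.
      by rewrite -(ler_nM2r wp); lra.
    by rewrite -(ler_nM2r wp); lra.
  have /andP[s1 s2] := sb; have s0 : 0 < s by lra.
  split.
  - have -> : y = q + s *: (X i - q).
      by apply/rowP => k; rewrite (k0E k) ysw /w !mxE.
    by apply: polytope_convex => //; apply/andP; split; lra.
  - apply/negP => /eqP yq; move: ysw; rewrite yq => /eqP.
    by rewrite -subr_eq0 opprD addNKr oppr_eq0 mulf_eq0 gt_eqF // (negbTE wn0).
  - by rewrite ysw addrC addKr normrM gtr0_norm // ler_wpM2r.
pose F (x : d.-tuple realT) : R :=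
  \1_(tuple_vec @^-1` sensed Q beta rng X' i) x * density phi beta X' i (tuple_vec x).
have intF : mu.-integrable setT (EFin \o F).
  have := fin X' QX' i; rewrite /vol_integrable => /(integrable_mkcond _ (mE X' i)).
  apply: eq_integrable => // x _; rewrite /F /patch /= indicE.
  by case: ifP => xE; rewrite ?mul1r ?mul0r.
have c20 : 0 < c / 2 by rewrite divr_gt0.
have [r [r0 rP]] := integral_normr_continuous intF c20.
pose t := Num.min 1 (Num.min (r / `|w|) (e / 2 / `|w|)).
have t0 : 0 < t by rewrite !lt_min !divr_gt0 // ltr01.
have t1 : t <= 1 by rewrite ge_min lexx.
have tr : t * `|w| <= r by rewrite -ler_pdivlMr // !ge_min lexx orbT.
have te : t * `|w| <= e / 2 by rewrite -ler_pdivlMr // !ge_min lexx !orbT.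
have mb : measurable (tuple_vec @^-1` box t : set (d.-tuple realT)).
  exact: vmeasurable_cbox.
have mub : mu (tuple_vec @^-1` box t) = (t * `|w| / 2)%:E by exact: vbox.
have mur : (mu (tuple_vec @^-1` box t) < r%:E)%E.
  by rewrite mub lte_fin; apply: lt_le_trans tr; rewrite ltr_pdivrMr // ltr_pMr ?mulr_gt0 // ltr1n.
have := rP _ mb mur; apply/negP; rewrite -leNgt.
have tw0 : 0 < t * `|w| by rewrite mulr_gt0.
have -> : c / 2 = \int[mu]_(x in tuple_vec @^-1` box t) (c / (t * `|w|)).
  transitivity (c / (t * `|w|) * fine (mu (tuple_vec @^-1` box t))); last by rewrite Rintegral_cst.
  by rewrite mub /=; field; rewrite !gt_eqF.
apply: ae_le_Rintegral => //.
- apply: (@bounded_integrable _ _ _ _ _ mb _ (cst (c / (t * `|w|))) (c / (t * `|w|))) => //.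
    by apply: (@le_lt_trans _ _ (mu (tuple_vec @^-1` box t))) => //; rewrite mub ltry.
  by move=> x _; rewrite ger0_norm // ltW // divr_gt0.
- have := integrable_abse (integrableS measurableT mb (@subsetT _ _) intF).
  by apply: eq_integrable.
apply: aeW => x xb; have [Qy yq yt] := boxP _ _ t0 t1 xb.
have yn : ball q e (tuple_vec x).
  split=> // a k; rewrite (ord1 a) (k0E k) /ball /= distrC.
  by have := yt; rewrite enormE !mxE; lra.
have [Wy dy] := eP _ yn Qy yq.
apply: le_trans (ler_norm _); rewrite /F indicE mem_set // mul1r.
apply: le_trans dy; rewrite ler_pM2l // lef_pV2 ?posrE //.
by rewrite enorm_gt0 subr_eq0.
Unshelve. all: by end_near. Qed.

(** If the derivative of the node function vanishes at 0 the density is bounded; otherwise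
    [phi] vanishes on the region and the mass is 0. *)
Lemma mass_bounded_line (d1 : d = 1%N) (fin : finite_masses Q phi beta rng) :
  exists Mx, forall X, (forall i, Q (X i)) ->
  forall i, vol_integrable (sensed Q beta rng X i) (density phi beta X i) /\
    mass Q phi beta rng X i <= Mx.
Proof.
have [K bQ] := polytope_bounded HQ.
have vQ : vmeasurable Q by exact: closed_vmeasurable.
have d0 : (0 < d)%N by rewrite d1.
have [diam diamP] : exists diam, forall p q, Q p -> Q q -> enorm (p - q) <= diam.
  exact: bounded_in_diameter bQ.
have [L L0 LP] := node_bounds Hbeta_incr Hbeta_analytic diam.
pose E X i : set (d.-tuple realT) := tuple_vec @^-1` sensed Q beta rng X i.
have muE X i : (mu (E X i) <= mu (tuple_vec @^-1` Q))%E.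
  apply: le_measure; rewrite ?inE //; first exact: mE.
  by move=> x /sensed_sub.
have Qoo : (mu (tuple_vec @^-1` Q) < +oo)%E by exact: bounded_vol_lty bQ.
have mass_le S X i : 0 <= S -> (forall j, Q (X j)) ->
    (forall q, sensed Q beta rng X i q -> q != X i -> density phi beta X i q <= S) ->
    mass Q phi beta rng X i <= S * fine (mu (tuple_vec @^-1` Q)).
  move=> S0 QX dS.
  have Eoo : (mu (E X i) < +oo)%E by exact: le_lt_trans (muE X i) Qoo.
  apply: (@le_trans _ _ (S * fine (mu (E X i)))); last first.
    by rewrite ler_wpM2l // fine_le // ge0_fin_numE.
  apply: (@le_trans _ _ (\int[mu]_(x in E X i) S)); last by rewrite Rintegral_cst //; exact: mE.
  rewrite /mass /vol_int; apply: ae_le_Rintegral.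
  - exact: mE.
  - exact: fin.
  - by apply: (@bounded_integrable _ _ _ _ _ (mE X i) Eoo (cst S) S) => // x _; rewrite ger0_norm.
  - apply: filterS (ae_off_center Q d0 (X i)) => x H Ex; apply: dS => //.
    by apply: H; exact: sensed_sub Ex.
have /choice[Mi MiP] : forall i, exists M, forall X, (forall j, Q (X j)) ->
    mass Q phi beta rng X i <= M.
  move=> i; have [G [cG _ Gle sE Glip]] := node_derivative Hbeta_incr Hbeta_analytic i.
  have [G0|G0] := eqVneq (G 0) 0.
    have [M [e [e0 MP]]] := Glip G0.
    exists ((`|M| + L / e) * fine (mu (tuple_vec @^-1` Q))) => X QX.
    have S0 : 0 <= `|M| + L / e by rewrite addr_ge0 // divr_ge0 // ltW.
    apply: mass_le => // q Wq qX; have Qq : Q q by exact: sensed_sub Wq.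
    have r0 : 0 < enorm (q - X i) by rewrite enorm_gt0 subr_eq0.
    have rd : enorm (q - X i) <= diam by exact: diamP.
    have s0 := slope_ge0 Hbeta_incr Hbeta_analytic i r0.
    have /andP[p0 p1] := Hphi01 Qq.
    rewrite densityE -[leRHS]mul1r; apply: ler_pM => //.
    have [re|er] := ltP (enorm (q - X i)) e.
      rewrite -[leLHS]addr0; apply: lerD; last by rewrite divr_ge0 // ltW.
      have := MP (enorm (q - X i)); rewrite (ltW r0) re => /(_ isT) GM.
      rewrite sE // ler_pdivrMr ?mulr_gt0 //.
      apply: le_trans (ler_norm _) _; rewrite normrN; apply: le_trans GM _.
      apply: (@le_trans _ _ (`|M| * enorm (q - X i))).
        by rewrite ler_wpM2r ?ler_norm // ltW.
      by rewrite ler_wpM2l // mulr_natl mulr2n lerDl ltW.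
    rewrite -[leLHS]add0r; apply: lerD => //.
    rewrite ler_pdivlMr //; have [_ /(_ (enorm (q - X i)))] := LP i.
    rewrite r0 rd => /(_ isT); apply: le_trans.
    by rewrite ler_wpM2l.
  exists 0 => X QX.
  have := @mass_le 0 X i (lexx _) QX; rewrite mul0r; apply => q Wq qX.
  have G00 : G 0 < 0 by rewrite lt_neqAle G0 Gle.
  by rewrite densityE (pole_uncertainty0 d1 fin cG sE G00 QX Wq qX) mul0r.
exists (\sum_i `|Mi i|) => X QX i; split; first exact: fin.
apply: le_trans (MiP i X QX) _; apply: le_trans (ler_norm _) _.
by rewrite (bigD1 i) //= lerDl; apply: sumr_ge0.
Qed.

Lemma trajectory_converges (d0 : (0 < d)%N) (k : R) (P : R -> 'I_N -> 'rV[R]_d)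
  (Hbeta01 : forall i (r : R), 0 <= r -> 0 <= beta i r <= 1)
  (Hrng_eq : forall i j, node beta i (rng i) = node beta j (rng j))
  (Hline : d = 1%N -> finite_masses Q phi beta rng /\ negligible_overlaps Q beta)
  (Hk : 0 < k) (HP : trajectory Q phi beta rng k P) (e : R) : 0 < e ->
  \forall t \near +oo, exists2 X : 'I_N -> 'rV[R]_d,
    critical_point Q phi beta rng X & forall i, enorm (P t i - X i) < e.
Proof.
move=> e0; have [K bQ] := polytope_bounded HQ.
have [diam diamP] := bounded_in_diameter bQ.
have [L L0 LP] := node_bounds Hbeta_incr Hbeta_analytic diam.
have [overlap [Mx Hmass]] : (forall X : 'I_N -> 'rV[R]_d, (forall i, Q (X i)) ->
      forall i j, X i != X j -> vnull (voronoi Q beta X i `&` voronoi Q beta X j)) /\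
    (exists Mx, forall X, (forall i, Q (X i)) ->
      forall i, vol_integrable (sensed Q beta rng X i) (density phi beta X i) /\
      mass Q phi beta rng X i <= Mx).
  have [d1|d1] := ltnP 1 d.
    by split; [move=> X _; exact: voronoi_overlap_vnull|exact: mass_bounded].
  have {}d1 : d = 1%N by apply/eqP; rewrite eqn_leq d1.
  have [fin tie] := Hline d1.
  by split; [exact: voronoi_overlap_vnull1|exact: mass_bounded_line].
have lip i r s : 0 <= r <= diam -> 0 <= s <= diam ->
    `|node beta i r - node beta i s| <= L * `|r - s| by have [H _] := LP i; exact: H.
have sl i r : 0 < r <= diam -> slope beta i r * r <= L by have [_ H] := LP i; exact: H.
exact: (@flow_converges R d N Q phi beta rng Hphi Hphi01 Hbeta01 Hbeta_incr Hbeta_analytic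
  Hrng Hrng_eq cQ K bQ overlap diam L diamP L0 lip d0 sl Mx Hmass k P Hk HP
  (polytope_compact HQ) e e0).
Qed.

End mass_and_ties.

(** The linear form [dotp (g - h)] vanishes, in particular at [g - h]. *)
Lemma is_gradient_unique (R : realType) (d N : nat) (Q : set 'rV[R]_d) phi
  (beta : 'I_N -> R -> R) rng X i (g h : 'rV[R]_d) :
  is_gradient Q phi beta rng X i g -> is_gradient Q phi beta rng X i h -> g = h.
Proof.
move=> [_ dg] [_ dh].
have E x : dotp g x = dotp h x by rewrite -dg -dh.
apply/eqP; rewrite -subr_eq0 -dotp_eq0.
by rewrite dotpDl dotpNl E subrr.
Qed.

Theorem theorem9 (R : realType) (d N : nat)
  (Q : set 'rV[R]_d) (phi : 'rV[R]_d -> R)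
  (beta : 'I_N -> R -> R) (rng : 'I_N -> R) (k : R)
  (P : R -> 'I_N -> 'rV[R]_d)
  (HQ : convex_polytope Q)
  (Hphi : {within Q, continuous phi})
  (Hphi01 : forall q, Q q -> 0 <= phi q <= 1)
  (Hbeta01 : forall i (r : R), 0 <= r -> 0 <= beta i r <= 1)
  (Hbeta_incr : forall i (r s : R), 0 <= r -> r < s -> beta i r < beta i s)
  (Hbeta_analytic : forall i, analytic_nonneg (beta i))
  (Hrng : forall i, 0 < rng i)
  (Hrng_eq : forall i j, node beta i (rng i) = node beta j (rng j))
  (Hline : d = 1%N ->
     finite_masses Q phi beta rng /\ negligible_overlaps Q beta)
  (Hk : 0 < k)
  (HP : trajectory Q phi beta rng k P) :
  (forall X : 'I_N -> 'rV[R]_d, configuration Q X ->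
     (forall i, is_gradient Q phi beta rng X i
                  (objective_gradient Q phi beta rng X i)) ->
     (critical_point Q phi beta rng X <->
      forall i, is_gradient Q phi beta rng X i 0)) /\
  (forall e : R, 0 < e ->
     \forall t \near +oo, exists2 X : 'I_N -> 'rV[R]_d,
       critical_point Q phi beta rng X &
       forall i, enorm (P t i - X i) < e).
Proof.
split=> [X [QX _] grad|e e0].
  split=> [[_ crit] i|grad0].
    by have := grad i; rewrite crit.
  by split=> // i; exact: is_gradient_unique (grad i) (grad0 i).
have [d0|d0] := posnP d.
  (* R^0 is a single point, which is critical *)
  have pt (x y : 'rV[R]_d) : x = y by apply/rowP => j; have := ltn_ord j; rewrite {2}d0.
  near=> t; exists (P t).
    split=> i; last exact: pt.
    have t0 : 0 <= t by near: t; exact: nbhs_pinfty_ge (num_real 0).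
    by have [/(_ t t0)[]] := HP.
  by move=> i; rewrite (pt (P t i - P t i) 0) enorm0.
exact: (trajectory_converges HQ Hphi Hphi01 Hbeta_incr Hbeta_analytic Hrng d0
  Hbeta01 Hrng_eq Hline Hk HP e0).
Unshelve. all: by end_near. Qed.
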